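(* Let $\mathbb B$ be the open quaternionic unit ball and let $f:\mathbb B\to\mathbb B$ be a slice regular function with $f(0)=0$. Then for any $q_0\in\mathbb B$ $$|f^h(q_0)|\le\frac{|\partial_Cf(0)|+\frac{2|q_0|}{1+|q_0|^2}}{1+|\partial_Cf(0)|\frac{2|q_0|}{1+|q_0|^2}},$$ where $f^h(q_0)$ is the hyperbolic derivative of $f$ at $q_0$ and $\partial_Cf(0)$ is the Cullen derivative of $f$ at $0$.
   Context: $\mathbb H$ is the skew-field of quaternions, $\mathbb B=\{q\in\mathbb H:|q|<1\}$, $\mathbb S=\{I\in\mathbb H:I^2=-1\}$, $\mathbb C_I=\mathbb R+\mathbb RI$. A function $f:\mathbb B\to\mathbb H$ is slice regular if it has continuous partial derivatives and $\frac12(\partial_x+I\partial_y)f(x+yI)=0$ on $\mathbb B\cap\mathbb C_I$ for every $I\in\mathbb S$; equivalently $f(q)=\sum_{m\ge0}q^ma_m$ with $a_m\in\mathbb H$, converging on $\mathbb B$. The Cullen (regular) derivative is $\partial_Cf(x+yI)=\frac12(\partial_x-I\partial_y)f(x+yI)$, i.e. $\partial_Cf(q)=\sum_{m\ge1}q^{m-1}m\,a_m$. For $f=\sum q^ma_m$, $g=\sum q^mb_m$: $f\ast g=\sum_m q^m\sum_{\ell=0}^m a_{m-\ell}b_\ell$ (constants are regarded as constant functions), $f^c=\sum q^m\overline{a_m}$, $f^s=f\ast f^c$, $f^{-\ast}(q)=f^s(q)^{-1}f^c(q)$, slice regular off the zero set of $f^s$. Hyperbolic difference quotient: for slice regular $f:\mathbb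 B\to\mathbb B$ and $p\in\mathbb B$, let $\mathcal R_{f,p}$ be the unique slice regular function on $\mathbb B$ with $f(q)=f(p)+(q-p)\ast\mathcal R_{f,p}(q)$. Then $f^\star_p(q):=(1-q\overline p)\ast\mathcal R_{f,p}(q)\ast(1-\overline{f(p)}\ast f(q))^{-\ast}$. The hyperbolic derivative of $f$ at $p$ is $f^h(p):=f^\star_p(p)$. *)

(* Defs.v *)
From Stdlib Require Import Reals ClassicalEpsilon.
From Coquelicot Require Import Coquelicot.
Open Scope R_scope.

(** [(a, b, c, d)] is the quaternion a + b i + c j + d k.  As an iterated
    product of [R] it inherits Coquelicot's topology and normed-module
    structure, whose norm is the Euclidean one. *)
Definition H : Type := (R * R * R * R)%type.

Definition re (q : H) : R := fst (fst (fst q)).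
Definition im_i (q : H) : R := snd (fst (fst q)).
Definition im_j (q : H) : R := snd (fst q).
Definition im_k (q : H) : R := snd q.

Definition RtoH (x : R) : H := (x, 0, 0, 0).
Definition Hi : H := (0, 1, 0, 0).

Definition Hadd (p q : H) : H :=
  (re p + re q, im_i p + im_i q, im_j p + im_j q, im_k p + im_k q).
Definition Hopp (q : H) : H := (- re q, - im_i q, - im_j q, - im_k q).
Definition Hmul (p q : H) : H :=
  (re p * re q - im_i p * im_i q - im_j p * im_j q - im_k p * im_k q,
   re p * im_i q + im_i p * re q + im_j p * im_k q - im_k p * im_j q,
   re p * im_j q - im_i p * im_k q + im_j p * re q + im_k p * im_i q,
   re p * im_k q + im_i p * im_j q - im_j p * im_i q + im_k p * re q).
Definition Hconj (q : H) : H := (re q, - im_i q, - im_j q, - im_k q).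
Definition Hnorm (q : H) : R :=
  sqrt (re q ^ 2 + im_i q ^ 2 + im_j q ^ 2 + im_k q ^ 2).

Declare Scope H_scope.
Delimit Scope H_scope with H.
Bind Scope H_scope with H.
Infix "+" := Hadd : H_scope.
Notation "- q" := (Hopp q) : H_scope.
Notation "p - q" := (Hadd p (Hopp q)) : H_scope.
Infix "*" := Hmul : H_scope.

Definition Hinv (q : H) : H := (RtoH (/ Hnorm q ^ 2) * Hconj q)%H.

Fixpoint Hpow (q : H) (m : nat) : H :=
  match m with
  | O => RtoH 1
  | S m' => (q * Hpow q m')%H
  end.

Definition HSeries (u : nat -> H) : H :=
  (Series (fun m => re (u m)), Series (fun m => im_i (u m)),
   Series (fun m => im_j (u m)), Series (fun m => im_k (u m))).

Definition HDerive (g : R -> H) (t : R) : H :=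
  (Derive (fun s => re (g s)) t, Derive (fun s => im_i (g s)) t,
   Derive (fun s => im_j (g s)) t, Derive (fun s => im_k (g s)) t).

Definition in_ball (q : H) : Prop := Hnorm q < 1.

Definition imaginary_unit (I : H) : Prop := (I * I)%H = RtoH (-1).

(** The point x + y I of the slice C_I. *)
Definition slice (I : H) (x y : R) : H := (RtoH x + RtoH y * I)%H.

Definition partial_x (f : H -> H) (I : H) (x y : R) : H :=
  HDerive (fun t => f (slice I t y)) x.
Definition partial_y (f : H -> H) (I : H) (x y : R) : H :=
  HDerive (fun t => f (slice I x t)) y.

(** Functions on the unit ball are represented by total functions [H -> H] whose
    values outside the ball are irrelevant.  Regularity is a condition on the
    restriction of [f] to each slice. *)
Definition slice_regular (f : H -> H) : Prop :=
  forall I : H, imaginary_unit I ->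
  forall x y : R, in_ball (slice I x y) ->
    ex_derive (fun t => f (slice I t y)) x /\
    ex_derive (fun t => f (slice I x t)) y /\
    continuous (fun z : R * R => partial_x f I (fst z) (snd z)) (x, y) /\
    continuous (fun z : R * R => partial_y f I (fst z) (snd z)) (x, y) /\
    (RtoH (/ 2) * (partial_x f I x y + I * partial_y f I x y))%H = RtoH 0.

(** Every q is x + y I with x = re q, y = [im_norm q] and I = [im_dir q].  The
    direction is only determined off the real axis; on it we take I = i, since
    there the Cullen derivative of a slice regular function does not depend on
    I (it equals the partial derivative in x). *)
Definition im_norm (q : H) : R := Hnorm (0, im_i q, im_j q, im_k q).
Definition im_dir (q : H) : H :=
  if Req_EM_T (im_norm q) 0 then Hi
  else (RtoH (/ im_norm q) * (0%R, im_i q, im_j q, im_k q))%H.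

Definition cullen_derivative (f : H -> H) (q : H) : H :=
  let I := im_dir q in
  let x := re q in
  let y := im_norm q in
  (RtoH (/ 2) * (partial_x f I x y - I * partial_y f I x y))%H.

Definition has_expansion (f : H -> H) (a : nat -> H) : Prop :=
  forall q : H, in_ball q -> is_series (fun m => (Hpow q m * a m)%H) (f q).

(** The power series coefficients of [f] at 0: they exist and are unique when
    [f] is slice regular on the ball. *)
Definition coef (f : H -> H) : nat -> H :=
  epsilon (inhabits (fun _ => RtoH 0)) (has_expansion f).

Definition power_series (a : nat -> H) (q : H) : H :=
  HSeries (fun m => (Hpow q m * a m)%H).

Definition star (f g : H -> H) : H -> H :=
  power_series (fun m => sum_n (fun l => (coef f (m - l) * coef g l)%H) m).

Definition regular_conj (f : H -> H) : H -> H :=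
  power_series (fun m => Hconj (coef f m)).

Definition symmetrization (f : H -> H) : H -> H := star f (regular_conj f).

Definition star_inv (f : H -> H) (q : H) : H :=
  (Hinv (symmetrization f q) * regular_conj f q)%H.

Definition is_difference_quotient (f : H -> H) (p : H) (g : H -> H) : Prop :=
  slice_regular g /\
  forall q : H, in_ball q -> f q = (f p + star (fun r => r - p) g q)%H.

(** Unique as a function on the ball when [f] is slice regular. *)
Definition difference_quotient (f : H -> H) (p : H) : H -> H :=
  epsilon (inhabits (fun _ => RtoH 0)) (is_difference_quotient f p).

(** For [f] mapping the ball to itself, the symmetrization of the function being
    inverted has no zero in the ball, so its [star_inv] is slice regular there. *)
Definition hyperbolic_difference_quotient (f : H -> H) (p : H) : H -> H :=
  star
    (star (fun q => RtoH 1 - q * Hconj p)%H (difference_quotient f p))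
    (star_inv (fun q => RtoH 1 - star (fun _ => Hconj (f p)) f q)%H).

Definition hyperbolic_derivative (f : H -> H) (p : H) : H :=
  hyperbolic_difference_quotient f p p.

(* Main.v *)
Require Import Defs.
From Stdlib Require Import Reals Lra Lia Psatz FunctionalExtensionality ClassicalEpsilon.
From Coquelicot Require Import Coquelicot.
Open Scope R_scope.

(** Write f(q) = sum of the q^n a_n, let * be the Cauchy product of coefficient
    sequences (the regular product of functions), and let |x|_N^2 be the sum of the
    |x_n|^2 over n < N.  The two facts behind the inequality are that a bounded slice
    regular function acts by multiplication as a contraction of these norms, and that
    a contraction h satisfies a two-point Schwarz-Pick inequality at 0 and p,

      |h(p)| <= (|h(0)| + |p|) / (1 + |h(0)| |p|).

    It is applied twice.  First h = g with f(q) = q g(q): then g(0) is the Cullen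
    derivative of f at 0.  Second h = the hyperbolic difference quotient of f at p,
    whose value at 0 is g(p), because f(0) = 0, and whose value at p is the hyperbolic
    derivative.  Composing the two bounds, the hyperbolic addition of |p| is performed
    twice, and |p| added to itself is 2 |p| / (1 + |p|^2).

    Contractions.  For z on a slice and x with finitely many terms, (x * a)(z) is the
    sum of the z^m g(z) a_m with g(z) = sum of the z^l x_l, that is g(z) f(z') with
    z' = g(z)^-1 z g(z); so it is bounded by |g(z)| ([power_series_lmul_bound]).
    Averaging over circles and Parseval's identity give |x * a|_N <= |x|_N
    ([bounded_right_contraction]).  What is needed is |a * x|_N <= |x|_N; it is
    obtained by duality ([right_left_contraction]).

    The hyperbolic difference quotient.  With c = f(p), it is
    h = (1 - q conj(p)) * r * e, where (q - p) * r = f - c and e is the inverse of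
    b = 1 - conj(c) * f.  For u = e * x, the norms of b * u = x and of (f - c) * u
    are compared by a pointwise identity ([moebius_identity]), which gives
    |(f - c) * e * x| <= |x|.  Replacing the factor q - p by 1 - q conj(p) costs
    nothing in the limit, since the truncated norms differ by a single boundary term
    that tends to 0 ([blaschke_division]).  That the function defining the regular
    reciprocal is indeed the sum of the series e is [star_inv_expansion]; the inverse
    e has bounded coefficients because conj(c) * f has norm |c| < 1.

    Schwarz-Pick.  Testing the contraction on the vector that the adjoint of h assigns
    to a combination of the reproducing vectors of p and 0 gives the positivity of a
    2 x 2 Pick matrix ([pick_inequality]).

    Expansions.  That slice regular functions are sums of power series is proved on
    each slice by Cauchy's formula with kernel w / (w - z): along the homothety that
    shrinks the circle to the point z, the Cauchy integral has zero derivative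
    ([cauchy_pair]).  Conversely sums of power series are slice regular
    ([expansion_slice_regular]), which provides the difference quotient. *)

(** * Quaternions *)

Lemma H_ext (p q : H) :
  re p = re q -> im_i p = im_i q -> im_j p = im_j q -> im_k p = im_k q -> p = q.
Proof.
  destruct p as [[[? ?] ?] ?], q as [[[? ?] ?] ?]; unfold re, im_i, im_j, im_k.
  cbn [fst snd]; intros; subst; reflexivity.
Qed.

Definition Hsq (q : H) : R := re q ^ 2 + im_i q ^ 2 + im_j q ^ 2 + im_k q ^ 2.

Ltac hunf :=
  unfold Hsq, slice, Hadd, Hopp, Hmul, Hconj, RtoH, Hi;
  unfold re, im_i, im_j, im_k; cbn [fst snd].

(* Compound subterms are turned into variables first, so that unfolding never
   looks inside sums and powers. *)
Ltac habstract t :=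
  lazymatch t with
  | Hadd ?p ?q => habstract p; habstract q
  | Hmul ?p ?q => habstract p; habstract q
  | Hopp ?p => habstract p
  | Hconj ?p => habstract p
  | slice ?p _ _ => habstract p
  | RtoH _ => idtac
  | Hi => idtac
  | (_, _) => idtac
  | _ => first [is_var t | let x := fresh in generalize t; intro x]
  end.

Ltac hring :=
  lazymatch goal with |- ?p = ?q => habstract p; habstract q end;
  repeat match goal with
  | |- context [?x] => is_var x; lazymatch type of x with H => destruct x as [[[? ?] ?] ?] end
  end;
  apply H_ext;
  cbv [Hsq slice Hadd Hopp Hmul Hconj RtoH Hi re im_i im_j im_k fst snd]; ring.

Lemma Hsq_ge0 q : 0 <= Hsq q.
Proof. unfold Hsq; nra. Qed.

Lemma Hsq_mul p q : Hsq (p * q)%H = Hsq p * Hsq q.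
Proof. hunf; ring. Qed.

Lemma Hnorm_sq q : Hnorm q ^ 2 = Hsq q.
Proof. unfold Hnorm; rewrite pow2_sqrt; [reflexivity | apply Hsq_ge0]. Qed.

Lemma Hnorm_ge0 q : 0 <= Hnorm q.
Proof. apply sqrt_pos. Qed.

Lemma norm_Hnorm (q : H) : norm q = Hnorm q.
Proof.
  destruct q as [[[a b] c] d].
  change (sqrt (sqrt (sqrt (Rabs a ^ 2 + Rabs b ^ 2) ^ 2 + Rabs c ^ 2) ^ 2 + Rabs d ^ 2)
          = Hnorm (a, b, c, d)).
  rewrite !pow2_abs, (pow2_sqrt (a ^ 2 + b ^ 2)) by nra.
  rewrite pow2_sqrt by nra; reflexivity.
Qed.

Lemma Hnorm_triangle p q : Hnorm (p + q)%H <= Hnorm p + Hnorm q.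
Proof. rewrite <- !norm_Hnorm; apply (norm_triangle p q). Qed.

Lemma Hnorm_mul p q : Hnorm (p * q)%H = Hnorm p * Hnorm q.
Proof.
  unfold Hnorm; rewrite <- sqrt_mult; try apply Hsq_ge0.
  f_equal; apply (Hsq_mul p q).
Qed.

Lemma Hnorm_ext p q : Hsq p = Hsq q -> Hnorm p = Hnorm q.
Proof. intros E; unfold Hnorm; unfold Hsq in E; now rewrite E. Qed.

Lemma Hnorm_opp q : Hnorm (- q)%H = Hnorm q.
Proof. apply Hnorm_ext; hunf; ring. Qed.

Lemma Hnorm_conj q : Hnorm (Hconj q) = Hnorm q.
Proof. apply Hnorm_ext; hunf; ring. Qed.

Lemma Hsq_conj q : Hsq (Hconj q) = Hsq q.
Proof. hunf; ring. Qed.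

Lemma Hnorm_RtoH x : Hnorm (RtoH x) = Rabs x.
Proof.
  rewrite <- sqrt_Rsqr_abs; unfold Hnorm; f_equal; hunf; unfold Rsqr; ring.
Qed.

Lemma Hnorm_0 : Hnorm (RtoH 0) = 0.
Proof. rewrite Hnorm_RtoH; apply Rabs_R0. Qed.

Lemma Hsq_eq0 q : Hsq q = 0 -> q = RtoH 0.
Proof.
  unfold Hsq; intros E; apply H_ext;
    [change (re q = 0) | change (im_i q = 0) | change (im_j q = 0) | change (im_k q = 0)]; nra.
Qed.

Lemma Hnorm_eq0 q : Hnorm q = 0 -> q = RtoH 0.
Proof. intros E; apply Hsq_eq0; rewrite <- Hnorm_sq, E; ring. Qed.

Lemma Hnorm_sub_sym p q : Hnorm (p - q)%H = Hnorm (q - p)%H.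
Proof. apply Hnorm_ext; hunf; ring. Qed.

Lemma Hnorm_le_sq q C : 0 <= C -> Hsq q <= C ^ 2 -> Hnorm q <= C.
Proof.
  intros hC h; rewrite <- Hnorm_sq in h; pose proof (Hnorm_ge0 q); nra.
Qed.

Lemma Rabs_le_sq x C : 0 <= C -> x ^ 2 <= C ^ 2 -> Rabs x <= C.
Proof. intros hC h; apply Rabs_le; nra. Qed.

Lemma re_le q : Rabs (re q) <= Hnorm q.
Proof. apply Rabs_le_sq; [apply Hnorm_ge0 | rewrite Hnorm_sq; unfold Hsq; nra]. Qed.
Lemma im_i_le q : Rabs (im_i q) <= Hnorm q.
Proof. apply Rabs_le_sq; [apply Hnorm_ge0 | rewrite Hnorm_sq; unfold Hsq; nra]. Qed.
Lemma im_j_le q : Rabs (im_j q) <= Hnorm q.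
Proof. apply Rabs_le_sq; [apply Hnorm_ge0 | rewrite Hnorm_sq; unfold Hsq; nra]. Qed.
Lemma im_k_le q : Rabs (im_k q) <= Hnorm q.
Proof. apply Rabs_le_sq; [apply Hnorm_ge0 | rewrite Hnorm_sq; unfold Hsq; nra]. Qed.

Lemma Hnorm_le_components q C :
  Rabs (re q) <= C -> Rabs (im_i q) <= C -> Rabs (im_j q) <= C -> Rabs (im_k q) <= C ->
  Hnorm q <= 2 * C.
Proof.
  intros h1 h2 h3 h4.
  assert (0 <= C) by (pose proof (Rabs_pos (re q)); lra).
  apply Rabs_le_between in h1, h2, h3, h4.
  apply Hnorm_le_sq; [lra | unfold Hsq; nra].
Qed.

Lemma Hnorm_pow q n : Hnorm (Hpow q n) = Hnorm q ^ n.
Proof.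
  induction n as [|n IH]; simpl.
  - rewrite Hnorm_RtoH; apply Rabs_R1.
  - now rewrite Hnorm_mul, IH.
Qed.

Lemma Hmul_assoc p q r : (p * (q * r) = (p * q) * r)%H.
Proof. hring. Qed.
Lemma Hmul_1l q : (RtoH 1 * q)%H = q.
Proof. hring. Qed.
Lemma Hmul_1r q : (q * RtoH 1)%H = q.
Proof. hring. Qed.
Lemma Hmul_0l q : (RtoH 0 * q)%H = RtoH 0.
Proof. hring. Qed.
Lemma Hmul_0r q : (q * RtoH 0)%H = RtoH 0.
Proof. hring. Qed.
Lemma Hadd_0l q : (RtoH 0 + q)%H = q.
Proof. hring. Qed.
Lemma Hadd_0r q : (q + RtoH 0)%H = q.
Proof. hring. Qed.
Lemma Hadd_comm p q : (p + q = q + p)%H.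
Proof. hring. Qed.
Lemma Hadd_assoc p q r : (p + (q + r) = (p + q) + r)%H.
Proof. hring. Qed.
Lemma Hmul_addl p q r : ((p + q) * r = p * r + q * r)%H.
Proof. hring. Qed.
Lemma Hmul_addr p q r : (p * (q + r) = p * q + p * r)%H.
Proof. hring. Qed.
Lemma Hconj_mul p q : Hconj (p * q)%H = (Hconj q * Hconj p)%H.
Proof. hring. Qed.
Lemma Hconj_add p q : Hconj (p + q)%H = (Hconj p + Hconj q)%H.
Proof. hring. Qed.
Lemma Hconj_conj p : Hconj (Hconj p) = p.
Proof. hring. Qed.
Lemma RtoH_comm x q : (RtoH x * q = q * RtoH x)%H.
Proof. hring. Qed.

Lemma Hsub_eq0 p q : (p - q)%H = RtoH 0 -> p = q.
Proof.
  intros E. assert (q = (q + (p - q))%H) as Eq by (rewrite E; hring).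
  rewrite Eq; hring.
Qed.

Lemma Hinv_l q : q <> RtoH 0 -> (Hinv q * q)%H = RtoH 1.
Proof.
  intros hq; unfold Hinv; rewrite Hnorm_sq.
  assert (Hsq q <> 0) as h by (intros E; apply hq, Hsq_eq0, E).
  rewrite <- Hmul_assoc.
  assert ((Hconj q * q)%H = RtoH (Hsq q)) as -> by hring.
  apply H_ext; hunf; field; exact h.
Qed.

Lemma Hinv_r q : q <> RtoH 0 -> (q * Hinv q)%H = RtoH 1.
Proof.
  intros hq; unfold Hinv; rewrite Hnorm_sq.
  assert (Hsq q <> 0) as h by (intros E; apply hq, Hsq_eq0, E).
  rewrite RtoH_comm, Hmul_assoc.
  assert ((q * Hconj q)%H = RtoH (Hsq q)) as -> by hring.
  apply H_ext; hunf; field; exact h.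
Qed.

Lemma Hmul_eq0 p q : p <> RtoH 0 -> (p * q)%H = RtoH 0 -> q = RtoH 0.
Proof.
  intros hp E. rewrite <- (Hmul_1l q), <- (Hinv_l p hp), <- Hmul_assoc, E; hring.
Qed.

Lemma Hpow_comm q n : (Hpow q n * q = q * Hpow q n)%H.
Proof.
  induction n as [|n IH]; cbn [Hpow]; [hring|].
  now rewrite <- Hmul_assoc, IH.
Qed.

Lemma Hpow_add q m n : Hpow q (m + n) = (Hpow q m * Hpow q n)%H.
Proof.
  induction m as [|m IH]; cbn [Hpow Nat.add]; [now rewrite Hmul_1l|].
  now rewrite IH, Hmul_assoc.
Qed.

Lemma Hpow_commute p q n : (p * q = q * p)%H -> (Hpow p n * q = q * Hpow p n)%H.
Proof.
  intros E; induction n as [|n IH]; cbn [Hpow]; [hring|].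
  now rewrite <- Hmul_assoc, IH, Hmul_assoc, E, Hmul_assoc.
Qed.

Lemma Hpow_mul p q n : (p * q = q * p)%H -> Hpow (p * q)%H n = (Hpow p n * Hpow q n)%H.
Proof.
  intros E; induction n as [|n IH]; cbn [Hpow]; [hring|].
  rewrite IH.
  rewrite <- !Hmul_assoc. f_equal. rewrite !Hmul_assoc. f_equal.
  symmetry; apply Hpow_commute, E.
Qed.

Lemma Hpow_conj q n : Hpow (Hconj q) n = Hconj (Hpow q n).
Proof.
  induction n as [|n IH]; cbn [Hpow]; [hring|].
  now rewrite Hconj_mul, IH, <- IH, Hpow_comm.
Qed.

Lemma Hpow_RtoH x n : Hpow (RtoH x) n = RtoH (x ^ n).
Proof. induction n as [|n IH]; cbn [Hpow pow]; [reflexivity | rewrite IH; hring]. Qed.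

Lemma RtoH_mul x y : (RtoH x * RtoH y)%H = RtoH (x * y).
Proof. hring. Qed.

(** * Finite sums and series *)

Fixpoint hsum (u : nat -> H) (n : nat) : H :=
  match n with O => RtoH 0 | S m => (hsum u m + u m)%H end.

Lemma sum_n_hsum u n : sum_n u n = hsum u (S n).
Proof.
  induction n as [|n IH].
  - rewrite sum_O; simpl; now rewrite Hadd_0l.
  - rewrite sum_Sn, IH. reflexivity.
Qed.

Lemma hsum_ext u v n : (forall k, (k < n)%nat -> u k = v k) -> hsum u n = hsum v n.
Proof.
  induction n as [|n IH]; intros E; simpl; [reflexivity|].
  rewrite IH, E; auto.
Qed.

Lemma hsum_mull c u n : hsum (fun k => c * u k)%H n = (c * hsum u n)%H.
Proof. induction n as [|n IH]; simpl; [hring | rewrite IH; hring]. Qed.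

Lemma hsum_add u v n : hsum (fun k => u k + v k)%H n = (hsum u n + hsum v n)%H.
Proof. induction n as [|n IH]; simpl; [hring | rewrite IH; hring]. Qed.

Lemma hsum_shift u n : hsum u (S n) = (u O + hsum (fun k => u (S k)) n)%H.
Proof.
  induction n as [|n IH]; [simpl; hring|].
  change (hsum u (S (S n))) with (hsum u (S n) + u (S n))%H. rewrite IH; simpl; hring.
Qed.

Definition Hlim (s : nat -> H) (l : H) : Prop :=
  forall eps, 0 < eps -> exists N, forall n, (N <= n)%nat -> Hnorm (s n - l)%H < eps.

Lemma minus_Hsub (x y : H) : minus x y = (x - y)%H.
Proof. reflexivity. Qed.

Lemma is_series_Hlim (u : nat -> H) (l : H) : is_series u l <-> Hlim (hsum u) l.
Proof.
  unfold is_series; split.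
  - intros h eps heps.
    destruct (proj1 (filterlim_locally_ball_norm _ _) h (mkposreal _ heps)) as [N hN].
    exists (S N); intros n hn. destruct n as [|n]; [lia|].
    specialize (hN n ltac:(lia)). unfold ball_norm in hN.
    rewrite norm_Hnorm, minus_Hsub, sum_n_hsum in hN. exact hN.
  - intros h; apply filterlim_locally_ball_norm; intros [eps heps].
    destruct (h eps heps) as [N hN]. exists N; intros n hn.
    unfold ball_norm; rewrite norm_Hnorm, minus_Hsub, sum_n_hsum; apply hN; lia.
Qed.

Lemma Hnorm_small_eq0 q : (forall eps, 0 < eps -> Hnorm q < eps) -> q = RtoH 0.
Proof.
  intros h; apply Hnorm_eq0. destruct (Rle_lt_or_eq_dec _ _ (Hnorm_ge0 q)) as [h'|h'].
  - specialize (h _ h'); lra.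
  - now rewrite <- h'.
Qed.

Lemma Hlim_unique s l l' : Hlim s l -> Hlim s l' -> l = l'.
Proof.
  intros h h'; apply Hsub_eq0, Hnorm_small_eq0; intros eps heps.
  destruct (h (eps / 2) ltac:(lra)) as [N hN], (h' (eps / 2) ltac:(lra)) as [N' hN'].
  specialize (hN (N + N')%nat ltac:(lia)); specialize (hN' (N + N')%nat ltac:(lia)).
  replace (l - l')%H with ((l - s (N + N')%nat) + (s (N + N')%nat - l'))%H by hring.
  eapply Rle_lt_trans; [apply Hnorm_triangle|]. rewrite (Hnorm_sub_sym l); lra.
Qed.

Lemma Hlim_ext s t l : (forall n, s n = t n) -> Hlim s l -> Hlim t l.
Proof. intros E h eps heps; destruct (h eps heps) as [N hN]; exists N; intros; rewrite <- E; auto. Qed.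

Lemma Hlim_add s t l m : Hlim s l -> Hlim t m -> Hlim (fun n => s n + t n)%H (l + m)%H.
Proof.
  intros h h' eps heps.
  destruct (h (eps / 2) ltac:(lra)) as [N hN], (h' (eps / 2) ltac:(lra)) as [N' hN'].
  exists (N + N')%nat; intros n hn.
  specialize (hN n ltac:(lia)); specialize (hN' n ltac:(lia)).
  replace (s n + t n - (l + m))%H with ((s n - l) + (t n - m))%H by hring.
  eapply Rle_lt_trans; [apply Hnorm_triangle|]; lra.
Qed.

Lemma Hlim_mull c s l : Hlim s l -> Hlim (fun n => c * s n)%H (c * l)%H.
Proof.
  intros h eps heps. pose proof (Hnorm_ge0 c).
  assert (0 < eps / (1 + Hnorm c)) as h1 by (apply Rdiv_lt_0_compat; lra).
  destruct (h _ h1) as [N hN]; exists N; intros n hn; specialize (hN n hn).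
  replace (c * s n - c * l)%H with (c * (s n - l))%H by hring.
  rewrite Hnorm_mul. apply Rmult_lt_compat_l with (r := 1 + Hnorm c) in hN; [|lra].
  replace ((1 + Hnorm c) * (eps / (1 + Hnorm c))) with eps in hN by (field; lra).
  pose proof (Hnorm_ge0 (s n - l)%H); nra.
Qed.

Lemma Hlim_shift s l : Hlim s l <-> Hlim (fun n => s (S n)) l.
Proof.
  split; intros h eps heps; destruct (h eps heps) as [N hN].
  - exists N; intros; apply hN; lia.
  - exists (S N); intros [|n] hn; [lia | apply hN; lia].
Qed.

Lemma pow_small lam C eps :
  0 <= lam < 1 -> 0 < eps -> exists N, forall n, (N <= n)%nat -> C * lam ^ n < eps.
Proof.
  intros hl heps.
  assert (0 < eps / (1 + Rabs C)) as h1
    by (apply Rdiv_lt_0_compat; [lra | pose proof (Rabs_pos C); lra]).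
  destruct (pow_lt_1_zero lam ltac:(rewrite Rabs_pos_eq; lra) _ h1) as [N hN].
  exists N; intros n hn; specialize (hN n hn).
  pose proof (pow_le lam n (proj1 hl)) as hp. rewrite Rabs_pos_eq in hN by exact hp.
  pose proof (Rabs_pos C). pose proof (Rle_abs C).
  apply Rmult_lt_compat_l with (r := 1 + Rabs C) in hN; [|lra].
  replace ((1 + Rabs C) * (eps / (1 + Rabs C))) with eps in hN by (field; lra).
  nra.
Qed.

Lemma Hlim_geom s l lam C :
  0 <= lam < 1 -> (forall n, Hnorm (s n - l)%H <= C * lam ^ n) -> Hlim s l.
Proof.
  intros hl h eps heps; destruct (pow_small lam C eps hl heps) as [N hN].
  exists N; intros n hn; eapply Rle_lt_trans; [apply h | auto].
Qed.

Lemma Hlim_norm_le s l C : Hlim s l -> (forall n, Hnorm (s n) <= C) -> Hnorm l <= C.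
Proof.
  intros h hC; apply Rnot_lt_le; intros hlt.
  destruct (h (Hnorm l - C) ltac:(lra)) as [N hN]; specialize (hN N (le_n _)); specialize (hC N).
  pose proof (Hnorm_triangle (s N) (l - s N)%H) as ht.
  replace (s N + (l - s N))%H with l in ht by hring. rewrite Hnorm_sub_sym in ht; lra.
Qed.

(** Convergence and differentiation are reduced to the four real coordinates; each
    of them is an additive map that is bounded by the norm. *)
Lemma component_is_series (pi : H -> R) (u : nat -> H) (l : H) :
  (forall x y, pi (x + y)%H = pi x + pi y) -> (forall x, pi (- x)%H = - pi x) ->
  pi (RtoH 0) = 0 -> (forall x, Rabs (pi x) <= Hnorm x) ->
  is_series u l -> is_series (fun n => pi (u n)) (pi l).
Proof.
  intros hadd hopp h0 hle hs.
  unfold is_series; apply filterlim_locally; intros [eps heps].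
  destruct (proj1 (is_series_Hlim _ _) hs eps heps) as [N hN].
  exists N; intros n hn. specialize (hN (S n) ltac:(lia)).
  change (Rabs (sum_n (fun n => pi (u n)) n - pi l) < eps).
  replace (sum_n (fun n => pi (u n)) n) with (pi (hsum u (S n))).
  - unfold Rminus; rewrite <- hopp, <- hadd. eapply Rle_lt_trans; [apply hle | exact hN].
  - clear hN hn. induction n as [|n IH].
    + rewrite sum_O. simpl; rewrite Hadd_0l; reflexivity.
    + rewrite sum_Sn, <- IH. change (hsum u (S (S n))) with (hsum u (S n) + u (S n))%H.
      apply hadd.
Qed.

Lemma is_series_re (u : nat -> H) (l : H) : is_series u l -> is_series (fun n => re (u n)) (re l).
Proof.
  apply component_is_series; try (intros; hunf; ring); auto using re_le.
Qed.
Lemma is_series_im_i (u : nat -> H) (l : H) : is_series u l -> is_series (fun n => im_i (u n)) (im_i l).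
Proof. apply component_is_series; try (intros; hunf; ring); auto using im_i_le. Qed.
Lemma is_series_im_j (u : nat -> H) (l : H) : is_series u l -> is_series (fun n => im_j (u n)) (im_j l).
Proof. apply component_is_series; try (intros; hunf; ring); auto using im_j_le. Qed.
Lemma is_series_im_k (u : nat -> H) (l : H) : is_series u l -> is_series (fun n => im_k (u n)) (im_k l).
Proof. apply component_is_series; try (intros; hunf; ring); auto using im_k_le. Qed.

Lemma HSeries_unique (u : nat -> H) (l : H) : is_series u l -> HSeries u = l.
Proof.
  intros h; unfold HSeries; apply H_ext; cbn.
  - apply is_series_unique, is_series_re, h.
  - apply is_series_unique, is_series_im_i, h.
  - apply is_series_unique, is_series_im_j, h.
  - apply is_series_unique, is_series_im_k, h.
Qed.

(** Growth of the coefficients of a power series converging in the whole ball.  This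
    form, unlike convergence itself, is visibly stable under Cauchy products. *)
Definition tame (a : nat -> H) : Prop :=
  forall rho, 0 <= rho < 1 -> exists C, 0 <= C /\ forall n, Hnorm (a n) * rho ^ n <= C.

(** Comparison with a slightly larger radius turns boundedness into geometric decay. *)
Lemma tame_geom a rho :
  tame a -> 0 <= rho < 1 ->
  exists C lam, 0 <= C /\ 0 <= lam < 1 /\ forall n, Hnorm (a n) * rho ^ n <= C * lam ^ n.
Proof.
  intros ha hr. set (s := (1 + rho) / 2).
  destruct (ha s ltac:(unfold s; lra)) as [C [hC h]].
  exists C, (rho / s). split; [exact hC|]. split.
  - split; [apply Rdiv_le_0_compat; unfold s; lra|].
    apply Rlt_div_l; unfold s; lra.
  - intros n. specialize (h n).
    replace rho with (s * (rho / s)) at 1 by (unfold s; field; lra).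
    rewrite Rpow_mult_distr, <- Rmult_assoc.
    apply Rmult_le_compat_r; [|exact h].
    apply pow_le, Rdiv_le_0_compat; unfold s; lra.
Qed.

Lemma geom_sum_le lam n : 0 <= lam < 1 -> INR (S n) * lam ^ n <= / (1 - lam).
Proof.
  intros hl.
  assert (INR (S n) * lam ^ n <= (1 - lam ^ S n) / (1 - lam)) as h.
  { apply (proj1 (Rle_div_r _ _ (1 - lam) ltac:(lra))).
    induction n as [|n IH].
    - simpl; lra.
    - rewrite S_INR. change (lam ^ S (S n)) with (lam * lam ^ S n).
      change (lam ^ S n) with (lam * lam ^ n) in *.
      pose proof (pow_le lam n (proj1 hl)).
      assert (lam ^ n <= 1) by (rewrite <- (pow1 n); apply pow_incr; lra).
      set (x := lam ^ n) in *. set (m := INR (S n)) in *.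
      assert (lam * (m * x * (1 - lam)) <= lam * (1 - lam * x)) by (apply Rmult_le_compat_l; lra).
      assert (0 <= (1 - lam) * (1 - lam * x)) by (apply Rmult_le_pos; nra).
      nra. }
  eapply Rle_trans; [exact h|]. unfold Rdiv.
  pose proof (pow_le lam (S n) (proj1 hl)).
  assert (0 < / (1 - lam)) by (apply Rinv_0_lt_compat; lra). nra.
Qed.

Lemma lin_geom mu :
  0 <= mu < 1 ->
  exists K nu, 0 <= K /\ 0 <= nu < 1 /\ forall n, INR (S n) * mu ^ n <= K * nu ^ n.
Proof.
  intros hm. set (nu := (1 + mu) / 2).
  assert (0 <= mu / nu < 1) as hl.
  { split; [apply Rdiv_le_0_compat; unfold nu; lra|]. apply Rlt_div_l; unfold nu; lra. }
  exists (/ (1 - mu / nu)), nu. split; [|split].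
  - left; apply Rinv_0_lt_compat; lra.
  - unfold nu; lra.
  - intros n. replace mu with ((mu / nu) * nu) at 1 by (unfold nu; field; lra).
    rewrite Rpow_mult_distr, <- Rmult_assoc.
    apply Rmult_le_compat_r; [apply pow_le; unfold nu; lra|].
    now apply geom_sum_le.
Qed.

Lemma hsum_norm_le u n c :
  (forall k, (k < n)%nat -> Hnorm (u k) <= c) -> Hnorm (hsum u n) <= INR n * c.
Proof.
  induction n as [|n IH]; intros h.
  - simpl; rewrite Hnorm_0; lra.
  - rewrite S_INR; cbn [hsum]. eapply Rle_trans; [apply Hnorm_triangle|].
    pose proof (h n ltac:(lia)). pose proof (IH ltac:(auto)). lra.
Qed.

Lemma hsum_geom_diff u C lam n k :
  0 <= C -> 0 <= lam < 1 -> (forall n, Hnorm (u n) <= C * lam ^ n) ->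
  Hnorm (hsum u (n + k)%nat - hsum u n)%H <= C / (1 - lam) * lam ^ n.
Proof.
  intros hC hl hu.
  assert (Hnorm (hsum u (n + k)%nat - hsum u n)%H <= C * lam ^ n * (1 - lam ^ k) / (1 - lam)) as h.
  { apply (proj1 (Rle_div_r _ _ (1 - lam) ltac:(lra))). induction k as [|k IH].
    - rewrite Nat.add_0_r. replace (hsum u n - hsum u n)%H with (RtoH 0) by hring.
      rewrite Hnorm_0; simpl; lra.
    - rewrite Nat.add_succ_r; cbn [hsum].
      replace (hsum u (n + k)%nat + u (n + k)%nat - hsum u n)%H
        with ((hsum u (n + k)%nat - hsum u n) + u (n + k)%nat)%H by hring.
      pose proof (Hnorm_triangle (hsum u (n + k)%nat - hsum u n)%H (u (n + k)%nat)).
      pose proof (hu (n + k)%nat). rewrite pow_add in *. simpl pow. nra. }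
  eapply Rle_trans; [exact h|]. unfold Rdiv.
  pose proof (pow_le lam n (proj1 hl)). pose proof (pow_le lam k (proj1 hl)).
  assert (0 < / (1 - lam)) by (apply Rinv_0_lt_compat; lra).
  assert (0 <= C * / (1 - lam) * lam ^ n).
  { apply Rmult_le_pos; [apply Rmult_le_pos|]; lra. }
  nra.
Qed.

Lemma ex_series_geom (u : nat -> R) C lam :
  0 <= lam < 1 -> (forall n, Rabs (u n) <= C * lam ^ n) -> ex_series u.
Proof.
  intros hl h. apply (ex_series_le u (fun n => C * lam ^ n)); [exact h|].
  apply (ex_series_scal_l (V := R_NormedModule) C), ex_series_geom.
  rewrite Rabs_pos_eq; lra.
Qed.

Lemma is_series_components (u : nat -> H) (l : H) :
  is_series (fun n => re (u n)) (re l) -> is_series (fun n => im_i (u n)) (im_i l) ->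
  is_series (fun n => im_j (u n)) (im_j l) -> is_series (fun n => im_k (u n)) (im_k l) ->
  is_series u l.
Proof.
  intros h1 h2 h3 h4. apply is_series_Hlim. intros eps heps.
  assert (0 < eps / 4) as he by lra.
  destruct (proj1 (filterlim_locally _ _) h1 (mkposreal _ he)) as [N1 H1].
  destruct (proj1 (filterlim_locally _ _) h2 (mkposreal _ he)) as [N2 H2].
  destruct (proj1 (filterlim_locally _ _) h3 (mkposreal _ he)) as [N3 H3].
  destruct (proj1 (filterlim_locally _ _) h4 (mkposreal _ he)) as [N4 H4].
  exists (S (N1 + N2 + N3 + N4)); intros [|n] hn; [lia|].
  specialize (H1 n ltac:(lia)); specialize (H2 n ltac:(lia));
  specialize (H3 n ltac:(lia)); specialize (H4 n ltac:(lia)).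
  assert (forall pi : H -> R, (forall x y, pi (x + y)%H = pi x + pi y) -> pi (RtoH 0) = 0 ->
    sum_n (fun k => pi (u k)) n = pi (hsum u (S n))) as E.
  { intros pi hadd h0. clear -hadd h0. induction n as [|n IH].
    - rewrite sum_O; simpl; now rewrite Hadd_0l.
    - rewrite sum_Sn, IH. change (hsum u (S (S n))) with (hsum u (S n) + u (S n))%H.
      now rewrite hadd. }
  apply Rle_lt_trans with (2 * (eps / 4)); [|lra].
  rewrite !E in * by (intros; hunf; ring).
  apply Hnorm_le_components; left; assumption.
Qed.

Lemma geom_converges u C lam :
  0 <= C -> 0 <= lam < 1 -> (forall n, Hnorm (u n) <= C * lam ^ n) ->
  is_series u (HSeries u) /\
  forall n, Hnorm (hsum u n - HSeries u)%H <= C / (1 - lam) * lam ^ n.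
Proof.
  intros hC hl hu.
  assert (is_series u (HSeries u)) as hs.
  { apply is_series_components; apply Series_correct;
      apply ex_series_geom with C lam; trivial; intros n; (eapply Rle_trans; [|apply hu]);
      auto using re_le, im_i_le, im_j_le, im_k_le. }
  split; [exact hs|]. intros n.
  rewrite Hnorm_sub_sym.
  apply Hlim_norm_le with (fun k => hsum u (n + k)%nat - hsum u n)%H.
  - apply (Hlim_add _ (fun _ => - hsum u n)%H).
    + intros eps heps. destruct (proj1 (is_series_Hlim _ _) hs eps heps) as [N hN].
      exists N; intros; apply hN; lia.
    + intros eps heps; exists O; intros. replace (- hsum u n - - hsum u n)%H with (RtoH 0) by hring.
      now rewrite Hnorm_0.
  - intros k; now apply hsum_geom_diff.
Qed.

(** The rate depends only on the radius; the uniformity is what allows averaging over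
    circles. *)
Lemma power_series_uniform a rho :
  tame a -> 0 <= rho < 1 ->
  exists C lam, 0 <= C /\ 0 <= lam < 1 /\ forall q, Hnorm q <= rho -> forall n,
    Hnorm (hsum (fun m => Hpow q m * a m)%H n - power_series a q)%H <= C * lam ^ n.
Proof.
  intros ha hr. destruct (tame_geom a rho ha hr) as [C [lam [hC [hl h]]]].
  exists (C / (1 - lam)), lam. split; [apply Rdiv_le_0_compat; lra|]. split; [exact hl|].
  intros q hq. apply geom_converges; trivial.
  intros n. rewrite Hnorm_mul, Hnorm_pow, Rmult_comm. eapply Rle_trans; [|apply h].
  apply Rmult_le_compat_l; [apply Hnorm_ge0|]. apply pow_incr; split; [apply Hnorm_ge0 | exact hq].
Qed.

Lemma power_series_Hlim a q :
  tame a -> in_ball q -> Hlim (hsum (fun m => Hpow q m * a m)%H) (power_series a q).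
Proof.
  intros ha hq.
  destruct (power_series_uniform a (Hnorm q) ha (conj (Hnorm_ge0 q) hq)) as [C [lam [hC [hl h]]]].
  apply Hlim_geom with lam C; [exact hl|]. apply h, Rle_refl.
Qed.

Lemma power_series_expansion a : tame a -> has_expansion (power_series a) a.
Proof. intros ha q hq; apply is_series_Hlim, power_series_Hlim; assumption. Qed.

Lemma has_expansion_power_series f a q : has_expansion f a -> in_ball q -> f q = power_series a q.
Proof. intros h hq; symmetry; apply HSeries_unique, h, hq. Qed.

Lemma has_expansion_ext f g a :
  (forall q, in_ball q -> f q = g q) -> has_expansion f a -> has_expansion g a.
Proof. intros E h q hq; rewrite <- E by exact hq; apply h, hq. Qed.

Lemma Hlim_bounded s l : Hlim s l -> exists M, 0 <= M /\ forall n, Hnorm (s n) <= M.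
Proof.
  intros h. destruct (h 1 ltac:(lra)) as [N hN].
  assert (exists M, 0 <= M /\ forall n, (n < N)%nat -> Hnorm (s n) <= M) as [M [hM0 hM]].
  { clear hN. induction N as [|N [M [hM0 hM]]].
    - exists 0; split; [lra | intros; lia].
    - exists (M + Hnorm (s N)). pose proof (Hnorm_ge0 (s N)). split; [lra|].
      intros n hn. destruct (Nat.eq_dec n N) as [->|]; [lra|].
      specialize (hM n ltac:(lia)); lra. }
  exists (M + (Hnorm l + 1)). pose proof (Hnorm_ge0 l). split; [lra|].
  intros n. destruct (Nat.lt_ge_cases n N) as [hn|hn].
  - specialize (hM n hn); lra.
  - specialize (hN n hn). pose proof (Hnorm_triangle (s n - l)%H l) as ht.
    replace (s n - l + l)%H with (s n) in ht by hring. lra.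
Qed.

Lemma has_expansion_tame f a : has_expansion f a -> tame a.
Proof.
  intros h rho hr.
  assert (in_ball (RtoH rho)) as hq by (unfold in_ball; rewrite Hnorm_RtoH, Rabs_pos_eq; lra).
  destruct (Hlim_bounded _ _ (proj1 (is_series_Hlim _ _) (h _ hq))) as [M [hM0 hM]].
  exists (M + M); split; [lra|]. intros n.
  set (u := fun m => (Hpow (RtoH rho) m * a m)%H) in hM.
  replace (Hnorm (a n) * rho ^ n) with (Hnorm (u n)).
  - replace (u n) with (hsum u (S n) + - hsum u n)%H by (simpl; hring).
    eapply Rle_trans; [apply Hnorm_triangle|]. rewrite Hnorm_opp.
    apply Rplus_le_compat; apply hM.
  - unfold u; rewrite Hnorm_mul, Hpow_RtoH, Hnorm_RtoH, Rabs_pos_eq by (apply pow_le; lra). ring.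
Qed.

Lemma real_series_unique (a b : nat -> R) r :
  0 < r ->
  (forall x, Rabs x < r -> exists l : R, is_series (fun n => x ^ n * a n) l
                                  /\ is_series (fun n => x ^ n * b n) l) ->
  forall n, a n = b n.
Proof.
  intros hr h n.
  assert (forall c : nat -> R, (forall x, Rabs x < r -> ex_series (fun n => x ^ n * c n)) ->
          Rbar_lt 0 (CV_radius c)) as hrad.
  { intros c hc. apply Rbar_lt_le_trans with (r / 2); [simpl; lra|].
    apply (proj1 (CV_radius_bounded c)).
    destruct (hc (r / 2)) as [l hl]; [rewrite Rabs_pos_eq; lra|].
    destruct (filterlim_bounded (fun n => c n * (r / 2) ^ n)) as [M hM].
    - exists 0. change (is_lim_seq (fun n => c n * (r / 2) ^ n) 0).
      apply (is_lim_seq_ext (fun n => (r / 2) ^ n * c n)); [intros; ring|].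
      apply ex_series_lim_0; exists l; exact hl.
    - exists M; exact hM. }
  apply (PSeries_ext_recip a b n).
  - apply hrad; intros x hx; destruct (h x hx) as [l [h1 _]]; now exists l.
  - apply hrad; intros x hx; destruct (h x hx) as [l [_ h1]]; now exists l.
  - exists (mkposreal r hr); intros x hx.
    assert (Rabs x < r) as hx'.
    { unfold ball in hx; simpl in hx; unfold AbsRing_ball, abs, minus, plus, opp in hx; simpl in hx.
      now rewrite Ropp_0, Rplus_0_r in hx. }
    destruct (h x hx') as [l [h1 h2]].
    unfold PSeries. rewrite (Series_ext _ (fun n => x ^ n * a n)), (Series_ext (fun k => b k * x ^ k) (fun n => x ^ n * b n))
      by (intros; ring).
    now rewrite (is_series_unique _ _ h1), (is_series_unique _ _ h2).
Qed.

(** Real points belong to every slice.  Hence coefficients found on different slices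
    or circles agree as soon as they represent the same function near 0 on the real axis. *)
Lemma coefficients_unique a b r :
  0 < r ->
  (forall x, Rabs x < r -> exists l : H, is_series (fun n => Hpow (RtoH x) n * a n)%H l
                                  /\ is_series (fun n => Hpow (RtoH x) n * b n)%H l) ->
  a = b.
Proof.
  intros hr h; apply functional_extensionality; intros n.
  apply H_ext; revert n; apply real_series_unique with r; trivial; intros x hx;
    destruct (h x hx) as [l [h1 h2]].
  - exists (re l); split; eapply is_series_ext; [|apply is_series_re, h1| |apply is_series_re, h2];
      intros n; cbn; rewrite Hpow_RtoH; hunf; ring.
  - exists (im_i l); split; eapply is_series_ext; [|apply is_series_im_i, h1| |apply is_series_im_i, h2];
      intros n; cbn; rewrite Hpow_RtoH; hunf; ring.
  - exists (im_j l); split; eapply is_series_ext; [|apply is_series_im_j, h1| |apply is_series_im_j, h2];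
      intros n; cbn; rewrite Hpow_RtoH; hunf; ring.
  - exists (im_k l); split; eapply is_series_ext; [|apply is_series_im_k, h1| |apply is_series_im_k, h2];
      intros n; cbn; rewrite Hpow_RtoH; hunf; ring.
Qed.

Lemma has_expansion_unique f a b : has_expansion f a -> has_expansion f b -> a = b.
Proof.
  intros ha hb; apply coefficients_unique with 1; [lra|]; intros x hx.
  assert (in_ball (RtoH x)) as hq by (unfold in_ball; now rewrite Hnorm_RtoH).
  exists (f (RtoH x)); split; auto.
Qed.

Lemma coef_eq f a : has_expansion f a -> coef f = a.
Proof.
  intros h; apply has_expansion_unique with f; [|exact h].
  unfold coef; apply epsilon_spec; now exists a.
Qed.

(** * Cauchy products *)

Definition shift (a : nat -> H) : nat -> H := fun n => a (S n).

(** The recursion, by removal of the first coefficient of the left factor, makes the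
    algebraic laws provable by induction on the degree; [conv_hsum] is the usual formula. *)
Fixpoint conv (a b : nat -> H) (n : nat) : H :=
  match n with
  | O => (a O * b O)%H
  | S m => (conv (shift a) b m + a O * b (S m))%H
  end.

Lemma conv_hsum a b n : conv a b n = hsum (fun l => a (n - l)%nat * b l)%H (S n).
Proof.
  revert a; induction n as [|n IH]; intros a; cbn [conv].
  - simpl; now rewrite Hadd_0l.
  - change (hsum (fun l => a (S n - l)%nat * b l)%H (S (S n)))
      with (hsum (fun l => a (S n - l)%nat * b l)%H (S n) + a (S n - S n)%nat * b (S n))%H.
    rewrite Nat.sub_diag, IH. f_equal. apply hsum_ext; intros k hk.
    unfold shift. now replace (S n - k)%nat with (S (n - k)) by lia.
Qed.

Lemma star_conv f g a b :
  has_expansion f a -> has_expansion g b -> star f g = power_series (conv a b).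
Proof.
  intros ha hb; unfold star. rewrite (coef_eq f a ha), (coef_eq g b hb).
  f_equal; apply functional_extensionality; intros n. now rewrite sum_n_hsum, <- conv_hsum.
Qed.

Definition addseq (a b : nat -> H) : nat -> H := fun n => (a n + b n)%H.
Definition lmul (c : H) (a : nat -> H) : nat -> H := fun n => (c * a n)%H.
Definition rmul (a : nat -> H) (c : H) : nat -> H := fun n => (a n * c)%H.
Definition conjseq (a : nat -> H) : nat -> H := fun n => Hconj (a n).
Definition delta (c : H) : nat -> H := fun n => match n with O => c | _ => RtoH 0 end.

Lemma conv_S_r a b n : conv a b (S n) = (a (S n) * b O + conv a (shift b) n)%H.
Proof.
  revert a; induction n as [|n IH]; intros a.
  - cbn [conv]; unfold shift; reflexivity.
  - change (conv a b (S (S n))) with (conv (shift a) b (S n) + a O * b (S (S n)))%H.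
    rewrite IH. cbn [conv]. unfold shift. hring.
Qed.

Lemma conv_addl a b c n : conv (addseq a b) c n = (conv a c n + conv b c n)%H.
Proof.
  revert a b; induction n as [|n IH]; intros a b; cbn [conv]; [unfold addseq; hring|].
  change (shift (addseq a b)) with (addseq (shift a) (shift b)).
  rewrite IH; unfold addseq; hring.
Qed.

Lemma conv_lmul d a b n : conv (lmul d a) b n = (d * conv a b n)%H.
Proof.
  revert a; induction n as [|n IH]; intros a; cbn [conv]; [unfold lmul; hring|].
  change (shift (lmul d a)) with (lmul d (shift a)).
  rewrite IH; unfold lmul; hring.
Qed.

Lemma conv_assoc a b c : conv a (conv b c) = conv (conv a b) c.
Proof.
  apply functional_extensionality; intros n; revert a b.
  induction n as [|n IH]; intros a b; cbn [conv]; [apply Hmul_assoc|].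
  change (shift (conv a b)) with (addseq (conv (shift a) b) (lmul (a O) (shift b))).
  rewrite conv_addl, conv_lmul, <- IH. hring.
Qed.

Lemma conv_zero_l b n : conv (fun _ => RtoH 0) b n = RtoH 0.
Proof.
  induction n as [|n IH]; cbn [conv]; [hring|].
  change (shift (fun _ => RtoH 0)) with (fun _ : nat => RtoH 0). rewrite IH; hring.
Qed.

Lemma conv_delta_l c b n : conv (delta c) b n = (c * b n)%H.
Proof.
  destruct n as [|n]; cbn [conv]; [reflexivity|].
  change (shift (delta c)) with (fun _ : nat => RtoH 0). rewrite conv_zero_l; simpl; hring.
Qed.

Lemma conv_delta_r a c n : conv a (delta c) n = (a n * c)%H.
Proof.
  revert a; induction n as [|n IH]; intros a; cbn [conv]; [reflexivity|].
  rewrite IH; unfold shift; simpl; hring.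
Qed.

Lemma conv_delta1_l b : conv (delta (RtoH 1)) b = b.
Proof. apply functional_extensionality; intros n; rewrite conv_delta_l; hring. Qed.

Lemma conv_delta1_r a : conv a (delta (RtoH 1)) = a.
Proof. apply functional_extensionality; intros n; rewrite conv_delta_r; hring. Qed.

Lemma conv_conj a b : conjseq (conv a b) = conv (conjseq b) (conjseq a).
Proof.
  apply functional_extensionality; intros n; unfold conjseq at 1; revert a.
  induction n as [|n IH]; intros a.
  - cbn [conv]; unfold conjseq; apply Hconj_mul.
  - rewrite (conv_S_r (conjseq b)). cbn [conv]. rewrite Hconj_add, IH, Hconj_mul.
    apply Hadd_comm.
Qed.

Lemma conv_real_comm s a : (forall n, s n = RtoH (re (s n))) -> conv s a = conv a s.
Proof.
  intros hs; apply functional_extensionality; intros n; revert s hs.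
  induction n as [|n IH]; intros s hs.
  - cbn [conv]; rewrite hs; apply RtoH_comm.
  - rewrite (conv_S_r a). cbn [conv].
    rewrite IH by (intros; apply hs). rewrite (hs O), RtoH_comm. apply Hadd_comm.
Qed.

(** The equation determines each coefficient of the inverse by the previous ones. *)
Lemma conv_right_inverse b : b O = RtoH 1 -> exists e, conv b e = delta (RtoH 1).
Proof.
  intros hb.
  (* [pre n] agrees with the inverse up to degree [n]. *)
  pose (step := fun e : nat -> H => fun n =>
    match n with O => RtoH 1 | S m => (- conv (shift b) e m)%H end).
  pose (pre := fix pre n := match n with O => delta (RtoH 1) | S m => step (pre m) end).
  assert (forall a x y n, (forall k, (k <= n)%nat -> x k = y k) -> conv a x n = conv a y n) as hloc.
  { intros a x y n; revert a; induction n as [|n IH]; intros a h; cbn [conv].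
    - now rewrite (h O).
    - rewrite (h (S n)) by lia. f_equal. apply IH; auto. }
  assert (forall n k, (k <= n)%nat -> pre n k = pre k k) as hst.
  { assert (forall n k, (k <= n)%nat -> pre n k = pre (S n) k) as hs.
    { induction n as [|n IH]; intros k hk.
      - now replace k with O by lia.
      - change (step (pre n) k = step (pre (S n)) k). destruct k as [|k]; [reflexivity|].
        unfold step. f_equal. apply hloc; intros; apply IH; lia. }
    intros n k hk. induction hk as [|n hn IH]; [reflexivity|].
    now rewrite <- hs. }
  exists (fun n => pre n n). apply functional_extensionality; intros [|n]; cbn [conv delta].
  - rewrite hb; simpl; hring.
  - change (pre (S n) (S n)) with (- conv (shift b) (pre n) n)%H.
    rewrite (hloc (shift b) (fun n => pre n n) (pre n)) by (intros; symmetry; apply hst; lia).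
    rewrite hb; hring.
Qed.

(** A right inverse has itself a right inverse, which can only be the original series. *)
Lemma conv_inverse b : b O = RtoH 1 ->
  exists e, conv b e = delta (RtoH 1) /\ conv e b = delta (RtoH 1).
Proof.
  intros hb. destruct (conv_right_inverse b hb) as [e he]. exists e; split; [exact he|].
  assert (e O = RtoH 1) as he0.
  { apply (f_equal (fun s => s O)) in he; cbn in he; rewrite hb, Hmul_1l in he; exact he. }
  destruct (conv_right_inverse e he0) as [g hg].
  replace b with g; [exact hg|].
  now rewrite <- (conv_delta1_l g), <- he, <- conv_assoc, hg, conv_delta1_r.
Qed.

(** * Growth of coefficients *)

Lemma tame_bounded a C : (forall n, Hnorm (a n) <= C) -> tame a.
Proof.
  intros h rho hr. assert (0 <= C) by (pose proof (Hnorm_ge0 (a O)); specialize (h O); lra).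
  exists C; split; [lra|]. intros n.
  assert (0 <= rho ^ n <= 1) by (split; [apply pow_le | rewrite <- (pow1 n); apply pow_incr]; lra).
  specialize (h n); pose proof (Hnorm_ge0 (a n)); nra.
Qed.

Lemma tame_lmul c a : tame a -> tame (lmul c a).
Proof.
  intros ha rho hr. destruct (ha rho hr) as [C [hC h]]. pose proof (Hnorm_ge0 c).
  exists (Hnorm c * C); split; [nra|]. intros n; specialize (h n).
  unfold lmul; rewrite Hnorm_mul, Rmult_assoc. now apply Rmult_le_compat_l.
Qed.

Lemma tame_conj a : tame a -> tame (conjseq a).
Proof.
  intros ha rho hr. destruct (ha rho hr) as [C [hC h]]. exists C; split; [lra|].
  intros n; unfold conjseq; rewrite Hnorm_conj; apply h.
Qed.

Lemma common_rate C lam C' lam' :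
  0 <= C -> 0 <= lam < 1 -> 0 <= C' -> 0 <= lam' < 1 ->
  exists mu, 0 <= mu < 1 /\ forall k l, (C * lam ^ k) * (C' * lam' ^ l) <= C * C' * mu ^ (k + l).
Proof.
  intros hC hl hC' hl'. exists (Rmax lam lam'). split.
  - split; [apply Rle_trans with lam; [lra | apply Rmax_l] | apply Rmax_lub_lt; lra].
  - intros k l. rewrite pow_add.
    pose proof (pow_incr lam (Rmax lam lam') k (conj (proj1 hl) (Rmax_l _ _))).
    pose proof (pow_incr lam' (Rmax lam lam') l (conj (proj1 hl') (Rmax_r _ _))).
    pose proof (pow_le lam k (proj1 hl)). pose proof (pow_le lam' l (proj1 hl')).
    replace (C * lam ^ k * (C' * lam' ^ l)) with (C * C' * (lam ^ k * lam' ^ l)) by ring.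
    apply Rmult_le_compat_l; [nra|]. apply Rmult_le_compat; lra.
Qed.

Lemma tame_conv a b : tame a -> tame b -> tame (conv a b).
Proof.
  intros ha hb rho hr.
  destruct (tame_geom a rho ha hr) as [C [lam [hC [hl h]]]].
  destruct (tame_geom b rho hb hr) as [C' [lam' [hC' [hl' h']]]].
  destruct (common_rate C lam C' lam' hC hl hC' hl') as [mu [hmu hm]].
  pose proof (Rmult_le_pos _ _ hC hC').
  exists (C * C' * / (1 - mu)). split.
  { apply Rmult_le_pos; [lra|]. left; apply Rinv_0_lt_compat; lra. }
  intros n. pose proof (pow_le rho n (proj1 hr)).
  rewrite conv_hsum, <- (Rabs_pos_eq (rho ^ n)), <- Hnorm_RtoH, Rmult_comm, <- Hnorm_mul, <- hsum_mull by lra.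
  eapply Rle_trans; [apply hsum_norm_le with (c := C * C' * mu ^ n)|].
  - intros k hk. rewrite !Hnorm_mul, Hnorm_RtoH, Rabs_pos_eq by lra.
    replace n with ((n - k) + k)%nat at 1 3 by lia. eapply Rle_trans; [|apply hm].
    rewrite pow_add.
    replace (rho ^ (n - k) * rho ^ k * (Hnorm (a (n - k)%nat) * Hnorm (b k)))
      with ((Hnorm (a (n - k)%nat) * rho ^ (n - k)) * (Hnorm (b k) * rho ^ k)) by ring.
    pose proof (pow_le rho (n-k) (proj1 hr)). pose proof (pow_le rho k (proj1 hr)).
    apply Rmult_le_compat; auto; apply Rmult_le_pos; auto using Hnorm_ge0.
  - replace (INR (S n) * (C * C' * mu ^ n)) with (C * C' * (INR (S n) * mu ^ n)) by ring.
    apply Rmult_le_compat_l; [lra|]. now apply geom_sum_le.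
Qed.

Lemma hsum_conv_powers q a b n :
  hsum (fun m => Hpow q m * conv a b m)%H n
  = hsum (fun l => Hpow q l * (hsum (fun m => Hpow q m * a m) (n - l)%nat * b l))%H n.
Proof.
  induction n as [|n IH]; [reflexivity|].
  cbn [hsum]. rewrite IH.
  rewrite (hsum_ext (fun l => Hpow q l * (hsum (fun m => Hpow q m * a m) (S n - l)%nat * b l))%H
    (fun l => Hpow q l * (hsum (fun m => Hpow q m * a m) (n - l)%nat * b l)
              + Hpow q n * (a (n - l)%nat * b l))%H).
  - rewrite hsum_add, hsum_mull, conv_hsum, <- Hadd_assoc. f_equal.
    replace (S n - n)%nat with 1%nat by lia. cbn [hsum Hpow]. rewrite Nat.sub_diag.
    hring.
  - intros k hk. replace (S n - k)%nat with (S (n - k)) by lia. cbn [hsum].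
    rewrite Hmul_addl, Hmul_addr. f_equal.
    rewrite !Hmul_assoc, <- Hpow_add. now replace (k + (n - k))%nat with n by lia.
Qed.

(** Coefficients stand on the right of powers of q, so grouping the terms by the index
    of the second factor leaves the value of the first factor between q^l and b_l. *)
Lemma power_series_conv a b q :
  tame a -> tame b -> in_ball q ->
  power_series (conv a b) q = power_series (lmul (power_series a q) b) q.
Proof.
  intros ha hb hq. set (A := power_series a q).
  apply Hlim_unique with (hsum (fun m => Hpow q m * conv a b m)%H).
  { apply power_series_Hlim; [now apply tame_conv | exact hq]. }
  pose proof (Hnorm_ge0 q) as hq0.
  destruct (power_series_uniform a (Hnorm q) ha (conj hq0 hq)) as [C [lam [hC [hl h]]]].
  specialize (h q (Rle_refl _)). fold A in h.
  destruct (tame_geom b (Hnorm q) hb (conj hq0 hq)) as [C' [lam' [hC' [hl' h']]]].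
  destruct (common_rate C lam C' lam' hC hl hC' hl') as [mu [hmu hm]].
  destruct (lin_geom mu hmu) as [K [nu [hK [hnu hn]]]].
  pose proof (Rmult_le_pos _ _ hC hC') as hCC.
  apply Hlim_ext with (fun n =>
    hsum (fun m => Hpow q m * lmul A b m)%H n
    + hsum (fun l => Hpow q l * ((hsum (fun m => Hpow q m * a m) (n - l)%nat - A) * b l))%H n)%H.
  { intros n. rewrite hsum_conv_powers, <- hsum_add. apply hsum_ext; intros; unfold lmul; hring. }
  rewrite <- (Hadd_0r (power_series _ _)).
  apply Hlim_add; [apply power_series_Hlim; [now apply tame_lmul | exact hq]|].
  apply Hlim_geom with nu (C * C' * K); [exact hnu|]. intros n.
  replace (hsum _ n - RtoH 0)%H with
    (hsum (fun l => Hpow q l * ((hsum (fun m => Hpow q m * a m) (n - l)%nat - A) * b l))%H n) by hring.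
  eapply Rle_trans; [apply hsum_norm_le with (c := C * C' * mu ^ n)|].
  - intros k hk. rewrite !Hnorm_mul, Hnorm_pow.
    replace n with ((n - k) + k)%nat at 2 by lia. eapply Rle_trans; [|apply hm].
    set (x := Hnorm (hsum _ _ - A)%H).
    replace (Hnorm q ^ k * (x * Hnorm (b k))) with (x * (Hnorm (b k) * Hnorm q ^ k)) by ring.
    apply Rmult_le_compat; [apply Hnorm_ge0 | | apply h | apply h'].
    apply Rmult_le_pos; [apply Hnorm_ge0 | now apply pow_le].
  - specialize (hn n). rewrite S_INR in hn. pose proof (pow_le mu n (proj1 hmu)).
    replace (INR n * (C * C' * mu ^ n)) with (C * C' * (INR n * mu ^ n)) by ring.
    rewrite (Rmult_assoc (C * C')). apply Rmult_le_compat_l; [lra|]. nra.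
Qed.

(** * Slices *)

Lemma imaginary_unit_spec I : imaginary_unit I -> re I = 0 /\ Hsq I = 1.
Proof.
  unfold imaginary_unit; destruct I as [[[a b] c] d]; intros E.
  assert (h1 := f_equal re E). assert (h2 := f_equal im_i E).
  assert (h3 := f_equal im_j E). assert (h4 := f_equal im_k E).
  cbv [Hmul RtoH re im_i im_j im_k fst snd] in h1, h2, h3, h4.
  cbv [Hsq re im_i im_j im_k fst snd].
  assert (a = 0) as ha.
  { destruct (Req_dec a 0) as [|n]; [assumption | exfalso].
    assert (b = 0) by (apply (Rmult_eq_reg_l a); lra).
    assert (c = 0) by (apply (Rmult_eq_reg_l a); lra).
    assert (d = 0) by (apply (Rmult_eq_reg_l a); lra).
    subst; nra. }
  subst; split; lra.
Qed.

Lemma imaginary_unit_of I : re I = 0 -> Hsq I = 1 -> imaginary_unit I.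
Proof.
  destruct I as [[[a b] c] d]; cbv [Hsq re im_i im_j im_k fst snd]; intros -> h.
  unfold imaginary_unit; apply H_ext; cbv [Hmul RtoH re im_i im_j im_k fst snd]; lra.
Qed.

Lemma Hsq_slice I x y : imaginary_unit I -> Hsq (slice I x y) = x ^ 2 + y ^ 2.
Proof.
  intros hI; destruct (imaginary_unit_spec I hI) as [h0 h1].
  destruct I as [[[a b] c] d]. cbv [Hsq slice Hadd Hmul RtoH re im_i im_j im_k fst snd] in *.
  subst; nra.
Qed.

Lemma in_ball_sq q : in_ball q <-> Hsq q < 1.
Proof.
  unfold in_ball; rewrite <- Hnorm_sq. pose proof (Hnorm_ge0 q). split; intros; nra.
Qed.

Lemma Hi_unit : imaginary_unit Hi.
Proof. unfold imaginary_unit; hring. Qed.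

Lemma slice_add I x y u v : (slice I x y + slice I u v)%H = slice I (x + u) (y + v).
Proof. hring. Qed.

Lemma slice_mul I x y u v :
  imaginary_unit I -> (slice I x y * slice I u v)%H = slice I (x * u - y * v) (x * v + y * u).
Proof.
  intros hI. unfold slice.
  transitivity (RtoH (x * u) + RtoH (x * v + y * u) * I + RtoH (y * v) * (I * I))%H; [hring|].
  rewrite hI. hring.
Qed.

Lemma slice_comm I x y u v : (slice I x y * slice I u v = slice I u v * slice I x y)%H.
Proof. hring. Qed.

Lemma slice_real I x : slice I x 0 = RtoH x.
Proof. hring. Qed.

Lemma slice_exists q : exists I x y, imaginary_unit I /\ q = slice I x y.
Proof.
  destruct q as [[[a b] c] d].
  destruct (Req_dec (b ^ 2 + c ^ 2 + d ^ 2) 0) as [h|h].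
  - exists Hi, a, 0. split; [apply Hi_unit|].
    assert (b = 0) by nra. assert (c = 0) by nra. assert (d = 0) by nra. subst; hring.
  - set (n := sqrt (b ^ 2 + c ^ 2 + d ^ 2)).
    assert (0 < b ^ 2 + c ^ 2 + d ^ 2) as hp by nra.
    assert (0 < n) as hn by (apply sqrt_lt_R0, hp).
    assert (n ^ 2 = b ^ 2 + c ^ 2 + d ^ 2) as hn2 by (apply pow2_sqrt; lra).
    exists (0, b / n, c / n, d / n), a, n. split.
    + apply imaginary_unit_of; [reflexivity|].
      cbv [Hsq re im_i im_j im_k fst snd]. field_simplify; [|lra]. rewrite hn2. field. nra.
    + apply H_ext; cbv [slice Hadd Hmul RtoH re im_i im_j im_k fst snd]; field; lra.
Qed.

(** * Differentiability of power series *)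

Definition deriv (a : nat -> H) : nat -> H := fun n => (RtoH (INR (S n)) * a (S n))%H.

Lemma tame_scale a : tame a -> tame (fun n => RtoH (INR (S n)) * a n)%H.
Proof.
  intros ha rho hr. destruct (tame_geom a rho ha hr) as [C [lam [hC [hl h]]]].
  exists (C * / (1 - lam)). split.
  { apply Rmult_le_pos; [lra|]. left; apply Rinv_0_lt_compat; lra. }
  intros n. rewrite Hnorm_mul, Hnorm_RtoH, Rabs_pos_eq by apply pos_INR.
  specialize (h n). pose proof (pos_INR (S n)). pose proof (geom_sum_le lam n hl).
  rewrite Rmult_assoc. apply Rle_trans with (INR (S n) * (C * lam ^ n)); [nra|].
  replace (INR (S n) * (C * lam ^ n)) with (C * (INR (S n) * lam ^ n)) by ring.
  apply Rmult_le_compat_l; lra.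
Qed.

Lemma tame_shift a : tame a -> tame (shift a).
Proof.
  intros ha rho hr. set (s := (1 + rho) / 2).
  destruct (ha s ltac:(unfold s; lra)) as [C [hC h]].
  assert (0 < s) as hs by (unfold s; lra).
  exists (C / s). split; [apply Rdiv_le_0_compat; lra|].
  intros n. specialize (h (S n)). unfold shift.
  apply (proj1 (Rle_div_r _ _ _ hs)). eapply Rle_trans; [|exact h].
  simpl pow. rewrite Rmult_assoc. apply Rmult_le_compat_l; [apply Hnorm_ge0|].
  rewrite Rmult_comm. apply Rmult_le_compat_l; [lra|]. apply pow_incr; unfold s; lra.
Qed.

Lemma tame_deriv a : tame a -> tame (deriv a).
Proof.
  intros ha. assert (h := tame_shift _ (tame_scale _ ha)).
  (* The scaled sequence carries the factor n + 2 in place of n + 1. *)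
  intros rho hr; destruct (h rho hr) as [C [hC hb]]; exists C; split; [exact hC|].
  intros n; eapply Rle_trans; [|apply (hb n)].
  apply Rmult_le_compat_r; [apply pow_le; lra|]. unfold deriv, shift.
  rewrite !Hnorm_mul, !Hnorm_RtoH, !Rabs_pos_eq by apply pos_INR.
  apply Rmult_le_compat_r; [apply Hnorm_ge0 | apply le_INR; lia].
Qed.

Definition dpow (z : H) (m : nat) : H :=
  match m with O => RtoH 0 | S n => (RtoH (INR (S n)) * Hpow z n)%H end.

(** Induction on the exponent; both sides are multiplied by powers of rho so that
    no exponent m - 1 or m - 2 occurs. *)
Lemma Hpow_quadratic z h rho m :
  (z * h = h * z)%H -> 0 < rho -> Hnorm z <= rho -> Hnorm (z + h)%H <= rho ->
  rho ^ 2 * Hnorm (Hpow (z + h) m - Hpow z m - h * dpow z m)%H <= INR m ^ 2 * rho ^ m * Hnorm h ^ 2.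
Proof.
  intros hc hr hz hzh. pose proof (Hnorm_ge0 h) as hh0.
  assert (forall k, Hnorm (dpow z k) * rho <= INR k * rho ^ k) as hd.
  { intros [|k]; cbn [dpow]; [rewrite Hnorm_0; simpl; lra|].
    rewrite Hnorm_mul, Hnorm_RtoH, Rabs_pos_eq, Hnorm_pow by apply pos_INR.
    rewrite Rmult_assoc. apply Rmult_le_compat_l; [apply pos_INR|].
    simpl pow; rewrite Rmult_comm. apply Rmult_le_compat_l; [lra|].
    apply pow_incr; split; [apply Hnorm_ge0 | exact hz]. }
  induction m as [|m IH].
  - cbn [Hpow dpow]. replace (RtoH 1 - RtoH 1 - h * RtoH 0)%H with (RtoH 0) by hring.
    rewrite Hnorm_0; simpl; lra.
  - set (E := (Hpow (z + h) m - Hpow z m - h * dpow z m)%H) in IH.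
    assert (Hpow (z + h) (S m) - Hpow z (S m) - h * dpow z (S m)
            = (z + h) * E + h * (h * dpow z m))%H as ->.
    { assert (z * dpow z m = RtoH (INR m) * Hpow z m)%H as hzd.
      { destruct m as [|m]; cbn [dpow Hpow]; [simpl; hring|].
        rewrite !Hmul_assoc, (RtoH_comm _ z). reflexivity. }
      unfold E; cbn [Hpow dpow]. rewrite S_INR.
      transitivity ((z + h) * Hpow (z + h) m - z * Hpow z m - h * Hpow z m - h * (RtoH (INR m) * Hpow z m))%H.
      { generalize (Hpow (z + h) m); generalize (Hpow z m); intros u v.
        replace (RtoH (INR m + 1)) with (RtoH (INR m) + RtoH 1)%H by hring.
        generalize (RtoH (INR m)); intros w. hring. }
      rewrite <- hzd. generalize (dpow z m); generalize (Hpow (z + h) m); generalize (Hpow z m); intros u v w.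
      transitivity ((z + h) * v - z * u - h * u - (h * z) * w)%H; [hring|].
      rewrite <- hc at 1.
      transitivity ((z + h) * v - z * u - h * u - (z * h) * w)%H; [reflexivity|]. hring. }
    set (x := Hnorm E) in *.
    assert (Hnorm ((z + h) * E + h * (h * dpow z m))%H <= rho * x + Hnorm h ^ 2 * Hnorm (dpow z m)) as h1.
    { eapply Rle_trans; [apply Hnorm_triangle|]. rewrite !Hnorm_mul. fold x.
      assert (0 <= x) by apply Hnorm_ge0. nra. }
    specialize (hd m). rewrite S_INR. simpl (rho ^ S m).
    assert (rho ^ 2 * (Hnorm h ^ 2 * Hnorm (dpow z m)) <= rho * Hnorm h ^ 2 * (INR m * rho ^ m)) as h2.
    { replace (rho ^ 2 * (Hnorm h ^ 2 * Hnorm (dpow z m)))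
        with (rho * Hnorm h ^ 2 * (Hnorm (dpow z m) * rho)) by ring.
      apply Rmult_le_compat_l; [nra | exact hd]. }
    apply Rle_trans with (rho ^ 2 * (rho * x + Hnorm h ^ 2 * Hnorm (dpow z m))); [nra|].
    assert (rho * (rho ^ 2 * x) <= rho * (INR m ^ 2 * rho ^ m * Hnorm h ^ 2)) by (apply Rmult_le_compat_l; lra).
    assert (0 <= rho * (rho ^ m * Hnorm h ^ 2)) by
      (apply Rmult_le_pos; [lra | apply Rmult_le_pos; [apply pow_le; lra | nra]]).
    pose proof (pos_INR m). nra.
Qed.

(** Since z and h commute, the powers of z + h expand as in a commutative field, and the
    bound of the second order term is summable. *)
Lemma power_series_quadratic a rho :
  tame a -> 0 < rho < 1 ->
  exists K, 0 <= K /\ forall z h, (z * h = h * z)%H -> Hnorm z <= rho -> Hnorm (z + h)%H <= rho ->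
    Hnorm (power_series a (z + h) - power_series a z - h * power_series (deriv a) z)%H
    <= K * Hnorm h ^ 2.
Proof.
  intros ha hr.
  destruct (tame_geom _ rho (tame_scale _ (tame_scale _ ha)) ltac:(lra)) as [C [lam [hC [hl hb]]]].
  exists (C / (1 - lam) / rho ^ 2). split.
  { apply Rdiv_le_0_compat; [apply Rdiv_le_0_compat; lra | nra]. }
  intros z h hc hz hzh.
  set (u := fun m => ((Hpow (z + h) m - Hpow z m - h * dpow z m) * a m)%H).
  apply Hlim_norm_le with (fun n => hsum u (S n)).
  - apply Hlim_ext with (fun n =>
      hsum (fun m => Hpow (z + h) m * a m) (S n) + (- RtoH 1) * hsum (fun m => Hpow z m * a m) (S n)
      + (- h) * hsum (fun m => Hpow z m * deriv a m) n)%H.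
    + intros n. transitivity (hsum (fun m => Hpow (z + h) m * a m) (S n)
        + (- RtoH 1) * hsum (fun m => Hpow z m * a m) (S n)
        + (- h) * hsum (fun m => dpow z m * a m) (S n))%H.
      * f_equal. f_equal. rewrite (hsum_shift (fun m => dpow z m * a m)%H).
        rewrite (hsum_ext (fun m => Hpow z m * deriv a m)%H (fun k => dpow z (S k) * a (S k))%H).
        { cbn [dpow]; hring. }
        intros k _; unfold deriv; cbn [dpow]. rewrite (RtoH_comm _ (Hpow z k)). apply Hmul_assoc.
      * rewrite <- !hsum_mull, <- !hsum_add. apply hsum_ext; intros; unfold u; hring.
    + replace (power_series a (z + h) - power_series a z - h * power_series (deriv a) z)%H
        with (power_series a (z + h) + (- RtoH 1) * power_series a z
              + (- h) * power_series (deriv a) z)%H by hring.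
      apply (Hlim_add (fun n => _ + _)%H); [apply Hlim_add|].
      * apply (Hlim_shift (hsum (fun m => Hpow (z + h) m * a m)%H)), power_series_Hlim;
          [exact ha | unfold in_ball; lra].
      * apply Hlim_mull, (Hlim_shift (hsum (fun m => Hpow z m * a m)%H)), power_series_Hlim;
          [exact ha | unfold in_ball; lra].
      * apply Hlim_mull, power_series_Hlim; [now apply tame_deriv | unfold in_ball; lra].
  - intros n. pose proof (Hnorm_ge0 h).
    assert (hsum u (S n) = (hsum u (0 + S n)%nat - hsum u 0)%H) as -> by (simpl; hring).
    replace (C / (1 - lam) / rho ^ 2 * Hnorm h ^ 2)
      with ((C * Hnorm h ^ 2 / rho ^ 2) / (1 - lam) * lam ^ 0) by (simpl; field; lra).
    apply hsum_geom_diff; [apply Rdiv_le_0_compat; nra | exact hl|].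
    intros m. unfold u. rewrite Hnorm_mul.
    replace (C * Hnorm h ^ 2 / rho ^ 2 * lam ^ m) with (C * lam ^ m * Hnorm h ^ 2 / rho ^ 2)
      by (field; lra).
    apply (proj1 (Rle_div_r _ _ (rho ^ 2) ltac:(nra))).
    specialize (hb m). rewrite !Hnorm_mul, !Hnorm_RtoH, !Rabs_pos_eq in hb by apply pos_INR.
    pose proof (Hpow_quadratic z h rho m hc (proj1 hr) hz hzh) as hq.
    set (x := Hnorm (_ - _ - _)%H) in *. pose proof (Hnorm_ge0 (a m)).
    apply Rle_trans with ((INR m ^ 2 * rho ^ m * Hnorm h ^ 2) * Hnorm (a m)); [nra|].
    apply Rle_trans with ((INR (S m) * (INR (S m) * Hnorm (a m)) * rho ^ m) * Hnorm h ^ 2);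
      [|apply Rmult_le_compat_r; [nra | exact hb]].
    assert (0 <= rho ^ m * Hnorm h ^ 2 * Hnorm (a m)) by
      (apply Rmult_le_pos; [apply Rmult_le_pos; [apply pow_le; lra | nra] | lra]).
    pose proof (pos_INR m). rewrite S_INR. nra.
Qed.

Lemma scal_RtoH (x : R) (l : H) : scal x l = (RtoH x * l)%H.
Proof.
  destruct l as [[[a b] c] d].
  change ((x * a, x * b, x * c, x * d) = (RtoH x * (a, b, c, d))%H).
  apply H_ext; cbv [Hmul RtoH re im_i im_j im_k fst snd]; ring.
Qed.

Lemma is_derive_quadratic (phi : R -> H) x (l : H) K delta :
  0 < delta ->
  (forall s, Rabs s < delta -> Hnorm (phi (x + s)%R - phi x - RtoH s * l)%H <= K * s ^ 2) ->
  is_derive phi x l.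
Proof.
  intros hd h. split; [apply (is_linear_scal_l l)|].
  intros x' hx'. rewrite <- (is_filter_lim_locally_unique x x' hx'). clear x' hx'.
  intros [eps heps].
  assert (0 < Rmin delta (eps / (1 + Rabs K))) as hpos.
  { apply Rmin_glb_lt; [exact hd|]. apply Rdiv_lt_0_compat; [exact heps|].
    pose proof (Rabs_pos K); lra. }
  exists (mkposreal _ hpos). intros t ht.
  change (Rabs (t - x) < Rmin delta (eps / (1 + Rabs K))) in ht.
  assert (Rabs (t - x) < delta) as h1 by (eapply Rlt_le_trans; [exact ht | apply Rmin_l]).
  assert (Rabs (t - x) < eps / (1 + Rabs K)) as h2 by (eapply Rlt_le_trans; [exact ht | apply Rmin_r]).
  specialize (h (t - x) h1). rewrite (Rplus_minus x t) in h.
  rewrite norm_Hnorm. change (minus t x) with (t - x). rewrite scal_RtoH.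
  change (norm (t - x)) with (Rabs (t - x)). simpl.
  eapply Rle_trans; [exact h|].
  rewrite <- pow2_abs. pose proof (Rabs_pos (t - x)). pose proof (Rle_abs K). pose proof (Rabs_pos K).
  apply (proj2 (Rlt_div_r _ _ (1 + Rabs K) ltac:(lra))) in h2. nra.
Qed.

Lemma continuous_lipschitz (phi : R * R -> H) x y L delta :
  0 < delta ->
  (forall u v, Rabs u < delta -> Rabs v < delta ->
     Hnorm (phi ((x + u)%R, (y + v)%R) - phi (x, y))%H <= L * (Rabs u + Rabs v)) ->
  continuous phi (x, y).
Proof.
  intros hd h.
  apply (proj2 (filterlim_locally_ball_norm (K := R_AbsRing) (F := locally (x, y)) phi (phi (x, y)))).
  intros [eps heps].
  assert (0 < Rmin delta (eps / (2 * (1 + Rabs L)))) as hpos.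
  { apply Rmin_glb_lt; [exact hd|]. apply Rdiv_lt_0_compat; [exact heps|].
    pose proof (Rabs_pos L); lra. }
  exists (mkposreal _ hpos). intros [u v] [hu hv].
  change (Rabs (u - x) < Rmin delta (eps / (2 * (1 + Rabs L)))) in hu.
  change (Rabs (v - y) < Rmin delta (eps / (2 * (1 + Rabs L)))) in hv.
  pose proof (Rmin_l delta (eps / (2 * (1 + Rabs L)))).
  pose proof (Rmin_r delta (eps / (2 * (1 + Rabs L)))) as h3.
  specialize (h (u - x) (v - y) ltac:(lra) ltac:(lra)).
  rewrite (Rplus_minus x u) in h. rewrite (Rplus_minus y v) in h.
  unfold ball_norm. rewrite norm_Hnorm, minus_Hsub. simpl. eapply Rle_lt_trans; [exact h|].
  pose proof (Rle_abs L). pose proof (Rabs_pos L).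
  pose proof (Rabs_pos (u - x)). pose proof (Rabs_pos (v - y)).
  assert (Rabs (u - x) + Rabs (v - y) < eps / (1 + Rabs L)) as h4.
  { replace (eps / (1 + Rabs L)) with (2 * (eps / (2 * (1 + Rabs L)))) by (field; lra). lra. }
  apply (proj2 (Rlt_div_r _ _ (1 + Rabs L) ltac:(lra))) in h4. nra.
Qed.

Lemma component_is_derive (pi : H -> R) (phi : R -> H) x (l : H) :
  (forall u v, pi (u + v)%H = pi u + pi v) -> (forall u, pi (- u)%H = - pi u) ->
  (forall t u, pi (RtoH t * u)%H = t * pi u) -> (forall u, Rabs (pi u) <= Hnorm u) ->
  is_derive phi x l -> is_derive (fun t => pi (phi t)) x (pi l).
Proof.
  intros hadd hopp hscal hle [_ h]. split; [apply (is_linear_scal_l (pi l))|].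
  intros x' hx'. specialize (h x' hx'). intros eps; specialize (h eps).
  eapply filter_imp; [|exact h]. intros t ht. eapply Rle_trans; [|exact ht].
  rewrite norm_Hnorm. eapply Rle_trans; [|apply hle]. right.
  rewrite scal_RtoH, !minus_Hsub.
  change (norm ?r) with (Rabs r).
  change (minus (minus (pi (phi t)) (pi (phi x'))) (scal (minus t x') (pi l)))
    with (pi (phi t) - pi (phi x') - minus t x' * pi l).
  rewrite hadd, hopp, hscal, hadd, hopp. reflexivity.
Qed.

Lemma is_derive_components (phi : R -> H) x (l : H) :
  is_derive phi x l ->
  is_derive (fun t => re (phi t)) x (re l) /\ is_derive (fun t => im_i (phi t)) x (im_i l) /\
  is_derive (fun t => im_j (phi t)) x (im_j l) /\ is_derive (fun t => im_k (phi t)) x (im_k l).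
Proof.
  intros h; split; [|split; [|split]];
    [apply (component_is_derive re) | apply (component_is_derive im_i)
    |apply (component_is_derive im_j) | apply (component_is_derive im_k)];
    auto using re_le, im_i_le, im_j_le, im_k_le; intros; hunf; ring.
Qed.

Lemma HDerive_unique (phi : R -> H) x (l : H) : is_derive phi x l -> HDerive phi x = l.
Proof.
  intros h; destruct (is_derive_components phi x l h) as [h1 [h2 [h3 h4]]].
  apply H_ext; [change (Derive (fun t => re (phi t)) x = re l)
    | change (Derive (fun t => im_i (phi t)) x = im_i l)
    | change (Derive (fun t => im_j (phi t)) x = im_j l)
    | change (Derive (fun t => im_k (phi t)) x = im_k l)]; apply is_derive_unique; assumption.
Qed.

Lemma slice_disc I x y :
  imaginary_unit I -> in_ball (slice I x y) ->
  exists delta rho, 0 < delta /\ 0 < rho < 1 /\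
    forall u v, Rabs u < delta -> Rabs v < delta ->
      Hnorm (slice I (x + u) (y + v)) <= rho.
Proof.
  intros hI hq. pose proof (Hnorm_ge0 (slice I x y)) as h0. unfold in_ball in hq.
  exists ((1 - Hnorm (slice I x y)) / 4), ((1 + Hnorm (slice I x y)) / 2).
  split; [lra|]. split; [lra|]. intros u v hu hv.
  rewrite <- slice_add. eapply Rle_trans; [apply Hnorm_triangle|].
  assert (Hnorm (slice I u v) <= Rabs u + Rabs v).
  { apply Hnorm_le_sq.
    - pose proof (Rabs_pos u); pose proof (Rabs_pos v); lra.
    - rewrite Hsq_slice by exact hI. rewrite <- (pow2_abs u), <- (pow2_abs v).
      pose proof (Rabs_pos u); pose proof (Rabs_pos v); nra. }
  lra.
Qed.

(** Derivatives along a slice, where the increments commute with the point. *)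
Lemma expansion_partials f a I x y :
  has_expansion f a -> imaginary_unit I -> in_ball (slice I x y) ->
  is_derive (fun t => f (slice I t y)) x (power_series (deriv a) (slice I x y)) /\
  is_derive (fun t => f (slice I x t)) y (I * power_series (deriv a) (slice I x y))%H.
Proof.
  intros hf hI hq. pose proof (has_expansion_tame f a hf) as ha.
  destruct (slice_disc I x y hI hq) as [delta [rho [hd [hr hb]]]].
  destruct (power_series_quadratic a rho ha hr) as [K [hK h]].
  assert (forall u v, Rabs u < delta -> Rabs v < delta ->
    Hnorm (f (slice I (x + u) (y + v)) - f (slice I x y)
           - slice I u v * power_series (deriv a) (slice I x y))%H <= K * (u ^ 2 + v ^ 2)) as hmain.
  { intros u v hu hv. rewrite <- (Hsq_slice I u v hI), <- Hnorm_sq.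
    pose proof (hb u v hu hv) as h1. pose proof (hb 0 0 ltac:(now rewrite Rabs_R0) ltac:(now rewrite Rabs_R0)) as h2.
    rewrite !Rplus_0_r in h2.
    rewrite (has_expansion_power_series f a (slice I x y) hf hq).
    rewrite (has_expansion_power_series f a (slice I (x + u) (y + v)) hf) by (unfold in_ball; lra).
    rewrite <- slice_add in *. apply h; trivial. apply slice_comm. }
  split.
  - apply is_derive_quadratic with K delta; [exact hd|]. intros s hs.
    specialize (hmain s 0 hs ltac:(now rewrite Rabs_R0)).
    rewrite slice_real, Rplus_0_r in hmain. eapply Rle_trans; [exact hmain|]. nra.
  - apply is_derive_quadratic with K delta; [exact hd|]. intros s hs.
    specialize (hmain 0 s ltac:(now rewrite Rabs_R0) hs).
    rewrite Rplus_0_r in hmain.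
    rewrite Hmul_assoc. replace (RtoH s * I)%H with (slice I 0 s) by hring.
    eapply Rle_trans; [exact hmain|]. nra.
Qed.

Lemma power_series_slice_continuous a I x y :
  tame a -> imaginary_unit I -> in_ball (slice I x y) ->
  continuous (fun z : R * R => power_series a (slice I (fst z) (snd z))) (x, y).
Proof.
  intros ha hI hq.
  destruct (slice_disc I x y hI hq) as [delta [rho [hd [hr hb]]]].
  destruct (power_series_quadratic a rho ha hr) as [K [hK h]].
  set (A := power_series (deriv a) (slice I x y)).
  apply continuous_lipschitz with (Hnorm A + K * 2 * delta) delta; [exact hd|].
  intros u v hu hv. cbn [fst snd].
  pose proof (hb u v hu hv) as h1.
  pose proof (hb 0 0 ltac:(now rewrite Rabs_R0) ltac:(now rewrite Rabs_R0)) as h2.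
  rewrite !Rplus_0_r in h2. rewrite <- slice_add in *.
  specialize (h (slice I x y) (slice I u v) (slice_comm _ _ _ _ _) h2 h1). fold A in h.
  assert (Hnorm (slice I u v) <= Rabs u + Rabs v) as h3.
  { apply Hnorm_le_sq.
    - pose proof (Rabs_pos u); pose proof (Rabs_pos v); lra.
    - rewrite Hsq_slice by exact hI. rewrite <- (pow2_abs u), <- (pow2_abs v).
      pose proof (Rabs_pos u); pose proof (Rabs_pos v); nra. }
  set (P := power_series a (slice I x y + slice I u v)%H) in *.
  set (Q := power_series a (slice I x y)) in *.
  replace (P - Q)%H with ((P - Q - slice I u v * A) + slice I u v * A)%H by hring.
  eapply Rle_trans; [apply Hnorm_triangle|]. rewrite Hnorm_mul.
  pose proof (Hnorm_ge0 (slice I u v)). pose proof (Hnorm_ge0 A).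
  assert (K * Hnorm (slice I u v) ^ 2 <= K * (2 * delta * (Rabs u + Rabs v))).
  { apply Rmult_le_compat_l; [exact hK|]. nra. }
  nra.
Qed.

Lemma expansion_slice_regular f a : has_expansion f a -> slice_regular f.
Proof.
  intros hf I hI x y hq. pose proof (has_expansion_tame f a hf) as ha.
  pose proof (tame_deriv a ha) as ha'.
  destruct (expansion_partials f a I x y hf hI hq) as [hx hy].
  assert (partial_x f I x y = power_series (deriv a) (slice I x y)) as ex by (apply HDerive_unique, hx).
  assert (partial_y f I x y = (I * power_series (deriv a) (slice I x y))%H) as ey by (apply HDerive_unique, hy).
  assert (locally (x, y) (fun z : R * R => in_ball (slice I (fst z) (snd z)))) as hloc.
  { destruct (slice_disc I x y hI hq) as [delta [rho [hd [hr hb]]]].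
    exists (mkposreal _ hd). intros [u v] [hu hv].
    change (Rabs (u - x) < delta) in hu. change (Rabs (v - y) < delta) in hv. cbn [fst snd].
    specialize (hb _ _ hu hv). rewrite (Rplus_minus x u) in hb.
    rewrite (Rplus_minus y v) in hb. unfold in_ball; lra. }
  split; [eexists; exact hx|]. split; [eexists; exact hy|]. split; [|split].
  - apply continuous_ext_loc with (fun z : R * R => power_series (deriv a) (slice I (fst z) (snd z))).
    + eapply filter_imp; [|exact hloc]. intros [u v] h. symmetry.
      apply HDerive_unique. apply (expansion_partials f a I u v hf hI h).
    + now apply power_series_slice_continuous.
  - apply continuous_ext_loc with (fun z : R * R => power_series (lmul I (deriv a)) (slice I (fst z) (snd z))).
    + eapply filter_imp; [|exact hloc]. intros [u v] h. symmetry.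
      etransitivity; [apply HDerive_unique, (expansion_partials f a I u v hf hI h)|].
      symmetry. apply HSeries_unique, is_series_Hlim.
      eapply Hlim_ext; [|apply Hlim_mull, power_series_Hlim; [exact ha' | exact h]].
      intros n; cbn beta. rewrite <- hsum_mull. apply hsum_ext; intros k _. unfold lmul.
      rewrite !Hmul_assoc. f_equal. symmetry. apply Hpow_commute. cbn [fst snd]. hring.
    + apply power_series_slice_continuous; trivial. now apply tame_lmul.
  - rewrite ex, ey, (Hmul_assoc I I), hI. hring.
Qed.

Lemma power_series_at_0 a : power_series a (RtoH 0) = a O.
Proof.
  apply HSeries_unique, is_series_Hlim. intros eps heps; exists 1%nat; intros n hn.
  destruct n as [|n]; [lia|]. rewrite hsum_shift.
  assert (hsum (fun k => Hpow (RtoH 0) (S k) * a (S k))%H n = RtoH 0) as ->.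
  { clear hn. induction n as [|n IH]; [reflexivity|]. cbn [hsum]. rewrite IH. cbn [Hpow]. hring. }
  cbn [Hpow]. replace (RtoH 1 * a 0%nat + RtoH 0 - a 0%nat)%H with (RtoH 0) by hring.
  now rewrite Hnorm_0.
Qed.

Lemma cullen_derivative_0 f a : has_expansion f a -> cullen_derivative f (RtoH 0) = a 1%nat.
Proof.
  intros hf. unfold cullen_derivative.
  assert (im_norm (RtoH 0) = 0) as hn by apply Hnorm_0.
  unfold im_dir; rewrite hn. destruct (Req_EM_T 0 0) as [_|n]; [|now elim n].
  change (re (RtoH 0)) with 0.
  assert (slice Hi 0 0 = RtoH 0) as h0 by hring.
  assert (in_ball (slice Hi 0 0)) as hq by (rewrite h0; unfold in_ball; rewrite Hnorm_0; lra).
  destruct (expansion_partials f a Hi 0 0 hf Hi_unit hq) as [hx hy].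
  assert (partial_x f Hi 0 0 = _) as -> by apply (HDerive_unique _ _ _ hx).
  assert (partial_y f Hi 0 0 = _) as -> by apply (HDerive_unique _ _ _ hy).
  rewrite h0, power_series_at_0, (Hmul_assoc Hi Hi), Hi_unit. unfold deriv. cbn [INR].
  destruct (a 1%nat) as [[[u v] w] t].
  apply H_ext; cbv [Hadd Hopp Hmul RtoH re im_i im_j im_k fst snd]; field.
Qed.

(** * Cauchy formula for pairs of real functions *)

Lemma differentiable_continuous_2d U x y a b :
  differentiable_pt_lim U x y a b -> continuity_2d_pt U x y.
Proof. intros h; apply differentiable_continuity_pt. now exists a, b. Qed.

Lemma continuous_2d_comp (A : R -> R -> R) (T : UniformSpace) (p q : T -> R) (z : T) :
  continuity_2d_pt A (p z) (q z) -> continuous p z -> continuous q z ->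
  continuous (fun t => A (p t) (q t)) z.
Proof.
  intros hA hp hq. apply (continuous_comp_2 p q A); trivial.
  now apply continuity_2d_pt_filterlim.
Qed.

Lemma continuous_affine_circle (T : UniformSpace) (x c : R) (l : T -> R) (g : T -> R) (z : T) :
  continuous l z -> continuous g z ->
  continuous (fun t => x + l t * (c * g t - x)) z.
Proof.
  intros hl hg. apply (continuous_plus (fun _ => x)); [apply continuous_const|].
  apply (continuous_mult l); [exact hl|].
  apply (continuous_minus (fun t => c * g t)); [|apply continuous_const].
  apply (continuous_mult (fun _ => c)); [apply continuous_const | exact hg].
Qed.

(** Cauchy's formula for U - i W, where A and B are the partial derivatives of U and
    k1 + i k2 is w / (w - z).  The integral of k1 U + k2 W at the points
    z + l (w - z) has as derivative in l the integral of a multiple of the angular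
    derivative of W, which vanishes by periodicity; so the values at l = 1 and l = 0 agree. *)
Lemma cauchy_pair (U W A B : R -> R -> R) (k1 k2 : R -> R) (x y r : R) :
  (forall u v, u ^ 2 + v ^ 2 < 1 -> differentiable_pt_lim U u v (A u v) (B u v)) ->
  (forall u v, u ^ 2 + v ^ 2 < 1 -> differentiable_pt_lim W u v (B u v) (- A u v)) ->
  (forall u v, u ^ 2 + v ^ 2 < 1 -> continuity_2d_pt A u v) ->
  (forall u v, u ^ 2 + v ^ 2 < 1 -> continuity_2d_pt B u v) ->
  0 < r < 1 -> x ^ 2 + y ^ 2 < r ^ 2 ->
  (forall s, continuous k1 s) -> (forall s, continuous k2 s) ->
  (forall s, k1 s * (r * cos s - x) - k2 s * (r * sin s - y) = r * cos s) ->
  (forall s, k1 s * (r * sin s - y) + k2 s * (r * cos s - x) = r * sin s) ->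
  RInt (fun s => k1 s * U (r * cos s) (r * sin s) + k2 s * W (r * cos s) (r * sin s)) 0 (2 * PI)
  = RInt (fun s => k1 s * U x y + k2 s * W x y) 0 (2 * PI).
Proof.
  intros hU hW hA hB hr hz hk1 hk2 e1 e2.
  set (X := fun l s => x + l * (r * cos s - x)).
  set (Y := fun l s => y + l * (r * sin s - y)).
  set (eta := (1 - r) / 2).
  assert (forall l s, - eta < l < 1 + eta -> X l s ^ 2 + Y l s ^ 2 < 1) as hdisc.
  { intros l s hl. unfold X, Y.
    assert (hcs := sin2_cos2 s). unfold Rsqr in hcs.
    set (c := cos s) in *. set (d := sin s) in *.
    replace ((x + l * (r * c - x)) ^ 2 + (y + l * (r * d - y)) ^ 2)
      with ((1 - l) ^ 2 * (x ^ 2 + y ^ 2) + 2 * (l * (1 - l)) * (r * (x * c + y * d))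
            + l ^ 2 * (r ^ 2 * (d * d + c * c))) by ring.
    rewrite hcs.
    assert (Rabs (r * (x * c + y * d)) <= r ^ 2) as hdot.
    { assert ((x * c + y * d) ^ 2 <= r ^ 2).
      { replace ((x * c + y * d) ^ 2) with ((x ^ 2 + y ^ 2) * (d * d + c * c) - (x * d - y * c) ^ 2) by ring.
        rewrite hcs. pose proof (pow2_ge_0 (x * d - y * c)). lra. }
      rewrite Rabs_mult, (Rabs_pos_eq r) by lra.
      assert (Rabs (x * c + y * d) <= r) by (apply Rabs_le_sq; lra). nra. }
    assert (2 * (l * (1 - l)) * (r * (x * c + y * d)) <= 2 * (Rabs l * Rabs (1 - l)) * r ^ 2) as h1.
    { eapply Rle_trans; [apply Rle_abs|].
      rewrite (Rabs_mult (2 * (l * (1 - l)))), (Rabs_mult 2), (Rabs_mult l), (Rabs_pos_eq 2) by lra.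
      apply Rmult_le_compat_l; [|exact hdot].
      apply Rmult_le_pos; [lra | apply Rmult_le_pos; apply Rabs_pos]. }
    rewrite <- (pow2_abs l), <- (pow2_abs (1 - l)) at 1.
    assert (Rabs l + Rabs (1 - l) <= 1 + 2 * eta).
    { unfold Rabs. destruct (Rcase_abs l), (Rcase_abs (1 - l)); unfold eta in *; lra. }
    pose proof (Rabs_pos l). pose proof (Rabs_pos (1 - l)).
    set (p := Rabs l) in *. set (q := Rabs (1 - l)) in *.
    assert ((p + q) * r < 1) as h2.
    { apply Rle_lt_trans with ((1 + 2 * eta) * r); [apply Rmult_le_compat_r; lra|].
      unfold eta. nra. }
    assert (0 <= (p + q) * r) by (apply Rmult_le_pos; lra).
    assert (((p + q) * r) ^ 2 < 1) by nra.
    assert (q ^ 2 * (x ^ 2 + y ^ 2) <= q ^ 2 * r ^ 2) by (apply Rmult_le_compat_l; [apply pow2_ge_0 | lra]).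
    nra. }
  set (Phi := fun l s => k1 s * U (X l s) (Y l s) + k2 s * W (X l s) (Y l s)).
  set (dPhi := fun l s => A (X l s) (Y l s) * (r * cos s) + B (X l s) (Y l s) * (r * sin s)).
  assert (forall l s, - eta < l < 1 + eta -> is_derive (fun u => Phi u s) l (dPhi l s)) as hder.
  { intros l s hl. unfold Phi, dPhi.
    assert (derivable_pt_lim (fun u => X u s) l (r * cos s - x)) as hX.
    { apply is_derive_Reals. unfold X. auto_derive; [trivial | ring]. }
    assert (derivable_pt_lim (fun u => Y u s) l (r * sin s - y)) as hY.
    { apply is_derive_Reals. unfold Y. auto_derive; [trivial | ring]. }
    pose proof (derivable_pt_lim_comp_2d U (fun u => X u s) (fun u => Y u s) l _ _ _ _
      (hU _ _ (hdisc l s hl)) hX hY) as d1.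
    pose proof (derivable_pt_lim_comp_2d W (fun u => X u s) (fun u => Y u s) l _ _ _ _
      (hW _ _ (hdisc l s hl)) hX hY) as d2.
    apply is_derive_Reals in d1, d2.
    replace (A (X l s) (Y l s) * (r * cos s) + B (X l s) (Y l s) * (r * sin s))
      with (k1 s * (A (X l s) (Y l s) * (r * cos s - x) + B (X l s) (Y l s) * (r * sin s - y))
            + k2 s * (B (X l s) (Y l s) * (r * cos s - x) + - A (X l s) (Y l s) * (r * sin s - y))).
    - apply (is_derive_plus (fun u => k1 s * U (X u s) (Y u s)) (fun u => k2 s * W (X u s) (Y u s)));
        apply is_derive_scal; assumption.
    - transitivity (A (X l s) (Y l s) * (k1 s * (r * cos s - x) - k2 s * (r * sin s - y))
        + B (X l s) (Y l s) * (k1 s * (r * sin s - y) + k2 s * (r * cos s - x))); [ring|].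
      now rewrite e1, e2. }
  assert (forall z : R * R, continuous (fun w : R * R => X (fst w) (snd w)) z) as hXc.
  { intros [l s]. apply (continuous_affine_circle _ x r fst (fun w : R * R => cos (snd w)));
      [apply continuous_fst|]. apply (continuous_comp snd cos); [apply continuous_snd | apply continuous_cos]. }
  assert (forall z : R * R, continuous (fun w : R * R => Y (fst w) (snd w)) z) as hYc.
  { intros [l s]. apply (continuous_affine_circle _ y r fst (fun w : R * R => sin (snd w)));
      [apply continuous_fst|]. apply (continuous_comp snd sin); [apply continuous_snd | apply continuous_sin]. }
  assert (forall l s, continuous (X l) s) as hXs.
  { intros l s. apply (continuous_affine_circle _ x r (fun _ => l) cos); [apply continuous_const | apply continuous_cos]. }
  assert (forall l s, continuous (Y l) s) as hYs.
  { intros l s. apply (continuous_affine_circle _ y r (fun _ => l) sin); [apply continuous_const | apply continuous_sin]. }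
  assert (forall l s, - eta < l < 1 + eta -> continuity_2d_pt dPhi l s) as hdc.
  { intros l s hl. apply continuity_2d_pt_filterlim. unfold dPhi.
    apply (continuous_plus (fun w : R * R => A (X (fst w) (snd w)) (Y (fst w) (snd w)) * (r * cos (snd w)))
      (fun w : R * R => B (X (fst w) (snd w)) (Y (fst w) (snd w)) * (r * sin (snd w))) (l, s)).
    - apply (continuous_mult (fun w : R * R => A (X (fst w) (snd w)) (Y (fst w) (snd w)))).
      + apply (continuous_2d_comp A _ (fun w : R * R => X (fst w) (snd w)) (fun w : R * R => Y (fst w) (snd w)));
          [apply hA, (hdisc l s hl) | apply hXc | apply hYc].
      + apply (continuous_mult (fun _ => r)); [apply continuous_const|].
        apply (continuous_comp snd cos); [apply continuous_snd | apply continuous_cos].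
    - apply (continuous_mult (fun w : R * R => B (X (fst w) (snd w)) (Y (fst w) (snd w)))).
      + apply (continuous_2d_comp B _ (fun w : R * R => X (fst w) (snd w)) (fun w : R * R => Y (fst w) (snd w)));
          [apply hB, (hdisc l s hl) | apply hXc | apply hYc].
      + apply (continuous_mult (fun _ => r)); [apply continuous_const|].
        apply (continuous_comp snd sin); [apply continuous_snd | apply continuous_sin]. }
  assert (forall l, - eta < l < 1 + eta -> ex_RInt (Phi l) 0 (2 * PI)) as hint.
  { intros l hl. apply (ex_RInt_continuous (V := R_CompleteNormedModule)). intros s _. unfold Phi.
    apply (continuous_plus (fun s => k1 s * U (X l s) (Y l s)) (fun s => k2 s * W (X l s) (Y l s))).
    - apply (continuous_mult k1); [apply hk1|]. apply (continuous_2d_comp U _ (X l) (Y l));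
        [eapply differentiable_continuous_2d, hU, hdisc, hl | apply hXs | apply hYs].
    - apply (continuous_mult k2); [apply hk2|]. apply (continuous_2d_comp W _ (X l) (Y l));
        [eapply differentiable_continuous_2d, hW, hdisc, hl | apply hXs | apply hYs]. }
  assert (0 < eta) as heta by (unfold eta; lra).
  assert (forall l, - eta < l < 1 + eta -> exists d : posreal, forall l', Rabs (l' - l) < d -> - eta < l' < 1 + eta) as hopen.
  { intros l hl. assert (0 < Rmin (l + eta) (1 + eta - l)) as hp by (apply Rmin_glb_lt; lra).
    exists (mkposreal _ hp). intros l' h'. simpl in h'.
    pose proof (Rmin_l (l + eta) (1 + eta - l)). pose proof (Rmin_r (l + eta) (1 + eta - l)).
    apply Rabs_lt_between in h'. lra. }
  set (G := fun l => RInt (Phi l) 0 (2 * PI)).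
  assert (forall l, - eta < l < 1 + eta -> is_derive G l (RInt (dPhi l) 0 (2 * PI))) as hG.
  { intros l hl. destruct (hopen l hl) as [d hd].
    replace (RInt (dPhi l) 0 (2 * PI)) with (RInt (fun t => Derive (fun u => Phi u t) l) 0 (2 * PI)).
    - apply (is_derive_RInt_param Phi).
      + exists d. intros l' h' t _. eexists. apply hder, hd, h'.
      + intros t _. apply continuity_2d_pt_ext_loc with dPhi; [|now apply hdc].
        exists d. intros u v hu _. symmetry. apply is_derive_unique, hder, hd, hu.
      + exists d. intros l' h'. apply hint, hd, h'.
    - apply RInt_ext. intros s _. apply is_derive_unique, hder, hl. }
  assert (forall l, 0 < l < 1 -> RInt (dPhi l) 0 (2 * PI) = 0) as hzero.
  { intros l hl. assert (- eta < l < 1 + eta) as hl' by lra.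
    apply (is_RInt_unique (V := R_CompleteNormedModule)).
    replace 0 with (minus (- / l * W (X l (2 * PI)) (Y l (2 * PI))) (- / l * W (X l 0) (Y l 0))) at 2.
    - apply (is_RInt_derive (V := R_CompleteNormedModule) (fun s => - / l * W (X l s) (Y l s))).
      + intros s _.
        assert (derivable_pt_lim (X l) s (- l * r * sin s)) as hX.
        { apply is_derive_Reals. unfold X. auto_derive; [trivial | ring]. }
        assert (derivable_pt_lim (Y l) s (l * r * cos s)) as hY.
        { apply is_derive_Reals. unfold Y. auto_derive; [trivial | ring]. }
        pose proof (derivable_pt_lim_comp_2d W (X l) (Y l) s _ _ _ _ (hW _ _ (hdisc l s hl')) hX hY) as d2.
        apply is_derive_Reals in d2.
        replace (dPhi l s) with (- / l * (B (X l s) (Y l s) * (- l * r * sin s) + - A (X l s) (Y l s) * (l * r * cos s)))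
          by (unfold dPhi; field; lra).
        now apply is_derive_scal.
      + intros s _. unfold dPhi.
        apply (continuous_plus (fun s => A (X l s) (Y l s) * (r * cos s)) (fun s => B (X l s) (Y l s) * (r * sin s))).
        * apply (continuous_mult (fun s => A (X l s) (Y l s))).
          -- apply (continuous_2d_comp A _ (X l) (Y l));
        [apply hA, hdisc, hl' | apply hXs | apply hYs].
          -- apply (continuous_mult (fun _ => r)); [apply continuous_const | apply continuous_cos].
        * apply (continuous_mult (fun s => B (X l s) (Y l s))).
          -- apply (continuous_2d_comp B _ (X l) (Y l));
        [apply hB, hdisc, hl' | apply hXs | apply hYs].
          -- apply (continuous_mult (fun _ => r)); [apply continuous_const | apply continuous_sin].
    - unfold X, Y. rewrite cos_2PI, sin_2PI, cos_0, sin_0. apply (minus_eq_zero (G := R_AbelianGroup)). }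
  destruct (MVT_gen G 0 1 (fun _ => 0)) as [c [_ hc]].
  - intros l hl. rewrite Rmin_left, Rmax_right in hl by lra. rewrite <- (hzero l hl). apply hG; lra.
  - intros l hl. rewrite Rmin_left, Rmax_right in hl by lra.
    apply continuity_pt_filterlim, (ex_derive_continuous G). eexists. apply hG; lra.
  - rewrite Rmult_0_l in hc. apply Rminus_diag_uniq in hc. unfold G, Phi, X, Y in hc.
    etransitivity; [|etransitivity; [exact hc|]]; apply RInt_ext; intros s _;
      [replace (x + 1 * (r * cos s - x)) with (r * cos s) by ring;
       replace (y + 1 * (r * sin s - y)) with (r * sin s) by ring
      |rewrite !Rmult_0_l, !Rplus_0_r]; reflexivity.
Qed.

(** * Averages over a circle *)

(** Real coordinates, and their compositions with left multiplication by a unit: the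
    pair pi(f), pi(I f) is what turns slice regularity into Cauchy-Riemann equations
    for real functions. *)
Definition real_form (pi : H -> R) : Prop :=
  (forall u v, pi (u + v)%H = pi u + pi v) /\ (forall t u, pi (RtoH t * u)%H = t * pi u) /\
  (forall u, Rabs (pi u) <= Hnorm u).

Lemma real_form_re : real_form re.
Proof. split; [|split]; auto using re_le; intros; hunf; ring. Qed.
Lemma real_form_im_i : real_form im_i.
Proof. split; [|split]; auto using im_i_le; intros; hunf; ring. Qed.
Lemma real_form_im_j : real_form im_j.
Proof. split; [|split]; auto using im_j_le; intros; hunf; ring. Qed.
Lemma real_form_im_k : real_form im_k.
Proof. split; [|split]; auto using im_k_le; intros; hunf; ring. Qed.

Lemma real_form_opp pi u : real_form pi -> pi (- u)%H = - pi u.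
Proof.
  intros [_ [hs _]]. replace (- u)%H with (RtoH (-1) * u)%H by hring. rewrite hs; ring.
Qed.

Lemma real_form_lmul pi c : real_form pi -> Hnorm c <= 1 -> real_form (fun u => pi (c * u)%H).
Proof.
  intros [ha [hs hb]] hc. split; [|split].
  - intros u v. now rewrite Hmul_addr, ha.
  - intros t u. replace (c * (RtoH t * u))%H with (RtoH t * (c * u))%H by hring. apply hs.
  - intros u. eapply Rle_trans; [apply hb|]. rewrite Hnorm_mul. pose proof (Hnorm_ge0 u). nra.
Qed.

Lemma real_form_continuous (T : UniformSpace) pi (g : T -> H) (z : T) :
  real_form pi -> continuous g z -> continuous (fun t => pi (g t)) z.
Proof.
  intros hp hg. apply (continuous_comp g pi); [exact hg|].
  apply (proj2 (filterlim_locally (F := locally (g z)) pi (pi (g z)))). intros [eps heps].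
  assert (hl := locally_ball_norm (g z) (mkposreal _ heps)).
  eapply filter_imp; [|exact hl]. intros u hu.
  change (Rabs (pi u - pi (g z)) < eps). unfold ball_norm in hu.
  rewrite norm_Hnorm, minus_Hsub in hu. simpl in hu.
  eapply Rle_lt_trans; [|exact hu]. destruct hp as [ha [hs hb]].
  unfold Rminus. rewrite <- (real_form_opp pi) by (split; auto). rewrite <- ha. apply hb.
Qed.

Definition hcont (g : R -> H) : Prop :=
  forall s, continuous (fun t => re (g t)) s /\ continuous (fun t => im_i (g t)) s /\
            continuous (fun t => im_j (g t)) s /\ continuous (fun t => im_k (g t)) s.

Ltac cont_real :=
  repeat first
    [ assumption
    | apply continuous_const
    | match goal with
      | |- continuous (fun t => @?f t + @?g t) _ => apply (continuous_plus f g)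
      | |- continuous (fun t => @?f t - @?g t) _ => apply (continuous_minus f g)
      | |- continuous (fun t => @?f t * @?g t) _ => apply (continuous_mult f g)
      | |- continuous (fun t => - @?f t) _ => apply (continuous_opp f)
      end ].

Lemma hcont_re g s : hcont g -> continuous (fun t => re (g t)) s.
Proof. intros h; exact (proj1 (h s)). Qed.
Lemma hcont_im_i g s : hcont g -> continuous (fun t => im_i (g t)) s.
Proof. intros h; exact (proj1 (proj2 (h s))). Qed.
Lemma hcont_im_j g s : hcont g -> continuous (fun t => im_j (g t)) s.
Proof. intros h; exact (proj1 (proj2 (proj2 (h s)))). Qed.
Lemma hcont_im_k g s : hcont g -> continuous (fun t => im_k (g t)) s.
Proof. intros h; exact (proj2 (proj2 (proj2 (h s)))). Qed.

Lemma hcont_mul (g h : R -> H) : hcont g -> hcont h -> hcont (fun s => g s * h s)%H.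
Proof.
  intros hg hh s. destruct (hg s) as [g1 [g2 [g3 g4]]], (hh s) as [h1 [h2 [h3 h4]]].
  split; [|split; [|split]]; cbn [re im_i im_j im_k Hmul fst snd]; cont_real.
Qed.

Lemma hcont_add (g h : R -> H) : hcont g -> hcont h -> hcont (fun s => g s + h s)%H.
Proof.
  intros hg hh s. destruct (hg s) as [g1 [g2 [g3 g4]]], (hh s) as [h1 [h2 [h3 h4]]].
  split; [|split; [|split]]; cbn [re im_i im_j im_k Hadd fst snd]; cont_real.
Qed.

Lemma hcont_const c : hcont (fun _ => c).
Proof. intros s; split; [|split; [|split]]; apply continuous_const. Qed.

Lemma hcont_pow g n : hcont g -> hcont (fun s => Hpow (g s) n).
Proof.
  intros hg; induction n as [|n IH]; cbn [Hpow]; [apply hcont_const | now apply hcont_mul].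
Qed.

Lemma hcont_slice I (p q : R -> R) :
  (forall s, continuous p s) -> (forall s, continuous q s) -> hcont (fun s => slice I (p s) (q s)).
Proof.
  intros hp hq s. specialize (hp s). specialize (hq s).
  split; [|split; [|split]]; cbn [slice re im_i im_j im_k Hmul Hadd RtoH fst snd]; cont_real.
Qed.

Lemma hcont_hsum (u : nat -> R -> H) n :
  (forall k, hcont (u k)) -> hcont (fun s => hsum (fun k => u k s) n).
Proof.
  intros h; induction n as [|n IH]; cbn [hsum]; [apply hcont_const | now apply hcont_add].
Qed.

Definition rmean (g : R -> R) : R := RInt g 0 (2 * PI) / (2 * PI).

Definition hmean (g : R -> H) : H :=
  (rmean (fun s => re (g s)), rmean (fun s => im_i (g s)),
   rmean (fun s => im_j (g s)), rmean (fun s => im_k (g s))).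

Lemma ex_RInt_cont (g : R -> R) a b : (forall s, continuous g s) -> ex_RInt g a b.
Proof. intros h; apply (ex_RInt_continuous (V := R_CompleteNormedModule)); auto. Qed.

Lemma two_PI_pos : 0 < 2 * PI.
Proof. pose proof PI_RGT_0; lra. Qed.

Lemma rmean_ext (g h : R -> R) : (forall s, g s = h s) -> rmean g = rmean h.
Proof. intros E; unfold rmean; f_equal; apply RInt_ext; auto. Qed.

Lemma rmean_plus (g h : R -> R) :
  (forall s, continuous g s) -> (forall s, continuous h s) ->
  rmean (fun s => g s + h s) = rmean g + rmean h.
Proof.
  intros hg hh; unfold rmean.
  rewrite (RInt_plus (V := R_CompleteNormedModule) g h) by (now apply ex_RInt_cont).
  unfold plus; simpl; field. pose proof two_PI_pos; lra.
Qed.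

Lemma rmean_scal c (g : R -> R) : (forall s, continuous g s) -> rmean (fun s => c * g s) = c * rmean g.
Proof.
  intros hg; unfold rmean.
  rewrite (RInt_scal (V := R_CompleteNormedModule) g) by (now apply ex_RInt_cont).
  unfold scal; simpl; unfold mult; simpl; field. pose proof two_PI_pos; lra.
Qed.

Lemma rmean_const c : rmean (fun _ => c) = c.
Proof.
  unfold rmean. rewrite RInt_const. unfold scal; simpl; unfold mult; simpl.
  field. pose proof two_PI_pos; lra.
Qed.

Lemma rmean_le (g h : R -> R) :
  (forall s, continuous g s) -> (forall s, continuous h s) ->
  (forall s, 0 <= s <= 2 * PI -> g s <= h s) -> rmean g <= rmean h.
Proof.
  intros hg hh hle. pose proof two_PI_pos. apply Rmult_le_compat_r.
  - left; apply Rinv_0_lt_compat; lra.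
  - apply RInt_le; [lra | now apply ex_RInt_cont | now apply ex_RInt_cont |].
    intros s hs; apply hle; lra.
Qed.

Lemma rmean_abs_le (g : R -> R) C :
  (forall s, continuous g s) -> (forall s, 0 <= s <= 2 * PI -> Rabs (g s) <= C) ->
  Rabs (rmean g) <= C.
Proof.
  intros hg hC. apply Rabs_le. split.
  - rewrite <- (rmean_const (- C)). apply rmean_le; [intros; apply continuous_const | exact hg|].
    intros s hs; specialize (hC s hs); apply Rabs_le_between in hC; lra.
  - rewrite <- (rmean_const C). apply rmean_le; [exact hg | intros; apply continuous_const|].
    intros s hs; specialize (hC s hs); apply Rabs_le_between in hC; lra.
Qed.

Lemma hmean_ext (g h : R -> H) : (forall s, g s = h s) -> hmean g = hmean h.
Proof. intros E. unfold hmean. now rewrite (functional_extensionality g h E). Qed.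

Lemma hmean_const c : hmean (fun _ => c) = c.
Proof. unfold hmean. rewrite !rmean_const. now destruct c as [[[? ?] ?] ?]. Qed.

Lemma hmean_add (g h : R -> H) : hcont g -> hcont h -> hmean (fun s => g s + h s)%H = (hmean g + hmean h)%H.
Proof.
  intros hg hh. apply H_ext.
  - apply (rmean_plus (fun s => re (g s)) (fun s => re (h s))); intros; now apply hcont_re.
  - apply (rmean_plus (fun s => im_i (g s)) (fun s => im_i (h s))); intros; now apply hcont_im_i.
  - apply (rmean_plus (fun s => im_j (g s)) (fun s => im_j (h s))); intros; now apply hcont_im_j.
  - apply (rmean_plus (fun s => im_k (g s)) (fun s => im_k (h s))); intros; now apply hcont_im_k.
Qed.

Lemma hmean_lmul c g : hcont g -> hmean (fun s => c * g s)%H = (c * hmean g)%H.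
Proof.
  intros hg.
  assert (forall s, continuous (fun t => re (g t)) s) as g1 by (intros; now apply hcont_re).
  assert (forall s, continuous (fun t => im_i (g t)) s) as g2 by (intros; now apply hcont_im_i).
  assert (forall s, continuous (fun t => im_j (g t)) s) as g3 by (intros; now apply hcont_im_j).
  assert (forall s, continuous (fun t => im_k (g t)) s) as g4 by (intros; now apply hcont_im_k).
  assert (forall a b d e, rmean (fun s => a * re (g s) + b * im_i (g s) + d * im_j (g s) + e * im_k (g s))
    = a * re (hmean g) + b * im_i (hmean g) + d * im_j (hmean g) + e * im_k (hmean g)) as E.
  { intros a b d e.
    rewrite (rmean_plus (fun s => a * re (g s) + b * im_i (g s) + d * im_j (g s)) (fun s => e * im_k (g s)));
      [|intros s; specialize (g1 s); specialize (g2 s); specialize (g3 s); specialize (g4 s); cont_real ..].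
    rewrite (rmean_plus (fun s => a * re (g s) + b * im_i (g s)) (fun s => d * im_j (g s)));
      [|intros s; specialize (g1 s); specialize (g2 s); specialize (g3 s); specialize (g4 s); cont_real ..].
    rewrite (rmean_plus (fun s => a * re (g s)) (fun s => b * im_i (g s)));
      [|intros s; specialize (g1 s); specialize (g2 s); specialize (g3 s); specialize (g4 s); cont_real ..].
    rewrite !rmean_scal by assumption. reflexivity. }
  apply H_ext.
  - transitivity (rmean (fun s => re c * re (g s) + - im_i c * im_i (g s) + - im_j c * im_j (g s) + - im_k c * im_k (g s))).
    + apply rmean_ext; intros; hunf; ring.
    + rewrite E; hunf; ring.
  - transitivity (rmean (fun s => im_i c * re (g s) + re c * im_i (g s) + - im_k c * im_j (g s) + im_j c * im_k (g s))).
    + apply rmean_ext; intros; hunf; ring.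
    + rewrite E; hunf; ring.
  - transitivity (rmean (fun s => im_j c * re (g s) + im_k c * im_i (g s) + re c * im_j (g s) + - im_i c * im_k (g s))).
    + apply rmean_ext; intros; hunf; ring.
    + rewrite E; hunf; ring.
  - transitivity (rmean (fun s => im_k c * re (g s) + - im_j c * im_i (g s) + im_i c * im_j (g s) + re c * im_k (g s))).
    + apply rmean_ext; intros; hunf; ring.
    + rewrite E; hunf; ring.
Qed.

Lemma hmean_hsum (u : nat -> R -> H) n :
  (forall k, hcont (u k)) ->
  hmean (fun s => hsum (fun k => u k s) n) = hsum (fun k => hmean (u k)) n.
Proof.
  intros hu; induction n as [|n IH]; cbn [hsum]; [apply hmean_const|].
  rewrite hmean_add, IH; auto. now apply hcont_hsum.
Qed.

Lemma hmean_norm_le g C :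
  hcont g -> (forall s, 0 <= s <= 2 * PI -> Hnorm (g s) <= C) -> Hnorm (hmean g) <= 2 * C.
Proof.
  intros hg hC. apply Hnorm_le_components; cbn [hmean re im_i im_j im_k fst snd];
    apply rmean_abs_le; auto using hcont_re, hcont_im_i, hcont_im_j, hcont_im_k;
    intros s hs; (eapply Rle_trans; [|apply hC, hs]); auto using re_le, im_i_le, im_j_le, im_k_le.
Qed.

Lemma hcont_bounded g : hcont g -> exists C, 0 <= C /\ forall s, 0 <= s <= 2 * PI -> Hnorm (g s) <= C.
Proof.
  intros hg.
  assert (forall h : R -> R, (forall s, continuous h s) ->
    exists C, forall s, 0 <= s <= 2 * PI -> Rabs (h s) <= C) as hb.
  { intros h hh. destruct (bounded_continuity (V := R_NormedModule) h 0 (2 * PI)) as [M hM].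
    - intros; apply hh.
    - exists M; intros s hs; left; apply (hM s hs). }
  destruct (hb _ (fun s => proj1 (hg s))) as [C1 h1].
  destruct (hb _ (fun s => proj1 (proj2 (hg s)))) as [C2 h2].
  destruct (hb _ (fun s => proj1 (proj2 (proj2 (hg s))))) as [C3 h3].
  destruct (hb _ (fun s => proj2 (proj2 (proj2 (hg s))))) as [C4 h4].
  pose proof (Rabs_pos C1). pose proof (Rabs_pos C2). pose proof (Rabs_pos C3). pose proof (Rabs_pos C4).
  pose proof (Rle_abs C1). pose proof (Rle_abs C2). pose proof (Rle_abs C3). pose proof (Rle_abs C4).
  exists (2 * (Rabs C1 + Rabs C2 + Rabs C3 + Rabs C4)). split; [lra|].
  intros s hs. specialize (h1 s hs); specialize (h2 s hs); specialize (h3 s hs); specialize (h4 s hs).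
  apply Hnorm_le_components; lra.
Qed.

Definition circle (I : H) (r s : R) : H := slice I (r * cos s) (r * sin s).

Lemma circle_norm I r s : imaginary_unit I -> 0 <= r -> Hnorm (circle I r s) = r.
Proof.
  intros hI hr. unfold circle, Hnorm. change (sqrt (Hsq (slice I (r * cos s) (r * sin s))) = r).
  rewrite Hsq_slice by exact hI. rewrite <- (sqrt_pow2 r hr). f_equal.
  assert (h := sin2_cos2 s). unfold Rsqr in h.
  rewrite (sqrt_pow2 r hr). replace ((r * cos s) ^ 2 + (r * sin s) ^ 2)
    with (r ^ 2 * (sin s * sin s + cos s * cos s)) by ring. rewrite h; ring.
Qed.

Lemma circle_mul I r s r' s' :
  imaginary_unit I -> (circle I r s * circle I r' s')%H = circle I (r * r') (s + s').
Proof.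
  intros hI; unfold circle. rewrite slice_mul, cos_plus, sin_plus by exact hI. f_equal; ring.
Qed.

Lemma circle_pow I r s n :
  imaginary_unit I -> Hpow (circle I r s) n = circle I (r ^ n) (INR n * s).
Proof.
  intros hI; induction n as [|n IH].
  - cbn [Hpow INR pow]. unfold circle. rewrite Rmult_0_l, cos_0, sin_0. hring.
  - cbn [Hpow]. rewrite IH, circle_mul by exact hI. rewrite S_INR. cbn [pow]. f_equal; ring.
Qed.

Lemma hcont_circle I r k : hcont (fun s => circle I r (k * s)).
Proof.
  apply hcont_slice; intros s; apply (continuous_mult (fun _ => r)); try apply continuous_const.
  - apply (continuous_comp (fun s => k * s) cos); [|apply continuous_cos].
    apply (continuous_mult (fun _ => k)); [apply continuous_const | apply continuous_id].
  - apply (continuous_comp (fun s => k * s) sin); [|apply continuous_sin].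
    apply (continuous_mult (fun _ => k)); [apply continuous_const | apply continuous_id].
Qed.

Lemma hmean_slice I (p q : R -> R) :
  (forall s, continuous p s) -> (forall s, continuous q s) ->
  hmean (fun s => slice I (p s) (q s)) = slice I (rmean p) (rmean q).
Proof.
  intros hp hq.
  assert (forall c, rmean (fun s => p s + q s * c) = rmean p + rmean q * c) as E.
  { intros c. rewrite (rmean_plus p (fun s => q s * c)); [|exact hp|].
    - rewrite (rmean_ext (fun s => q s * c) (fun s => c * q s)) by (intros; ring).
      rewrite rmean_scal by exact hq; ring.
    - intros s; specialize (hq s); cont_real. }
  assert (forall c, rmean (fun s => q s * c) = rmean q * c) as E'.
  { intros c. rewrite (rmean_ext (fun s => q s * c) (fun s => c * q s)) by (intros; ring).
    rewrite rmean_scal by exact hq; ring. }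
  apply H_ext.
  - transitivity (rmean (fun s => p s + q s * re I)); [apply rmean_ext; intros; hunf; ring|].
    rewrite E; hunf; ring.
  - transitivity (rmean (fun s => q s * im_i I)); [apply rmean_ext; intros; hunf; ring|].
    rewrite E'; hunf; ring.
  - transitivity (rmean (fun s => q s * im_j I)); [apply rmean_ext; intros; hunf; ring|].
    rewrite E'; hunf; ring.
  - transitivity (rmean (fun s => q s * im_k I)); [apply rmean_ext; intros; hunf; ring|].
    rewrite E'; hunf; ring.
Qed.

Lemma hmean_circle I r k :
  k <> 0 -> cos (k * (2 * PI)) = 1 -> sin (k * (2 * PI)) = 0 ->
  hmean (fun s => circle I r (k * s)) = RtoH 0.
Proof.
  intros hk hc hs. pose proof two_PI_pos.
  assert (forall s, continuous (fun s => cos (k * s)) s) as cc.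
  { intros s. apply (continuous_comp (fun s => k * s) cos); [|apply continuous_cos].
    apply (continuous_mult (fun _ => k)); [apply continuous_const | apply continuous_id]. }
  assert (forall s, continuous (fun s => sin (k * s)) s) as cs.
  { intros s. apply (continuous_comp (fun s => k * s) sin); [|apply continuous_sin].
    apply (continuous_mult (fun _ => k)); [apply continuous_const | apply continuous_id]. }
  unfold circle. rewrite hmean_slice, !rmean_scal; trivial;
    try (intros s; apply (continuous_mult (fun _ => r)); [apply continuous_const | auto]).
  assert (rmean (fun s => cos (k * s)) = 0) as ->.
  { unfold rmean. rewrite (is_RInt_unique (V := R_CompleteNormedModule) _ _ _
      (minus (sin (k * (2 * PI)) / k) (sin (k * 0) / k))).
    - rewrite hs, Rmult_0_r, sin_0, (minus_eq_zero (G := R_AbelianGroup)).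
      unfold zero; simpl; field; lra.
    - apply (is_RInt_derive (V := R_CompleteNormedModule) (fun s => sin (k * s) / k)); intros s _; [|apply cc].
      auto_derive; [trivial | field; exact hk]. }
  assert (rmean (fun s => sin (k * s)) = 0) as ->.
  { unfold rmean. rewrite (is_RInt_unique (V := R_CompleteNormedModule) _ _ _
      (minus (- cos (k * (2 * PI)) / k) (- cos (k * 0) / k))).
    - rewrite hc, Rmult_0_r, cos_0, (minus_eq_zero (G := R_AbelianGroup)).
      unfold zero; simpl; field; lra.
    - apply (is_RInt_derive (V := R_CompleteNormedModule) (fun s => - cos (k * s) / k)); intros s _; [|apply cs].
      auto_derive; [trivial | field; exact hk]. }
  hring.
Qed.

Lemma cos_sin_period n :
  cos (INR n * (2 * PI)) = 1 /\ sin (INR n * (2 * PI)) = 0.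
Proof.
  replace (INR n * (2 * PI)) with (0 + 2 * INR n * PI) by ring.
  now rewrite cos_period, sin_period, cos_0, sin_0.
Qed.

Lemma hmean_circle_pos I r n : (0 < n)%nat -> hmean (fun s => circle I r (INR n * s)) = RtoH 0.
Proof.
  intros hn; destruct (cos_sin_period n). apply hmean_circle; trivial.
  apply not_0_INR; lia.
Qed.

Lemma hmean_circle_neg I r n : (0 < n)%nat -> hmean (fun s => circle I r (- INR n * s)) = RtoH 0.
Proof.
  intros hn; destruct (cos_sin_period n) as [h1 h2]. apply hmean_circle.
  - apply Ropp_neq_0_compat, not_0_INR; lia.
  - now rewrite Ropp_mult_distr_l_reverse, cos_neg.
  - rewrite Ropp_mult_distr_l_reverse, sin_neg, h2; ring.
Qed.

(** * Cauchy formula on a slice *)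

Lemma slice_regular_derivatives f I x y :
  slice_regular f -> imaginary_unit I -> in_ball (slice I x y) ->
  is_derive (fun t => f (slice I t y)) x (partial_x f I x y) /\
  is_derive (fun t => f (slice I x t)) y (I * partial_x f I x y)%H /\
  continuous (fun z : R * R => partial_x f I (fst z) (snd z)) (x, y).
Proof.
  intros hf hI hq. destruct (hf I hI x y hq) as [[l hl] [[m hm] [hc [_ cr]]]].
  assert (partial_x f I x y = l) as el by (apply HDerive_unique, hl).
  assert (partial_y f I x y = m) as em by (apply HDerive_unique, hm).
  split; [rewrite el; exact hl|]. split; [|exact hc].
  rewrite el, em in cr. replace (I * partial_x f I x y)%H with m; [exact hm|].
  rewrite el. apply Hsub_eq0.
  transitivity (- (RtoH 2 * I) * (RtoH (/ 2) * (l + I * m)) + (RtoH 1 + I * I) * m)%H.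
  - transitivity (m - I * l)%H; [reflexivity|].
    transitivity (RtoH (2 * / 2) * (- (I * (l + I * m))) + (RtoH 1 + I * I) * m)%H; [|hring].
    replace (2 * / 2) with 1 by field. hring.
  - rewrite cr, hI. hring.
Qed.

Lemma slice_disc_locally I x y :
  imaginary_unit I -> in_ball (slice I x y) ->
  locally (x, y) (fun z : R * R => in_ball (slice I (fst z) (snd z))).
Proof.
  intros hI hq. destruct (slice_disc I x y hI hq) as [delta [rho [hd [hr hb]]]].
  exists (mkposreal _ hd). intros [u v] [hu hv].
  change (Rabs (u - x) < delta) in hu. change (Rabs (v - y) < delta) in hv. cbn [fst snd].
  specialize (hb _ _ hu hv). rewrite !Rplus_minus in hb. unfold in_ball; lra.
Qed.

Lemma real_form_derive (pi : H -> R) (phi : R -> H) x (l : H) :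
  real_form pi -> is_derive phi x l -> is_derive (fun t => pi (phi t)) x (pi l).
Proof.
  intros hp. apply component_is_derive; try apply hp.
  intros u; now apply real_form_opp.
Qed.

Lemma real_form_differentiable pi f I u v :
  real_form pi -> slice_regular f -> imaginary_unit I -> in_ball (slice I u v) ->
  differentiable_pt_lim (fun s t => pi (f (slice I s t))) u v
    (pi (partial_x f I u v)) (pi (I * partial_x f I u v)%H).
Proof.
  intros hp hf hI hq. apply filterdiff_differentiable_pt_lim.
  apply (is_derive_filterdiff (fun s t => pi (f (slice I s t))) u v
    (fun s t => pi (partial_x f I s t)) (pi (I * partial_x f I u v)%H)).
  - eapply filter_imp; [|apply (slice_disc_locally I u v hI hq)].
    intros [s t] h. cbn [fst snd] in *. apply (real_form_derive pi (fun z => f (slice I z t))); [exact hp|].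
    exact (proj1 (slice_regular_derivatives f I s t hf hI h)).
  - apply (real_form_derive pi (fun z => f (slice I u z))); [exact hp|].
    exact (proj1 (proj2 (slice_regular_derivatives f I u v hf hI hq))).
  - apply (real_form_continuous _ pi (fun z : R * R => partial_x f I (fst z) (snd z))); [exact hp|].
    exact (proj2 (proj2 (slice_regular_derivatives f I u v hf hI hq))).
Qed.

Lemma hcont_circle_comp f I r :
  slice_regular f -> imaginary_unit I -> 0 < r < 1 -> hcont (fun s => f (circle I r s)).
Proof.
  intros hf hI hr s.
  assert (forall pi, real_form pi -> continuous (fun t => pi (f (circle I r t))) s) as h.
  { intros pi hp. unfold circle.
    apply (continuous_2d_comp (fun a b => pi (f (slice I a b))) _ (fun t => r * cos t) (fun t => r * sin t)).
    - eapply differentiable_continuous_2d, (real_form_differentiable pi f I); trivial.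
      fold (circle I r s). unfold in_ball. rewrite circle_norm; [lra | exact hI | lra].
    - apply (continuous_mult (fun _ => r)); [apply continuous_const | apply continuous_cos].
    - apply (continuous_mult (fun _ => r)); [apply continuous_const | apply continuous_sin]. }
  split; [|split; [|split]]; apply h;
    auto using real_form_re, real_form_im_i, real_form_im_j, real_form_im_k.
Qed.

(** The Cauchy kernel w / (w - z) at the point w = r (cos s + I sin s), for
    z = x + y I; its two coordinates on the slice do not depend on I. *)
Definition kernel_den (r x y s : R) : R := (r * cos s - x) ^ 2 + (r * sin s - y) ^ 2.
Definition kernel_re (r x y s : R) : R :=
  (r * cos s * (r * cos s - x) + r * sin s * (r * sin s - y)) / kernel_den r x y s.
Definition kernel_im (r x y s : R) : R :=
  (r * sin s * (r * cos s - x) - r * cos s * (r * sin s - y)) / kernel_den r x y s.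
Definition kernel (I : H) (r x y s : R) : H := slice I (kernel_re r x y s) (kernel_im r x y s).

Lemma kernel_den_pos r x y s : x ^ 2 + y ^ 2 < r ^ 2 -> 0 < kernel_den r x y s.
Proof.
  intros hz; unfold kernel_den.
  destruct (Rle_lt_dec ((r * cos s - x) ^ 2 + (r * sin s - y) ^ 2) 0) as [h|h]; [|exact h].
  exfalso. assert (hcs := sin2_cos2 s). unfold Rsqr in hcs.
  pose proof (pow2_ge_0 (r * cos s - x)). pose proof (pow2_ge_0 (r * sin s - y)).
  assert (r * cos s = x) by (apply Rminus_diag_uniq, Rsqr_0_uniq; unfold Rsqr; lra).
  assert (r * sin s = y) by (apply Rminus_diag_uniq, Rsqr_0_uniq; unfold Rsqr; lra).
  assert (x ^ 2 + y ^ 2 = r ^ 2 * (sin s * sin s + cos s * cos s)) by (subst; ring).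
  rewrite hcs in *. lra.
Qed.

Lemma kernel_continuous r x y :
  x ^ 2 + y ^ 2 < r ^ 2 ->
  (forall s, continuous (kernel_re r x y) s) /\ (forall s, continuous (kernel_im r x y) s).
Proof.
  intros hz.
  assert (forall s, continuous (fun s => / kernel_den r x y s) s) as hD.
  { intros s. apply (ex_derive_continuous (fun s => / kernel_den r x y s)).
    unfold kernel_den. auto_derive. pose proof (kernel_den_pos r x y s hz) as h.
    unfold kernel_den in h. intros E. simpl in h. nra. }
  split; intros s.
  - apply (continuous_mult (fun s => r * cos s * (r * cos s - x) + r * sin s * (r * sin s - y))); [|apply hD].
    apply (ex_derive_continuous (fun s => r * cos s * (r * cos s - x) + r * sin s * (r * sin s - y))).
    auto_derive; trivial.
  - apply (continuous_mult (fun s => r * sin s * (r * cos s - x) - r * cos s * (r * sin s - y))); [|apply hD].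
    apply (ex_derive_continuous (fun s => r * sin s * (r * cos s - x) - r * cos s * (r * sin s - y))).
    auto_derive; trivial.
Qed.

Lemma kernel_hcont I r x y : x ^ 2 + y ^ 2 < r ^ 2 -> hcont (kernel I r x y).
Proof.
  intros hz; destruct (kernel_continuous r x y hz) as [h1 h2].
  exact (hcont_slice I _ _ h1 h2).
Qed.

Lemma kernel_spec r x y s :
  x ^ 2 + y ^ 2 < r ^ 2 ->
  kernel_re r x y s * (r * cos s - x) - kernel_im r x y s * (r * sin s - y) = r * cos s /\
  kernel_re r x y s * (r * sin s - y) + kernel_im r x y s * (r * cos s - x) = r * sin s.
Proof.
  intros hz. pose proof (kernel_den_pos r x y s hz) as hD. unfold kernel_re, kernel_im. split.
  - transitivity (r * cos s * kernel_den r x y s / kernel_den r x y s); [|field; lra].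
    unfold kernel_den at 3. field; lra.
  - transitivity (r * sin s * kernel_den r x y s / kernel_den r x y s); [|field; lra].
    unfold kernel_den at 3. field; lra.
Qed.

Lemma circle_inverse I r s :
  imaginary_unit I -> 0 < r -> (circle I r s * circle I (/ r) (- 1 * s))%H = RtoH 1.
Proof.
  intros hI hr. rewrite circle_mul by exact hI. unfold circle.
  replace (s + -1 * s) with 0 by ring. rewrite cos_0, sin_0, Rinv_r by lra. hring.
Qed.

(** One step of the geometric series of z / w. *)
Lemma kernel_step I r x y s :
  imaginary_unit I -> 0 < r -> x ^ 2 + y ^ 2 < r ^ 2 ->
  kernel I r x y s
  = (RtoH 1 + slice I x y * (circle I (/ r) (- 1 * s) * kernel I r x y s))%H.
Proof.
  intros hI hr hz.
  assert (kernel I r x y s * (circle I r s - slice I x y) = circle I r s)%H as E.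
  { destruct (kernel_spec r x y s hz) as [e1 e2].
    replace (circle I r s - slice I x y)%H with (slice I (r * cos s - x) (r * sin s - y))
      by (unfold circle; hring).
    unfold kernel. rewrite slice_mul by exact hI. unfold circle. now rewrite e1, e2. }
  assert (kernel I r x y s * circle I r s = circle I r s + kernel I r x y s * slice I x y)%H as E'
    by (rewrite <- E at 2; hring).
  transitivity ((kernel I r x y s * circle I r s) * circle I (/ r) (- 1 * s))%H.
  - rewrite <- Hmul_assoc, circle_inverse by assumption; hring.
  - rewrite E', Hmul_addl, circle_inverse by assumption. f_equal. unfold kernel, circle. hring.
Qed.

Definition cauchy_coef (I : H) (r : R) (g : R -> H) (m : nat) : H :=
  hmean (fun s => Hpow (circle I (/ r) (- 1 * s)) m * g s)%H.

(** Iterating [kernel_step] N times leaves a remainder of order (|z| / r)^N. *)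
Lemma kernel_expansion I r x y g :
  imaginary_unit I -> 0 < r < 1 -> x ^ 2 + y ^ 2 < r ^ 2 -> hcont g ->
  Hlim (hsum (fun m => Hpow (slice I x y) m * cauchy_coef I r g m)%H)
       (hmean (fun s => kernel I r x y s * g s)%H).
Proof.
  intros hI hr hz hg. set (z := slice I x y). set (v := fun s => circle I (/ r) (- 1 * s)).
  assert (hcont v) as hv by apply hcont_circle.
  assert (hcont (kernel I r x y)) as hK by (now apply kernel_hcont).
  assert (hcont (fun s => kernel I r x y s * g s)%H) as hKg by (now apply hcont_mul).
  destruct (hcont_bounded _ hKg) as [C [hC hb]].
  assert (Hnorm z < r) as hzr.
  { pose proof (Hnorm_ge0 z). apply Rsqr_incrst_0; try lra. unfold Rsqr.
    replace (Hnorm z * Hnorm z) with (Hnorm z ^ 2) by ring.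
    unfold z. rewrite Hnorm_sq, Hsq_slice by exact hI. lra. }
  assert (forall n s, kernel I r x y s * g s
    = hsum (fun m => Hpow z m * (Hpow (v s) m * g s)) n + Hpow z n * (Hpow (v s) n * (kernel I r x y s * g s)))%H as hexp.
  { intros n s; induction n as [|n IH]; [cbn [hsum Hpow]; hring|].
    rewrite IH at 1. cbn [hsum]. rewrite <- Hadd_assoc. f_equal.
    rewrite (kernel_step I r x y s hI (proj1 hr) hz) at 1. fold (v s). fold z.
    assert (Hpow (v s) n * z = z * Hpow (v s) n)%H as hc
      by (apply Hpow_commute; unfold v, z, circle; apply slice_comm).
    rewrite Hmul_addl, Hmul_1l, !Hmul_addr. f_equal.
    cbn [Hpow]. rewrite <- !Hpow_comm, <- !Hmul_assoc. f_equal.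
    now rewrite (Hmul_assoc (Hpow (v s) n)), hc, <- Hmul_assoc. }
  apply Hlim_geom with (Hnorm z / r) (2 * C).
  { split; [apply Rdiv_le_0_compat; [apply Hnorm_ge0 | lra]|]. apply Rlt_div_l; lra. }
  intros n.
  assert (forall k, hcont (fun s => Hpow (v s) k * g s)%H) as hvk.
  { intros k; apply hcont_mul; [now apply hcont_pow | exact hg]. }
  assert (hcont (fun s => Hpow (v s) n * (kernel I r x y s * g s))%H) as hrem.
  { apply hcont_mul; [now apply hcont_pow | exact hKg]. }
  assert (hmean (fun s => kernel I r x y s * g s)
    = hsum (fun m => Hpow z m * cauchy_coef I r g m) n
      + Hpow z n * hmean (fun s => Hpow (v s) n * (kernel I r x y s * g s)))%H as ->.
  { rewrite (hmean_ext _ _ (hexp n)).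
    rewrite hmean_add, hmean_lmul; trivial.
    - f_equal. rewrite (hmean_hsum (fun m s => Hpow z m * (Hpow (v s) m * g s))%H).
      + apply hsum_ext; intros k _. now rewrite hmean_lmul.
      + intros k; apply hcont_mul; [apply hcont_const | apply hvk].
    - apply (hcont_hsum (fun m s => Hpow z m * (Hpow (v s) m * g s))%H).
      intros k; apply hcont_mul; [apply hcont_const | apply hvk].
    - apply hcont_mul; [apply hcont_const | exact hrem]. }
  set (S := hsum _ n). set (T := hmean _).
  replace (S - (S + Hpow z n * T))%H with (- (Hpow z n * T))%H by hring.
  rewrite Hnorm_opp, Hnorm_mul, Hnorm_pow.
  assert (Hnorm T <= 2 * ((/ r) ^ n * C)) as hT.
  { apply hmean_norm_le; [exact hrem|]. intros s hs.
    rewrite Hnorm_mul, Hnorm_pow. unfold v. rewrite circle_norm;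
      [|exact hI | left; apply Rinv_0_lt_compat; lra].
    apply Rmult_le_compat_l; [apply pow_le; left; apply Rinv_0_lt_compat; lra | now apply hb]. }
  unfold Rdiv. rewrite Rpow_mult_distr.
  pose proof (pow_le (Hnorm z) n (Hnorm_ge0 z)). nra.
Qed.

(** For the constant function 1 all coefficients except the first are averages of
    nontrivial characters of the circle. *)
Lemma kernel_mean I r x y :
  imaginary_unit I -> 0 < r < 1 -> x ^ 2 + y ^ 2 < r ^ 2 -> hmean (kernel I r x y) = RtoH 1.
Proof.
  intros hI hr hz.
  assert (h := kernel_expansion I r x y (fun _ => RtoH 1) hI hr hz (hcont_const _)).
  rewrite (hmean_ext _ (kernel I r x y)) in h by (intros; hring).
  assert (forall m, cauchy_coef I r (fun _ => RtoH 1) (S m) = RtoH 0) as hc.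
  { intros m. unfold cauchy_coef.
    rewrite <- (hmean_circle_neg I ((/ r) ^ S m) (S m)) by lia.
    apply hmean_ext; intros s. rewrite Hmul_1r, circle_pow by exact hI. f_equal. ring. }
  eapply Hlim_unique; [exact h|].
  intros eps heps; exists 1%nat; intros [|n] hn; [lia|]. rewrite hsum_shift.
  rewrite (hsum_ext _ (fun k => RtoH 0 * RtoH 0)%H) by (intros; rewrite hc; hring).
  rewrite hsum_mull. unfold cauchy_coef. cbn [Hpow].
  rewrite (hmean_ext _ (fun _ => RtoH 1)) by (intros; hring). rewrite hmean_const.
  replace (RtoH 1 * RtoH 1 + RtoH 0 * hsum (fun _ => RtoH 0) n - RtoH 1)%H with (RtoH 0) by hring.
  now rewrite Hnorm_0.
Qed.

Lemma hcont_conj g : hcont g -> hcont (fun s => Hconj (g s)).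
Proof.
  intros h s. destruct (h s) as [h1 [h2 [h3 h4]]].
  split; [|split; [|split]]; cbn [Hconj re im_i im_j im_k fst snd]; cont_real.
Qed.

Lemma hmean_conj g : hcont g -> hmean (fun s => Hconj (g s)) = Hconj (hmean g).
Proof.
  intros hg.
  assert (forall h : R -> R, (forall s, continuous h s) -> rmean (fun s => - h s) = - rmean h) as E.
  { intros h hh. rewrite (rmean_ext _ (fun s => (-1) * h s)) by (intros; ring).
    rewrite rmean_scal by exact hh; ring. }
  apply H_ext.
  - reflexivity.
  - apply (E (fun s => im_i (g s))); intros; now apply hcont_im_i.
  - apply (E (fun s => im_j (g s))); intros; now apply hcont_im_j.
  - apply (E (fun s => im_k (g s))); intros; now apply hcont_im_k.
Qed.

Lemma hmean_rmul c g : hcont g -> hmean (fun s => g s * c)%H = (hmean g * c)%H.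
Proof.
  intros hg. pose proof (hcont_conj g hg) as hg'.
  rewrite (hmean_ext _ (fun s => Hconj (Hconj c * Hconj (g s)))%H) by (intros; hring).
  rewrite hmean_conj by (now apply hcont_mul; [apply hcont_const|]).
  rewrite hmean_lmul, hmean_conj by assumption. hring.
Qed.

Lemma cauchy_formula f I r x y :
  slice_regular f -> imaginary_unit I -> 0 < r < 1 -> x ^ 2 + y ^ 2 < r ^ 2 ->
  hmean (fun s => kernel I r x y s * f (circle I r s))%H = f (slice I x y).
Proof.
  intros hf hI hr hz. set (z := slice I x y).
  transitivity (hmean (fun s => kernel I r x y s * f z)%H).
  - destruct (kernel_continuous r x y hz) as [hk1 hk2].
    assert (forall pi, real_form pi ->
      rmean (fun s => pi (kernel I r x y s * f (circle I r s))%H)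
      = rmean (fun s => pi (kernel I r x y s * f z)%H)) as h.
    { intros pi hp.
      assert (forall p q u, pi (slice I p q * u)%H = p * pi u + q * pi (I * u)%H) as hsl.
      { intros p q u. destruct hp as [ha [hs _]]. rewrite <- !hs, <- ha. f_equal. hring. }
      assert (real_form (fun u => pi (I * u)%H)) as hp'.
      { apply real_form_lmul; [exact hp|]. apply Hnorm_le_sq; [lra|].
        rewrite (proj2 (imaginary_unit_spec I hI)); lra. }
      assert (forall u v, u ^ 2 + v ^ 2 < 1 -> in_ball (slice I u v)) as hball.
      { intros u v h. apply in_ball_sq. now rewrite Hsq_slice. }
      unfold rmean. f_equal. unfold kernel at 1 2.
      rewrite (RInt_ext (V := R_CompleteNormedModule) _ _ _ _ (fun s _ => hsl _ _ _)).
      rewrite (RInt_ext (V := R_CompleteNormedModule) (fun s => pi (_ * f z)%H) _ _ _ (fun s _ => hsl _ _ _)).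
      apply (cauchy_pair (fun u v => pi (f (slice I u v))) (fun u v => pi (I * f (slice I u v))%H)
        (fun u v => pi (partial_x f I u v)) (fun u v => pi (I * partial_x f I u v)%H)); trivial.
      - intros u v h. apply real_form_differentiable; auto.
      - intros u v h.
        assert (- pi (partial_x f I u v) = pi (I * (I * partial_x f I u v))%H) as ->.
        { rewrite Hmul_assoc, hI. rewrite (proj1 (proj2 hp)). ring. }
        apply (real_form_differentiable (fun u => pi (I * u)%H)); auto.
      - intros u v h. apply continuity_2d_pt_filterlim.
        change (continuous (fun z : R * R => pi (partial_x f I (fst z) (snd z))) (u, v)).
        apply (real_form_continuous _ pi (fun z : R * R => partial_x f I (fst z) (snd z))); [exact hp|].
        exact (proj2 (proj2 (slice_regular_derivatives f I u v hf hI (hball u v h)))).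
      - intros u v h. apply continuity_2d_pt_filterlim.
        change (continuous (fun z : R * R => pi (I * partial_x f I (fst z) (snd z))%H) (u, v)).
        apply (real_form_continuous _ (fun q => pi (I * q)%H) (fun z : R * R => partial_x f I (fst z) (snd z)));
          [exact hp'|].
        exact (proj2 (proj2 (slice_regular_derivatives f I u v hf hI (hball u v h)))).
      - intros s. apply (kernel_spec r x y s hz).
      - intros s. apply (kernel_spec r x y s hz). }
    apply H_ext; apply h; auto using real_form_re, real_form_im_i, real_form_im_j, real_form_im_k.
  - rewrite hmean_rmul, kernel_mean by (trivial; now apply kernel_hcont). apply Hmul_1l.
Qed.

Lemma slice_expansion f I r x y :
  slice_regular f -> imaginary_unit I -> 0 < r < 1 -> x ^ 2 + y ^ 2 < r ^ 2 ->
  is_series (fun m => Hpow (slice I x y) m * cauchy_coef I r (fun s => f (circle I r s)) m)%H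
            (f (slice I x y)).
Proof.
  intros hf hI hr hz. apply is_series_Hlim. rewrite <- (cauchy_formula f I r x y) by assumption.
  apply (kernel_expansion I r x y (fun s => f (circle I r s))); trivial. now apply hcont_circle_comp.
Qed.

(** The coefficients computed on one small circle of one slice serve for the whole
    ball, by [coefficients_unique]. *)
Lemma slice_regular_expansion f : slice_regular f -> exists a, has_expansion f a.
Proof.
  intros hf. pose (c := fun I r => cauchy_coef I r (fun s => f (circle I r s))).
  exists (c Hi (1 / 2)). intros q hq. destruct (slice_exists q) as [I [x [y [hI ->]]]].
  pose proof (Hnorm_ge0 (slice I x y)) as h0. unfold in_ball in hq.
  set (r := (1 + Hnorm (slice I x y)) / 2).
  assert (c Hi (1 / 2) = c I r) as ->.
  { apply coefficients_unique with (1 / 2); [lra|]. intros t ht. exists (f (RtoH t)).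
    assert (t ^ 2 < (1 / 2) ^ 2) by (rewrite <- pow2_abs; pose proof (Rabs_pos t); nra).
    assert ((1 / 2) ^ 2 <= r ^ 2) by (apply pow_incr; unfold r; lra).
    split.
    - rewrite <- (slice_real Hi t). apply slice_expansion; trivial; [apply Hi_unit | lra | lra].
    - rewrite <- (slice_real I t). apply slice_expansion; trivial; unfold r in *; lra. }
  apply slice_expansion; trivial; [unfold r; lra|].
  rewrite <- (Hsq_slice I x y hI), <- Hnorm_sq. unfold r. nra.
Qed.

(** * Truncated square norms *)

Fixpoint sqsum (x : nat -> H) (n : nat) : R :=
  match n with O => 0 | S m => sqsum x m + Hsq (x m) end.

Lemma sqsum_ge0 x n : 0 <= sqsum x n.
Proof. induction n as [|n IH]; simpl; [lra | pose proof (Hsq_ge0 (x n)); lra]. Qed.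

Lemma sqsum_ext x y n : (forall k, (k < n)%nat -> x k = y k) -> sqsum x n = sqsum y n.
Proof. induction n as [|n IH]; intros E; simpl; [reflexivity|]. rewrite IH, E; auto. Qed.

Lemma sqsum_mono x m n : (m <= n)%nat -> sqsum x m <= sqsum x n.
Proof.
  induction 1 as [|n hn IH]; simpl; [lra | pose proof (Hsq_ge0 (x n)); lra].
Qed.

Lemma sqsum_term x k n : (k < n)%nat -> Hsq (x k) <= sqsum x n.
Proof.
  intros hk; eapply Rle_trans; [|apply (sqsum_mono x (S k) n hk)].
  simpl; pose proof (sqsum_ge0 x k); lra.
Qed.

Lemma sqsum_shift x n : sqsum x (S n) = Hsq (x O) + sqsum (shift x) n.
Proof. induction n as [|n IH]; [simpl; ring|]. cbn [sqsum] in *. rewrite IH. unfold shift. ring. Qed.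

(** * Parseval identity *)

Definition trig_poly (I : H) (c : nat -> H) (n : nat) (s : R) : H :=
  hsum (fun k => Hpow (circle I 1 s) k * c k)%H n.

Lemma hcont_unit_circle I : hcont (fun s => circle I 1 s).
Proof.
  apply hcont_slice; intros s; apply (continuous_mult (fun _ => 1)); try apply continuous_const;
    [apply continuous_cos | apply continuous_sin].
Qed.

Lemma hcont_trig_poly I c n : hcont (trig_poly I c n).
Proof.
  apply (hcont_hsum (fun k s => Hpow (circle I 1 s) k * c k)%H). intros k.
  apply hcont_mul; [apply hcont_pow, hcont_unit_circle | apply hcont_const].
Qed.

Lemma continuous_Hsq g s : hcont g -> continuous (fun t => Hsq (g t)) s.
Proof.
  intros h; destruct (h s) as [h1 [h2 [h3 h4]]].
  assert (forall p : R -> R, continuous p s -> continuous (fun t => p t ^ 2) s) as hs.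
  { intros p hp. apply (continuous_mult p (fun t => p t * 1)); [exact hp|].
    apply (continuous_mult p); [exact hp | apply continuous_const]. }
  apply (continuous_plus (fun t => re (g t) ^ 2 + im_i (g t) ^ 2 + im_j (g t) ^ 2) (fun t => im_k (g t) ^ 2));
    [|now apply (hs (fun t => im_k (g t)))].
  apply (continuous_plus (fun t => re (g t) ^ 2 + im_i (g t) ^ 2) (fun t => im_j (g t) ^ 2));
    [|now apply (hs (fun t => im_j (g t)))].
  apply (continuous_plus (fun t => re (g t) ^ 2) (fun t => im_i (g t) ^ 2));
    [now apply (hs (fun t => re (g t))) | now apply (hs (fun t => im_i (g t)))].
Qed.

(** Induction on the degree: the constant term is orthogonal to the multiples of z. *)
Lemma parseval I c n : imaginary_unit I -> rmean (fun s => Hsq (trig_poly I c n s)) = sqsum c n.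
Proof.
  intros hI; revert c; induction n as [|n IH]; intros c.
  - unfold trig_poly; cbn [hsum sqsum].
    rewrite (rmean_ext _ (fun _ => 0)); [apply rmean_const | intros; hunf; ring].
  - set (Y := fun s => (circle I 1 s * trig_poly I (shift c) n s)%H).
    assert (hcont Y) as hY by (apply hcont_mul; [apply hcont_unit_circle | apply hcont_trig_poly]).
    assert (forall s, trig_poly I c (S n) s = c O + Y s)%H as hp.
    { intros s. unfold trig_poly, Y. rewrite hsum_shift. cbn [Hpow]. f_equal; [hring|].
      unfold trig_poly. rewrite <- hsum_mull. apply hsum_ext; intros; unfold shift. hring. }
    assert (hmean Y = RtoH 0) as hY0.
    { rewrite (hmean_ext Y (fun s => hsum (fun k => Hpow (circle I 1 s) (S k) * c (S k))%H n)).
      - rewrite (hmean_hsum (fun k s => Hpow (circle I 1 s) (S k) * c (S k))%H).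
        + rewrite (hsum_ext _ (fun k => RtoH 0 * RtoH 0)%H); [rewrite hsum_mull; hring|].
          intros k _. rewrite hmean_rmul by (apply hcont_pow, hcont_unit_circle).
          rewrite (hmean_ext _ (fun s => circle I (1 ^ S k) (INR (S k) * s)))
            by (intros; now apply circle_pow).
          rewrite hmean_circle_pos by lia. hring.
        + intros k; apply hcont_mul; [apply hcont_pow, hcont_unit_circle | apply hcont_const].
      - intros s; unfold Y, trig_poly. rewrite <- hsum_mull. apply hsum_ext; intros; unfold shift.
        cbn [Hpow]. apply Hmul_assoc. }
    rewrite (rmean_ext _ (fun s => Hsq (c O) + (Hsq (Y s) + 2 * re (Hconj (c O) * Y s)%H))).
    + assert (hcont (fun s => Hconj (c O) * Y s)%H) as hcY by (apply hcont_mul; [apply hcont_const | exact hY]).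
      assert (forall s, continuous (fun t => 2 * re (Hconj (c O) * Y t)%H) s) as h2.
      { intros s. apply (continuous_mult (fun _ => 2)); [apply continuous_const|].
        now apply (hcont_re (fun t => Hconj (c O) * Y t)%H). }
      assert (forall s, continuous (fun t => Hsq (Y t)) s) as h1 by (intros; now apply continuous_Hsq).
      rewrite (rmean_plus (fun _ => Hsq (c O)) (fun s => Hsq (Y s) + 2 * re (Hconj (c O) * Y s)%H)).
      * rewrite (rmean_plus (fun s => Hsq (Y s)) (fun s => 2 * re (Hconj (c O) * Y s)%H)) by assumption.
        rewrite (rmean_scal 2 (fun s => re (Hconj (c O) * Y s)%H))
          by (intros; now apply (hcont_re (fun t => Hconj (c O) * Y t)%H)).
        change (rmean (fun s => re (Hconj (c O) * Y s)%H)) with (re (hmean (fun s => Hconj (c O) * Y s)%H)).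
        rewrite hmean_lmul, hY0 by exact hY.
        rewrite rmean_const, sqsum_shift, <- IH.
        rewrite (rmean_ext (fun s => Hsq (Y s)) (fun s => Hsq (trig_poly I (shift c) n s))).
        -- rewrite Hmul_0r. unfold RtoH, re; cbn [fst]. ring.
        -- intros s. unfold Y. rewrite Hsq_mul. rewrite <- (Hnorm_sq (circle I 1 s)), circle_norm by (trivial; lra). ring.
      * intros; apply continuous_const.
      * intros s; apply (continuous_plus (fun s => Hsq (Y s)) (fun s => 2 * re (Hconj (c O) * Y s)%H)); auto.
    + intros s. rewrite hp. generalize (c O) (Y s). intros u v. hunf; ring.
Qed.

(** * Multiplication by a bounded slice regular function *)

Definition trunc (n : nat) (x : nat -> H) : nat -> H := fun k => if Nat.ltb k n then x k else RtoH 0.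

Lemma trunc_lt n x k : (k < n)%nat -> trunc n x k = x k.
Proof. intros h; unfold trunc. now rewrite (proj2 (Nat.ltb_lt k n) h). Qed.
Lemma trunc_ge n x k : (n <= k)%nat -> trunc n x k = RtoH 0.
Proof. intros h; unfold trunc. now rewrite (proj2 (Nat.ltb_ge k n) h). Qed.

Lemma tame_trunc n x : tame (trunc n x).
Proof.
  apply tame_bounded with (sqrt (sqsum x n)). intros k.
  destruct (Nat.lt_ge_cases k n) as [h|h].
  - rewrite trunc_lt by exact h. unfold Hnorm. apply sqrt_le_1_alt. now apply sqsum_term.
  - rewrite trunc_ge by exact h. rewrite Hnorm_0. apply sqrt_pos.
Qed.

Lemma conv_ext a b x y n :
  (forall k, (k <= n)%nat -> a k = b k) -> (forall k, (k <= n)%nat -> x k = y k) ->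
  conv a x n = conv b y n.
Proof.
  intros h h'. rewrite !conv_hsum. apply hsum_ext; intros k hk. rewrite h, h' by lia. reflexivity.
Qed.

Lemma hsum_trunc n x q m :
  (n <= m)%nat -> hsum (fun k => Hpow q k * trunc n x k)%H m = hsum (fun k => Hpow q k * x k)%H n.
Proof.
  induction 1 as [|m hm IH].
  - apply hsum_ext; intros; now rewrite trunc_lt.
  - cbn [hsum]. rewrite IH, trunc_ge by exact hm. hring.
Qed.

Lemma power_series_trunc n x q : power_series (trunc n x) q = hsum (fun k => Hpow q k * x k)%H n.
Proof.
  apply HSeries_unique, is_series_Hlim. intros eps heps; exists n; intros m hm.
  rewrite hsum_trunc by exact hm. set (u := hsum _ n).
  replace (u - u)%H with (RtoH 0) by hring. now rewrite Hnorm_0.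
Qed.

(** For invertible w, the series of q^m w a_m sums to w f(w^-1 q w), and conjugation by w
    preserves the ball. *)
Lemma power_series_lmul_bound f a w q M :
  has_expansion f a -> 0 <= M -> (forall q, in_ball q -> Hnorm (f q) <= M) -> in_ball q ->
  Hnorm (power_series (lmul w a) q) <= Hnorm w * M.
Proof.
  intros hf hM hb hq.
  destruct (Req_dec (Hnorm w) 0) as [h0|h0].
  - apply Hnorm_eq0 in h0. subst w.
    assert (power_series (lmul (RtoH 0) a) q = RtoH 0) as ->.
    { apply HSeries_unique, is_series_Hlim. intros eps heps; exists O; intros n _.
      rewrite (hsum_ext _ (fun k => RtoH 0 * RtoH 0)%H) by (intros; unfold lmul; hring).
      rewrite hsum_mull. replace (RtoH 0 * hsum (fun _ => RtoH 0) n - RtoH 0)%H with (RtoH 0) by hring.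
      now rewrite Hnorm_0. }
    rewrite Hnorm_0; lra.
  - assert (w <> RtoH 0) as hw by (intros ->; apply h0, Hnorm_0).
    set (q' := (Hinv w * q * w)%H).
    assert (forall m, Hpow q' m = Hinv w * Hpow q m * w)%H as hpow.
    { induction m as [|m IH]; cbn [Hpow].
      - rewrite Hmul_1r, Hinv_l by exact hw. reflexivity.
      - rewrite IH. unfold q'.
        transitivity (Hinv w * q * (w * Hinv w) * Hpow q m * w)%H; [now rewrite !Hmul_assoc|].
        rewrite Hinv_r, Hmul_1r, !Hmul_assoc by exact hw. reflexivity. }
    assert (in_ball q') as hq'.
    { unfold in_ball, q'. rewrite !Hnorm_mul.
      replace (Hnorm (Hinv w) * Hnorm q * Hnorm w) with (Hnorm q * (Hnorm (Hinv w) * Hnorm w)) by ring.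
      rewrite <- Hnorm_mul, Hinv_l, Hnorm_RtoH, Rabs_R1, Rmult_1_r by exact hw. exact hq. }
    assert (power_series (lmul w a) q = w * f q')%H as ->.
    { apply HSeries_unique, is_series_Hlim.
      eapply Hlim_ext; [|apply Hlim_mull, is_series_Hlim, hf, hq'].
      intros n; cbn beta. rewrite <- hsum_mull. apply hsum_ext; intros k _. unfold lmul.
      rewrite hpow, !Hmul_assoc, Hinv_r, Hmul_1l by exact hw. reflexivity. }
    rewrite Hnorm_mul. apply Rmult_le_compat_l; [apply Hnorm_ge0 | now apply hb].
Qed.

Definition dilate (rho : R) (a : nat -> H) : nat -> H := fun n => (RtoH (rho ^ n) * a n)%H.

Lemma circle_scale I r s : circle I r s = (RtoH r * circle I 1 s)%H.
Proof. unfold circle. hring. Qed.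

Lemma trig_poly_dilate I rho c n s :
  hsum (fun k => Hpow (circle I rho s) k * c k)%H n = trig_poly I (dilate rho c) n s.
Proof.
  unfold trig_poly, dilate. apply hsum_ext; intros k _.
  rewrite circle_scale, Hpow_mul by apply RtoH_comm. rewrite Hpow_RtoH. hring.
Qed.

Lemma sqsum_dilate_le rho x n : 0 <= rho <= 1 -> sqsum (dilate rho x) n <= sqsum x n.
Proof.
  intros hr; induction n as [|n IH]; cbn [sqsum]; [lra|].
  assert (Hsq (dilate rho x n) <= Hsq (x n)); [|lra].
  unfold dilate. rewrite Hsq_mul.
  assert (Hsq (RtoH (rho ^ n)) <= 1).
  { assert (0 <= rho ^ n <= 1) by (split; [apply pow_le | rewrite <- (pow1 n); apply pow_incr]; lra).
    hunf. nra. }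
  pose proof (Hsq_ge0 (x n)). nra.
Qed.

Lemma sqsum_dilate_ge rho x n : 0 <= rho <= 1 -> (rho ^ n) ^ 2 * sqsum x n <= sqsum (dilate rho x) n.
Proof.
  intros hr. assert (forall m, (m <= n)%nat -> (rho ^ n) ^ 2 * sqsum x m <= sqsum (dilate rho x) m) as h;
    [|now apply h].
  induction m as [|m IH]; intros hm; cbn [sqsum]; [lra|].
  specialize (IH ltac:(lia)).
  assert ((rho ^ n) ^ 2 * Hsq (x m) <= Hsq (dilate rho x m)); [|lra].
  unfold dilate. rewrite Hsq_mul. apply Rmult_le_compat_r; [apply Hsq_ge0|].
  replace (Hsq (RtoH (rho ^ m))) with ((rho ^ m) ^ 2) by (hunf; ring).
  apply pow_incr. split; [apply pow_le; lra|].
  replace n with (m + (n - m))%nat by lia. rewrite pow_add.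
  assert (0 <= rho ^ (n - m) <= 1) by (split; [apply pow_le | rewrite <- (pow1 (n - m)); apply pow_incr]; lra).
  pose proof (pow_le rho m (proj1 hr)). nra.
Qed.

Lemma pow_ge_linear rho n : 0 <= rho <= 1 -> 1 - INR n * (1 - rho) <= rho ^ n.
Proof.
  intros hr; induction n as [|n IH]; [simpl; lra|].
  rewrite S_INR; simpl pow. pose proof (pos_INR n).
  assert (rho ^ n <= 1) by (rewrite <- (pow1 n); apply pow_incr; lra). nra.
Qed.

Definition right_contraction (a : nat -> H) : Prop :=
  forall x n, sqsum (conv x a) n <= sqsum x n.
Definition left_contraction (a : nat -> H) : Prop :=
  forall x n, sqsum (conv a x) n <= sqsum x n.

(** On the circle of radius rho the product is bounded by the polynomial with
    coefficients x, up to a tail of the series that tends to 0 with the degree;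
    Parseval's identity turns this into a weighted inequality, and rho tends to 1. *)
Lemma bounded_right_contraction f a :
  has_expansion f a -> (forall q, in_ball q -> Hnorm (f q) <= 1) -> right_contraction a.
Proof.
  intros hf hb x n. pose proof (has_expansion_tame f a hf) as ha.
  set (y := conv (trunc n x) a).
  assert (tame y) as hy by (apply tame_conv; [apply tame_trunc | exact ha]).
  assert (sqsum (conv x a) n = sqsum y n) as ->.
  { apply sqsum_ext; intros k hk. apply conv_ext; [|reflexivity].
    intros j hj; symmetry; apply trunc_lt; lia. }
  assert (forall rho, 0 <= rho < 1 -> sqsum (dilate rho y) n <= sqsum (dilate rho x) n) as hrho.
  { intros rho hr. apply Rnot_lt_le; intros hlt.
    destruct (power_series_uniform y rho hy hr) as [C [lam [hC [hl hu]]]].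
    destruct (hcont_bounded _ (hcont_trig_poly Hi (dilate rho x) n)) as [G [hG0 hG]].
    destruct (pow_small lam (2 * G * C + C ^ 2) (sqsum (dilate rho y) n - sqsum (dilate rho x) n) hl ltac:(lra))
      as [M hM].
    specialize (hM (M + n)%nat ltac:(lia)).
    set (N := (M + n)%nat) in *.
    assert (sqsum (dilate rho y) N <= sqsum (dilate rho x) n + (2 * G * C + C ^ 2) * lam ^ N) as h1.
    { rewrite <- (parseval Hi (dilate rho y) N Hi_unit), <- (parseval Hi (dilate rho x) n Hi_unit).
      rewrite <- (rmean_const ((2 * G * C + C ^ 2) * lam ^ N)), <- rmean_plus;
        [|intros; apply continuous_Hsq, hcont_trig_poly | intros; apply continuous_const].
      apply rmean_le.
      - intros; apply continuous_Hsq, hcont_trig_poly.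
      - intros s; apply (continuous_plus (fun s => Hsq (trig_poly Hi (dilate rho x) n s)));
          [apply continuous_Hsq, hcont_trig_poly | apply continuous_const].
      - intros s hs. rewrite <- !Hnorm_sq, <- trig_poly_dilate.
        set (z := circle Hi rho s).
        assert (Hnorm z = rho) as hz by (apply circle_norm; [apply Hi_unit | lra]).
        assert (in_ball z) as hzb by (unfold in_ball; lra).
        specialize (hu z ltac:(lra) N). specialize (hG s hs).
        assert (Hnorm (power_series y z) <= Hnorm (trig_poly Hi (dilate rho x) n s)) as h2.
        { unfold y. rewrite power_series_conv; [|apply tame_trunc | exact ha | exact hzb].
          eapply Rle_trans; [apply (power_series_lmul_bound f a _ z 1 hf); auto; lra|].
          rewrite power_series_trunc, Rmult_1_r. unfold z. rewrite trig_poly_dilate. lra. }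
        set (T := hsum _ N) in *.
        pose proof (Hnorm_triangle (T - power_series y z)%H (power_series y z)) as ht.
        replace (T - power_series y z + power_series y z)%H with T in ht by hring.
        set (g := Hnorm (trig_poly Hi (dilate rho x) n s)) in *.
        assert (0 <= g) by apply Hnorm_ge0. pose proof (Hnorm_ge0 T).
        assert (0 <= lam ^ N <= 1) as hlN
          by (split; [apply pow_le | rewrite <- (pow1 N); apply pow_incr]; lra).
        assert (Hnorm T <= g + C * lam ^ N) by lra.
        assert (0 <= C * lam ^ N) by (apply Rmult_le_pos; lra).
        apply Rle_trans with ((g + C * lam ^ N) ^ 2); [apply pow_incr; lra|].
        assert (g * (C * lam ^ N) <= G * (C * lam ^ N)) by (apply Rmult_le_compat_r; lra).
        assert (C ^ 2 * (lam ^ N * lam ^ N) <= C ^ 2 * lam ^ N) by (apply Rmult_le_compat_l; nra).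
        nra. }
    pose proof (sqsum_mono (dilate rho y) n N ltac:(unfold N; lia)). lra. }
  apply Rnot_lt_le; intros hlt.
  set (S := sqsum y n) in *. set (T := sqsum x n) in *.
  assert (0 <= T) as hT by apply sqsum_ge0.
  (* A radius close to 1, for which the weights lose less than the gap. *)
  set (d := (S - T) / (2 * (2 * INR n + 1) * S)).
  pose proof (pos_INR n) as hn.
  assert (0 < d) as hd by (apply Rdiv_lt_0_compat; [lra | apply Rmult_lt_0_compat; lra]).
  assert (2 * INR n * d * S < S - T) as hdS.
  { replace (2 * INR n * d * S) with ((S - T) * (INR n / (2 * INR n + 1))) by (unfold d; field; lra).
    assert (INR n / (2 * INR n + 1) < 1) by (apply Rlt_div_l; lra). nra. }
  assert (d < 1) as hd1.
  { unfold d. apply Rlt_div_l; [apply Rmult_lt_0_compat; lra|]. nra. }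
  specialize (hrho (1 - d) ltac:(lra)).
  pose proof (sqsum_dilate_ge (1 - d) y n ltac:(lra)) as h1. fold S in h1.
  pose proof (sqsum_dilate_le (1 - d) x n ltac:(lra)) as h2. fold T in h2.
  pose proof (pow_ge_linear (1 - d) (n * 2) ltac:(lra)) as h3.
  rewrite pow_mult, mult_INR in h3. simpl (INR 2) in h3. nra.
Qed.

(** Let y = a * x and let v be conj(y) with the order of its n + 1 first terms reversed.
    The coefficient of degree n of v * y is |y|^2, but v * y = (v * a) * x, which is
    bounded by the norms of v * a and x.  This is the passage to the adjoint of a
    triangular Toeplitz matrix. *)
Lemma right_left_contraction a : right_contraction a -> left_contraction a.
Proof.
  intros ha x [|n]; [simpl; lra|].
  assert (forall u v, 2 * Hnorm (conv u v n) <= sqsum u (S n) + sqsum v (S n)) as hcs.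
  { clear. intros u v; revert u; induction n as [|n IH]; intros u.
    - cbn [conv sqsum]. rewrite Hnorm_mul, <- !Hnorm_sq.
      pose proof (pow2_ge_0 (Hnorm (u O) - Hnorm (v O))). nra.
    - cbn [conv]. rewrite (sqsum_shift u). cbn [sqsum] in *. specialize (IH (shift u)).
      pose proof (Hnorm_triangle (conv (shift u) v n) (u O * v (S n))%H) as h.
      rewrite Hnorm_mul in h. rewrite <- (Hnorm_sq (u O)), <- (Hnorm_sq (v (S n))).
      pose proof (pow2_ge_0 (Hnorm (u O) - Hnorm (v (S n)))). nra. }
  set (y := conv a x). set (v := fun k => Hconj (y (n - k)%nat)).
  assert (Hnorm (conv v y n) = sqsum y (S n)) as h1.
  { rewrite conv_hsum. assert (forall m, (m <= S n)%nat ->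
      hsum (fun l => v (n - l)%nat * y l)%H m = RtoH (sqsum y m)) as h.
    { induction m as [|m IH]; intros hm; [reflexivity|]. cbn [hsum sqsum]. rewrite IH by lia.
      unfold v. replace (n - (n - m))%nat with m by lia. hring. }
    rewrite h by lia. rewrite Hnorm_RtoH. apply Rabs_pos_eq, sqsum_ge0. }
  assert (sqsum v (S n) = sqsum y (S n)) as h2.
  { assert (forall m u, sqsum (fun k => u (m - k)%nat) (S m) = sqsum u (S m)) as h.
    { induction m as [|m IH]; intros u; [reflexivity|].
      rewrite sqsum_shift. unfold shift. rewrite Nat.sub_0_r.
      cbn [sqsum] in IH |- *. specialize (IH u).
      rewrite <- IH. cbn [Nat.sub]. lra. }
    unfold v. rewrite <- (h n y). apply (eq_trans (y := sqsum (fun k => y (n - k)%nat) (S n))); [|reflexivity].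
    generalize (S n); intros m; induction m as [|m IH]; cbn [sqsum]; [reflexivity|].
    now rewrite IH, Hsq_conj. }
  assert (conv v y = conv (conv v a) x) as h3 by apply conv_assoc.
  pose proof (hcs (conv v a) x) as h4. rewrite <- h3, h1 in h4.
  pose proof (ha v (S n)). lra.
Qed.

(** * Schwarz-Pick inequality *)

(** Contraction of the full square norm.  It is weaker than [left_contraction], as the
    bound is not required of each truncation separately; this is what survives the
    division by a Blaschke factor. *)
Definition l2_contraction (h : nat -> H) : Prop :=
  forall x K, (forall n, sqsum x n <= K) -> forall n, sqsum (conv h x) n <= K.

Lemma Hlim_re_le s l C : Hlim s l -> (forall n, re (s n) <= C) -> re l <= C.
Proof.
  intros h hC; apply Rnot_lt_le; intros hlt.
  destruct (h (re l - C) ltac:(lra)) as [N hN]; specialize (hN N (le_n _)); specialize (hC N).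
  pose proof (re_le (s N - l)%H) as hr.
  replace (re (s N - l)%H) with (re (s N) - re l) in hr by (hunf; ring).
  apply Rabs_le_between in hr. lra.
Qed.

Lemma l2_pairing u v x y n :
  sqsum u n <= x -> sqsum v n <= y -> 2 * re (hsum (fun k => Hconj (u k) * v k)%H n) <= x + y.
Proof.
  intros hx hy. apply Rle_trans with (sqsum u n + sqsum v n); [|lra]. clear hx hy.
  induction n as [|n IH]; cbn [hsum sqsum].
  - hunf; lra.
  - set (S := hsum _ n) in *.
    replace (re (S + Hconj (u n) * v n)%H) with (re S + re (Hconj (u n) * v n)%H) by (hunf; ring).
    assert (2 * re (Hconj (u n) * v n)%H <= Hsq (u n) + Hsq (v n)); [|lra].
    pose proof (Hsq_ge0 (u n - v n)%H) as h.
    replace (Hsq (u n - v n)%H) with (Hsq (u n) + Hsq (v n) - 2 * re (Hconj (u n) * v n)%H) in h by (hunf; ring).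
    lra.
Qed.

Lemma Hsq_pow q n : Hsq (Hpow q n) = Hsq q ^ n.
Proof.
  induction n as [|n IH]; cbn [Hpow pow]; [hunf; ring|].
  now rewrite Hsq_mul, IH.
Qed.

Definition geometric (c p a : H) : nat -> H := fun n => (c * (Hpow p n * a))%H.

Lemma sqsum_geometric_delta c p a d n :
  in_ball p ->
  sqsum (addseq (geometric c p a) (delta d)) n
  <= Hsq (c * a + d)%H + Hsq c * Hsq a * (Hsq p / (1 - Hsq p)).
Proof.
  intros hp. apply in_ball_sq in hp. pose proof (Hsq_ge0 p) as hp0.
  pose proof (Hsq_ge0 c). pose proof (Hsq_ge0 a).
  assert (0 <= Hsq c * Hsq a) as hca by (apply Rmult_le_pos; lra).
  eapply Rle_trans; [apply (sqsum_mono _ n (S n)); lia|].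
  assert (sqsum (addseq (geometric c p a) (delta d)) (S n)
    = Hsq (c * a + d)%H + Hsq c * Hsq a * ((Hsq p - Hsq p ^ S n) / (1 - Hsq p))) as ->.
  { induction n as [|n IH].
    - cbn [sqsum addseq geometric delta Hpow]. unfold addseq, geometric, delta.
      cbn [Hpow pow]. rewrite Hmul_1l. field; lra.
    - cbn [sqsum] in *. rewrite IH. unfold addseq at 1, geometric at 1. cbn [delta].
      rewrite Hadd_0r, !Hsq_mul, Hsq_pow. cbn [pow]. field; lra. }
  apply Rplus_le_compat_l, Rmult_le_compat_l; [exact hca|].
  apply Rmult_le_compat_r; [left; apply Rinv_0_lt_compat; lra|].
  pose proof (pow_le (Hsq p) (S n) hp0). lra.
Qed.

(** Evaluations at p and at 0 are the pairings with conj(p)^n and with the first basis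
    vector.  The sequence x below is the image under the adjoint of h of the combination v
    of these vectors; then |x|^2 is the pairing of h * x with v, so it is at most the
    mean of |x|^2 and |v|^2. *)
Lemma pick_inequality h p al be :
  tame h -> l2_contraction h -> in_ball p ->
  let eta := power_series h p in
  let k := Hsq p / (1 - Hsq p) in
  Hsq (Hconj eta * al + Hconj (h O) * be)%H + Hsq eta * Hsq al * k <= Hsq (al + be)%H + Hsq al * k.
Proof.
  intros hh hc hp eta k.
  assert (Hsq p < 1) as ht by (now apply in_ball_sq). pose proof (Hsq_ge0 p) as ht0.
  set (x := addseq (geometric (Hconj eta) (Hconj p) al) (delta (Hconj (h O) * be)%H)).
  set (v := addseq (geometric (RtoH 1) (Hconj p) al) (delta be)).
  set (X := Hsq (Hconj eta * al + Hconj (h O) * be)%H + Hsq eta * Hsq al * k).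
  set (V := Hsq (al + be)%H + Hsq al * k).
  assert (in_ball (Hconj p)) as hp' by (unfold in_ball; now rewrite Hnorm_conj).
  assert (forall n, sqsum x n <= X) as hx.
  { intros n. eapply Rle_trans; [apply sqsum_geometric_delta, hp'|]. rewrite !Hsq_conj. apply Rle_refl. }
  assert (forall n, sqsum v n <= V) as hv.
  { intros n. eapply Rle_trans; [apply sqsum_geometric_delta, hp'|].
    rewrite Hmul_1l, Hsq_conj. fold k. unfold V. replace (Hsq (RtoH 1)) with 1 by (hunf; ring). lra. }
  assert (tame x) as hxt.
  { apply tame_bounded with (sqrt X). intros n. unfold Hnorm. apply sqrt_le_1_alt.
    eapply Rle_trans; [apply (sqsum_term x n (S n)); lia | apply hx]. }
  set (y := conv h x).
  assert (forall n, sqsum y n <= X) as hy by (intros n; now apply hc).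
  (* The reproducing property: evaluation at p turns the product with h into a left
     multiplication by eta, and x is geometric. *)
  assert (power_series y p = RtoH (Hsq eta / (1 - Hsq p)) * al + eta * (Hconj (h O) * be))%H as hyp.
  { unfold y. rewrite power_series_conv by assumption. fold eta.
    apply HSeries_unique, is_series_Hlim, Hlim_shift.
    apply Hlim_geom with (Hsq p) (Hnorm (RtoH (Hsq eta / (1 - Hsq p)) * al)%H); [lra|]. intros n.
    assert (hsum (fun m => Hpow p m * lmul eta x m)%H (S n)
      = RtoH (Hsq eta / (1 - Hsq p) * (1 - Hsq p ^ S n)) * al + eta * (Hconj (h O) * be))%H as ->.
    { induction n as [|n IH].
      - cbn [hsum]. unfold lmul, x, addseq, geometric, delta. cbn [Hpow pow].
        replace (Hsq eta / (1 - Hsq p) * (1 - Hsq p * 1)) with (Hsq eta) by (field; lra).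
        generalize (h O); intros u. hring.
      - change (hsum (fun m => Hpow p m * lmul eta x m)%H (S (S n)))
          with (hsum (fun m => Hpow p m * lmul eta x m)%H (S n) + Hpow p (S n) * lmul eta x (S n))%H.
        rewrite IH. unfold lmul, x, addseq, geometric at 1. cbn [delta].
        rewrite Hadd_0r, Hpow_conj.
        assert (Hpow p (S n) * (eta * (Hconj eta * (Hconj (Hpow p (S n)) * al)))
          = RtoH (Hsq eta * Hsq p ^ S n) * al)%H as ->.
        { rewrite <- Hsq_pow. set (z := Hpow p (S n)).
          transitivity (z * (eta * Hconj eta) * (Hconj z * al))%H; [now rewrite !Hmul_assoc|].
          replace (eta * Hconj eta)%H with (RtoH (Hsq eta)) by hring.
          rewrite <- RtoH_comm. transitivity (RtoH (Hsq eta) * ((z * Hconj z) * al))%H; [now rewrite !Hmul_assoc|].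
          replace (z * Hconj z)%H with (RtoH (Hsq z)) by hring.
          now rewrite Hmul_assoc, RtoH_mul. }
        replace (Hsq eta / (1 - Hsq p) * (1 - Hsq p ^ S (S n)))
          with (Hsq eta / (1 - Hsq p) * (1 - Hsq p ^ S n) + Hsq eta * Hsq p ^ S n)
          by (cbn [pow]; field; lra).
        generalize (Hsq eta / (1 - Hsq p) * (1 - Hsq p ^ S n)) (Hsq eta * Hsq p ^ S n).
        intros r1 r2. generalize (eta * (Hconj (h O) * be))%H. intros u. hring. }
    generalize (Hsq eta / (1 - Hsq p)); intros A. generalize (eta * (Hconj (h O) * be))%H; intros u.
    replace (RtoH (A * (1 - Hsq p ^ S n)) * al + u - (RtoH A * al + u))%H
      with (RtoH (- Hsq p ^ S n) * (RtoH A * al))%H.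
    - rewrite Hnorm_mul, Hnorm_RtoH, Rabs_Ropp, Rabs_pos_eq by (apply pow_le; lra).
      rewrite Rmult_comm. apply Rmult_le_compat_l; [apply Hnorm_ge0|].
      cbn [pow]. pose proof (pow_le (Hsq p) n ht0). nra.
    - generalize (Hsq p ^ S n); intros r. hring. }
  assert (Hlim (fun n => hsum (fun m => Hconj (v m) * y m)%H (S n))
    (Hconj al * power_series y p + Hconj be * (h O * x O)))%H as hlim.
  { apply Hlim_ext with (fun n =>
      Hconj al * hsum (fun m => Hpow p m * y m) (S n) + Hconj be * (h O * x O))%H.
    - intros n. induction n as [|n IH].
      + cbn [hsum]. unfold v, addseq, geometric, delta. cbn [Hpow].
        change (y O) with (h O * x O)%H. hring.
      + change (hsum (fun m => Hconj (v m) * y m)%H (S (S n)))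
          with (hsum (fun m => Hconj (v m) * y m)%H (S n) + Hconj (v (S n)) * y (S n))%H.
        rewrite <- IH. change (hsum (fun m => Hpow p m * y m)%H (S (S n)))
          with (hsum (fun m => Hpow p m * y m)%H (S n) + Hpow p (S n) * y (S n))%H.
        unfold v, addseq, geometric. cbn [delta]. rewrite Hadd_0r, Hpow_conj. hring.
    - apply (Hlim_add _ (fun _ => _)).
      + apply Hlim_mull, (Hlim_shift (hsum (fun m => Hpow p m * y m)%H)), power_series_Hlim; [|exact hp].
        now apply tame_conv.
      + intros eps heps; exists O; intros _ _. set (u := (Hconj be * _)%H).
        replace (u - u)%H with (RtoH 0) by hring. now rewrite Hnorm_0. }
  assert (re (Hconj al * power_series y p + Hconj be * (h O * x O))%H <= (X + V) / 2) as hre.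
  { apply (Hlim_re_le _ _ _ hlim). intros n.
    pose proof (l2_pairing v y V X (S n) (hv _) (hy _)). lra. }
  assert (re (Hconj al * power_series y p + Hconj be * (h O * x O))%H = X) as hX.
  { rewrite hyp. unfold x, X, addseq, geometric, delta, k. cbn [Hpow]. rewrite Hmul_1l.
    replace (Hsq eta / (1 - Hsq p)) with (Hsq eta + Hsq eta * (Hsq p / (1 - Hsq p))) by (field; lra).
    generalize (Hsq p / (1 - Hsq p)); intros r. clear. generalize (h O); intros u.
    clearbody eta. destruct al as [[[? ?] ?] ?], be as [[[? ?] ?] ?], eta as [[[? ?] ?] ?], u as [[[? ?] ?] ?].
    cbv [Hsq Hadd Hmul Hconj RtoH re im_i im_j im_k fst snd]. ring. }
  fold X V. lra.
Qed.

(** Eliminating the second parameter of [pick_inequality] optimally, with al = 1 - |h(0)|^2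
    and be = h(0) conj(eta) - 1, bounds |eta - h(0)|; only moduli are kept from there. *)
Lemma schwarz_pick h p :
  tame h -> l2_contraction h -> in_ball p ->
  Hnorm (h O) <= 1 /\
  Hnorm (power_series h p) <= (Hnorm (h O) + Hnorm p) / (1 + Hnorm (h O) * Hnorm p).
Proof.
  intros hh hc hp. pose proof (pick_inequality h p) as hpick. cbv zeta in hpick.
  set (eta := power_series h p) in *.
  assert (Hsq p < 1) as ht by (now apply in_ball_sq). pose proof (Hsq_ge0 p) as ht0.
  set (k := Hsq p / (1 - Hsq p)) in *.
  assert (0 <= k) as hk by (apply Rdiv_le_0_compat; lra).
  pose proof (Hnorm_ge0 p). pose proof (Hnorm_ge0 (h O)). pose proof (Hnorm_ge0 eta).
  assert (Hsq (RtoH 1) = 1) as e1 by (hunf; ring).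
  assert (Hsq (RtoH 0) = 0) as e0 by (hunf; ring).
  assert (Hnorm (h O) <= 1) as hB.
  { specialize (hpick (RtoH 0) (RtoH 1) hh hc hp).
    rewrite Hmul_0r, !Hadd_0l, Hmul_1r, Hsq_conj, e1, e0 in hpick.
    apply Hnorm_le_sq; lra. }
  assert (Hnorm eta <= 1) as hA.
  { specialize (hpick (RtoH 1) (RtoH 0) hh hc hp).
    rewrite Hmul_0r, !Hadd_0r, Hmul_1r, Hsq_conj, e1 in hpick.
    apply Hnorm_le_sq; [lra|]. nra. }
  split; [exact hB|].
  apply (proj1 (Rle_div_r _ _ (1 + Hnorm (h O) * Hnorm p) ltac:(nra))).
  destruct (Rle_lt_or_eq_dec _ _ hB) as [hB1|hB1]; [|rewrite hB1 in *; nra].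
  specialize (hpick (RtoH (1 - Hsq (h O))) (- (RtoH 1 - h O * Hconj eta))%H hh hc hp).
  assert (Hconj eta * RtoH (1 - Hsq (h O)) + Hconj (h O) * - (RtoH 1 - h O * Hconj eta)
          = Hconj (eta - h O))%H as e2.
  { transitivity (RtoH (1 - Hsq (h O)) * Hconj eta - Hconj (h O) + (Hconj (h O) * h O) * Hconj eta)%H; [hring|].
    replace (Hconj (h O) * h O)%H with (RtoH (Hsq (h O))) by hring. generalize (Hsq (h O)); intros r. hring. }
  assert (RtoH (1 - Hsq (h O)) + - (RtoH 1 - h O * Hconj eta) = h O * Hconj (eta - h O))%H as e3.
  { transitivity (- RtoH (Hsq (h O)) + h O * Hconj eta)%H; [generalize (Hsq (h O)); intros r; hring|].
    replace (RtoH (Hsq (h O))) with (h O * Hconj (h O))%H by hring. hring. }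
  rewrite e2, e3, Hsq_mul, !Hsq_conj in hpick.
  replace (Hsq (RtoH (1 - Hsq (h O)))) with ((1 - Hsq (h O)) ^ 2) in hpick by (hunf; ring).
  assert ((Hnorm eta - Hnorm (h O)) ^ 2 <= Hsq (eta - h O)%H) as hE.
  { rewrite <- Hnorm_sq.
    pose proof (Hnorm_triangle (eta - h O)%H (h O)) as t1.
    pose proof (Hnorm_triangle (- (eta - h O))%H eta) as t2.
    replace (eta - h O + h O)%H with eta in t1 by hring.
    replace (- (eta - h O) + eta)%H with (h O) in t2 by hring. rewrite Hnorm_opp in t2.
    pose proof (Hnorm_ge0 (eta - h O)%H). nra. }
  rewrite <- (Hnorm_sq eta), <- (Hnorm_sq (h O)) in hpick.
  set (A := Hnorm eta) in *. set (B := Hnorm (h O)) in *. set (E := Hsq (eta - h O)%H) in *.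
  assert (k * (1 - Hsq p) = Hsq p) as hkp by (unfold k; field; lra).
  rewrite <- (Hnorm_sq p) in hkp, ht. set (tau := Hnorm p) in *.
  assert (0 < 1 - B ^ 2) as hs by nra.
  assert (E <= (1 - B ^ 2) * (1 - A ^ 2) * k) as h1.
  { apply (Rmult_le_reg_l (1 - B ^ 2)); [exact hs|]. nra. }
  assert (E * (1 - tau ^ 2) <= (1 - B ^ 2) * (1 - A ^ 2) * tau ^ 2) as h2.
  { apply Rle_trans with ((1 - B ^ 2) * (1 - A ^ 2) * k * (1 - tau ^ 2));
      [apply Rmult_le_compat_r; lra | rewrite Rmult_assoc, hkp; lra]. }
  assert ((A - B) ^ 2 * (1 - tau ^ 2) <= E * (1 - tau ^ 2)) as h3 by (apply Rmult_le_compat_r; lra).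
  assert ((A - B) ^ 2 <= (tau * (1 - A * B)) ^ 2) as h4 by nra.
  assert (0 <= tau * (1 - A * B)) as h5 by (apply Rmult_le_pos; nra).
  assert (Rabs (A - B) <= tau * (1 - A * B)) as h6 by (now apply Rabs_le_sq).
  apply Rabs_le_between in h6. nra.
Qed.

(** * Expansions of the functions entering the hyperbolic difference quotient *)

Lemma expansion_const c : has_expansion (fun _ => c) (delta c).
Proof.
  intros q _. apply is_series_Hlim. intros eps heps; exists 1%nat; intros [|n] hn; [lia|].
  rewrite hsum_shift. rewrite (hsum_ext _ (fun k => RtoH 0 * RtoH 0)%H) by (intros; cbn [delta]; hring).
  rewrite hsum_mull. cbn [Hpow delta].
  replace (RtoH 1 * c + RtoH 0 * hsum (fun _ => RtoH 0) n - c)%H with (RtoH 0) by hring.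
  now rewrite Hnorm_0.
Qed.

Lemma expansion_add f g a b :
  has_expansion f a -> has_expansion g b -> has_expansion (fun q => f q + g q)%H (addseq a b).
Proof.
  intros hf hg q hq. apply is_series_Hlim.
  eapply Hlim_ext; [|apply Hlim_add; [apply is_series_Hlim, hf, hq | apply is_series_Hlim, hg, hq]].
  intros n; cbn beta. rewrite <- hsum_add. apply hsum_ext; intros; unfold addseq; hring.
Qed.

Lemma expansion_opp f a : has_expansion f a -> has_expansion (fun q => - f q)%H (lmul (RtoH (-1)) a).
Proof.
  intros hf q hq. apply is_series_Hlim. replace (- f q)%H with (RtoH (-1) * f q)%H by hring.
  eapply Hlim_ext; [|apply Hlim_mull, is_series_Hlim, hf, hq].
  intros n; cbn beta. rewrite <- hsum_mull. apply hsum_ext; intros; unfold lmul; hring.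
Qed.

Definition linear (u v : H) : nat -> H :=
  fun n => match n with O => u | S O => v | _ => RtoH 0 end.

Lemma expansion_linear u v : has_expansion (fun q => u + q * v)%H (linear u v).
Proof.
  intros q _. apply is_series_Hlim. intros eps heps; exists 2%nat; intros [|[|n]] hn; try lia.
  rewrite !hsum_shift. rewrite (hsum_ext _ (fun k => RtoH 0 * RtoH 0)%H) by (intros; cbn [linear]; hring).
  rewrite hsum_mull. cbn [Hpow linear].
  match goal with |- Hnorm ?x < _ => replace x with (RtoH 0) by hring end.
  now rewrite Hnorm_0.
Qed.

Lemma tame_linear u v : tame (linear u v).
Proof. exact (has_expansion_tame _ _ (expansion_linear u v)). Qed.

Lemma conv_linear_S u v x n : conv (linear u v) x (S n) = (v * x n + u * x (S n))%H.
Proof.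
  cbn [conv]. replace (shift (linear u v)) with (delta v) by
    (apply functional_extensionality; intros [|k]; reflexivity).
  now rewrite conv_delta_l.
Qed.

(** * The difference quotient *)

(** The solution of r_n = a_(n+1) + p r_(n+1) that stays bounded when a does: the sum of the
    p^k a_(n+1+k). *)
Definition quotient_coef (a : nat -> H) (p : H) (n : nat) : H :=
  power_series (fun k => a (S n + k)%nat) p.

Lemma power_series_shift a p :
  tame a -> in_ball p -> power_series a p = (a O + p * power_series (shift a) p)%H.
Proof.
  intros ha hp. apply HSeries_unique, is_series_Hlim, Hlim_shift.
  eapply Hlim_ext; [|apply (Hlim_add (fun _ => a O)); [|apply Hlim_mull, power_series_Hlim;
    [apply tame_shift, ha | exact hp]]].
  - intros n; cbn beta. rewrite hsum_shift, <- hsum_mull. f_equal; [cbn [Hpow]; hring|].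
    apply hsum_ext; intros; unfold shift; cbn [Hpow]; apply Hmul_assoc.
  - intros eps heps; exists O; intros. replace (a O - a O)%H with (RtoH 0) by hring. now rewrite Hnorm_0.
Qed.

Lemma quotient_coef_step a p n :
  (forall k, Hnorm (a k) <= 1) -> in_ball p ->
  quotient_coef a p n = (a (S n) + p * quotient_coef a p (S n))%H.
Proof.
  intros ha hp. unfold quotient_coef. rewrite power_series_shift;
    [|apply tame_bounded with 1; auto | exact hp].
  rewrite Nat.add_0_r. f_equal. f_equal. f_equal. apply functional_extensionality; intros k.
  unfold shift. f_equal. lia.
Qed.

Lemma quotient_coef_bounded a p n :
  (forall k, Hnorm (a k) <= 1) -> in_ball p -> Hnorm (quotient_coef a p n) <= / (1 - Hnorm p).
Proof.
  intros ha hp. pose proof (Hnorm_ge0 p). unfold in_ball in hp.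
  apply Hlim_norm_le with (hsum (fun k => Hpow p k * a (S n + k)%nat)%H).
  - apply power_series_Hlim; [|exact hp]. apply tame_bounded with 1; auto.
  - intros m. set (u := fun k => _).
    replace (hsum u m) with (hsum u (0 + m)%nat - hsum u 0)%H by (cbn [hsum Nat.add]; hring).
    replace (/ (1 - Hnorm p)) with (1 / (1 - Hnorm p) * Hnorm p ^ 0) by (cbn [pow]; field; lra).
    apply hsum_geom_diff; [lra | lra |]. intros k; unfold u.
    rewrite Hnorm_mul, Hnorm_pow. pose proof (pow_le (Hnorm p) k ltac:(lra)).
    pose proof (Hnorm_ge0 (a (S n + k)%nat)). specialize (ha (S n + k)%nat). nra.
Qed.

(** Existence: the bounded solution of the recurrence gives a slice regular function.
    Uniqueness: the difference of two solutions satisfies d_n = p d_(n+1) and p d_0 = 0,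
    so it vanishes. *)
Lemma difference_quotient_expansion f a p :
  has_expansion f a -> (forall k, Hnorm (a k) <= 1) -> in_ball p ->
  conv (linear (- p)%H (RtoH 1)) (quotient_coef a p) = addseq a (delta (- f p)%H) /\
  has_expansion (difference_quotient f p) (quotient_coef a p).
Proof.
  intros hf ha hp. set (r := quotient_coef a p).
  assert (tame a) as hat by (exact (has_expansion_tame f a hf)).
  assert (tame r) as hr.
  { apply tame_bounded with (/ (1 - Hnorm p)). intros n; now apply quotient_coef_bounded. }
  assert (has_expansion (fun q => q - p)%H (linear (- p)%H (RtoH 1))) as hlin.
  { eapply has_expansion_ext; [|apply expansion_linear]. intros; cbn beta; hring. }
  assert (has_expansion (fun q => f q + - f p)%H (addseq a (delta (- f p)%H))) as hsub.
  { apply (expansion_add f (fun _ => - f p)%H); [exact hf | apply expansion_const]. }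
  assert (conv (linear (- p)%H (RtoH 1)) r = addseq a (delta (- f p)%H)) as hconv.
  { apply functional_extensionality; intros [|n].
    - cbn [conv linear]. unfold addseq. cbn [delta].
      rewrite (has_expansion_power_series f a p hf hp), power_series_shift by assumption.
      change (power_series (shift a) p) with (r O). hring.
    - rewrite conv_linear_S. unfold addseq; cbn [delta]. unfold r.
      rewrite (quotient_coef_step a p n ha hp). hring. }
  split; [exact hconv|].
  assert (is_difference_quotient f p (difference_quotient f p)) as [hreg hdq].
  { unfold difference_quotient; apply epsilon_spec. exists (power_series r). split.
    - apply (expansion_slice_regular _ r). now apply power_series_expansion.
    - intros q hq. rewrite (star_conv _ _ _ _ hlin (power_series_expansion r hr)), hconv.
      rewrite <- (has_expansion_power_series _ _ q hsub hq). hring. }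
  destruct (slice_regular_expansion _ hreg) as [g hg].
  replace r with g; [exact hg|].
  assert (conv (linear (- p)%H (RtoH 1)) g = conv (linear (- p)%H (RtoH 1)) r) as E.
  { rewrite hconv. apply (has_expansion_unique (fun q => f q + - f p)%H); [|exact hsub].
    apply has_expansion_ext with (power_series (conv (linear (- p)%H (RtoH 1)) g)).
    - intros q hq. rewrite (hdq q hq), (star_conv _ _ _ _ hlin hg). hring.
    - apply power_series_expansion, tame_conv; [apply tame_linear | exact (has_expansion_tame _ _ hg)]. }
  assert (forall n, (g n - r n)%H = (p * (g (S n) - r (S n)))%H) as hs.
  { intros n. assert (En := f_equal (fun s => s (S n)) E). cbn beta in En.
    rewrite !conv_linear_S in En.
    apply Hsub_eq0. transitivity ((RtoH 1 * g n + - p * g (S n)) - (RtoH 1 * r n + - p * r (S n)))%H; [hring|].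
    rewrite En. hring. }
  assert (p * (g O - r O) = RtoH 0)%H as h0.
  { assert (En := f_equal (fun s => s O) E). cbn [conv linear] in En.
    transitivity (- (- p * g O - - p * r O))%H; [hring|]. rewrite En. hring. }
  destruct (Req_dec (Hnorm p) 0) as [hp0|hp0].
  - apply Hnorm_eq0 in hp0. apply functional_extensionality; intros n.
    apply Hsub_eq0. rewrite hs, hp0. hring.
  - assert (p <> RtoH 0) as hpn by (intros ->; apply hp0, Hnorm_0).
    assert (forall n, (g n - r n)%H = RtoH 0) as hn.
    { induction n as [|n IH]; apply (Hmul_eq0 p); trivial. rewrite <- hs. exact IH. }
    apply functional_extensionality; intros n. apply Hsub_eq0, hn.
Qed.

(** * The regular reciprocal *)

Lemma power_series_rmul_value a c q :
  tame a -> in_ball q -> power_series (rmul a c) q = (power_series a q * c)%H.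
Proof.
  intros ha hq. apply HSeries_unique, is_series_Hlim. intros eps heps.
  pose proof (Hnorm_ge0 c).
  assert (0 < eps / (1 + Hnorm c)) as h1 by (apply Rdiv_lt_0_compat; lra).
  destruct (power_series_Hlim a q ha hq _ h1) as [N hN]. exists N; intros n hn; specialize (hN n hn).
  assert (hsum (fun m => Hpow q m * rmul a c m) n = hsum (fun m => Hpow q m * a m) n * c)%H as ->.
  { clear. induction n as [|n IH]; cbn [hsum]; [hring|]. rewrite IH. unfold rmul. hring. }
  set (S := hsum _ n) in *. set (T := power_series a q) in *.
  replace (S * c - T * c)%H with ((S - T) * c)%H by hring. rewrite Hnorm_mul.
  apply (proj2 (Rlt_div_r _ _ (1 + Hnorm c) ltac:(lra))) in hN.
  pose proof (Hnorm_ge0 (S - T)%H). nra.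
Qed.

(** Real coefficients commute with everything, so the regular product with such a series
    is the pointwise one. *)
Lemma power_series_real_mul s e q :
  tame s -> tame e -> (forall n, s n = RtoH (re (s n))) -> in_ball q ->
  power_series (conv e s) q = (power_series s q * power_series e q)%H.
Proof.
  intros hs he hre hq. rewrite power_series_conv by assumption.
  rewrite <- power_series_rmul_value by assumption. f_equal.
  apply functional_extensionality; intros n. unfold lmul, rmul. rewrite (hre n). symmetry; apply RtoH_comm.
Qed.

(** The symmetrization s = b * conj(b) has real coefficients, hence is central, and
    e * s = conj(b).  It has no zero, since conj(e) * e is a regular inverse of s
    converging in the whole ball. *)
Lemma star_inv_expansion F b e :
  has_expansion F b -> tame e -> conv b e = delta (RtoH 1) -> conv e b = delta (RtoH 1) ->
  has_expansion (star_inv F) e.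
Proof.
  intros hF he hbe heb. pose proof (has_expansion_tame F b hF) as hb.
  assert (tame (conjseq b)) as hbc by (now apply tame_conj).
  assert (regular_conj F = power_series (conjseq b)) as hFc.
  { unfold regular_conj. now rewrite (coef_eq F b hF). }
  set (s := conv b (conjseq b)).
  assert (symmetrization F = power_series s) as hFs.
  { unfold symmetrization. rewrite hFc. apply star_conv; [exact hF | now apply power_series_expansion]. }
  assert (tame s) as hs by (now apply tame_conv).
  assert (conjseq s = s) as hsc.
  { unfold s. rewrite conv_conj. f_equal. apply functional_extensionality; intros n. apply Hconj_conj. }
  assert (forall n, s n = RtoH (re (s n))) as hre.
  { intros n. assert (E := f_equal (fun u => u n) hsc). unfold conjseq in E. cbn beta in E.
    destruct (s n) as [[[u v] w] t].
    assert (E1 := f_equal im_i E). assert (E2 := f_equal im_j E). assert (E3 := f_equal im_k E).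
    cbv [Hconj re im_i im_j im_k fst snd] in E1, E2, E3.
    apply H_ext; cbv [RtoH re im_i im_j im_k fst snd]; lra. }
  assert (conv e s = conjseq b) as hes.
  { unfold s. rewrite conv_assoc, heb. apply conv_delta1_l. }
  set (sig := conv (conjseq e) e).
  assert (conv sig s = delta (RtoH 1)) as hsig.
  { rewrite <- (conv_real_comm s sig hre). unfold s, sig.
    rewrite <- conv_assoc, (conv_assoc (conjseq b)), <- conv_conj, heb.
    replace (conjseq (delta (RtoH 1))) with (delta (RtoH 1)); [now rewrite conv_delta1_l|].
    apply functional_extensionality; intros [|n]; unfold conjseq; cbn [delta]; hring. }
  assert (tame sig) as hsigt by (apply tame_conv; [now apply tame_conj | exact he]).
  apply has_expansion_ext with (power_series e); [|now apply power_series_expansion].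
  intros q hq. unfold star_inv. rewrite hFc, hFs, <- hes.
  rewrite power_series_real_mul by assumption.
  assert (power_series s q * power_series sig q = RtoH 1)%H as hnz.
  { rewrite <- power_series_real_mul, hsig by assumption.
    symmetry; apply (has_expansion_power_series (fun _ => RtoH 1)); [apply expansion_const | exact hq]. }
  rewrite Hmul_assoc, Hinv_l, Hmul_1l; [reflexivity|].
  intros E. rewrite E, Hmul_0l in hnz. assert (E1 := f_equal re hnz).
  cbv [RtoH re fst] in E1. lra.
Qed.

(** * The hyperbolic difference quotient is a contraction *)

Lemma contraction_bounded a : left_contraction a -> forall n, Hnorm (a n) <= 1.
Proof.
  intros ha n. apply Hnorm_le_sq; [lra|].
  assert (sqsum (delta (RtoH 1)) (S n) = 1) as h.
  { induction n as [|n IH]; cbn [sqsum delta] in *; [hunf; ring|]. rewrite IH. hunf; ring. }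
  pose proof (ha (delta (RtoH 1)) (S n)) as h1. rewrite conv_delta1_r in h1.
  pose proof (sqsum_term a n (S n) ltac:(lia)). lra.
Qed.

(** Schwarz lemma: multiplication by q is isometric. *)
Lemma shift_contraction a : left_contraction a -> a O = RtoH 0 -> l2_contraction (shift a).
Proof.
  intros ha h0 x K hx n.
  assert (shift (conv a x) = conv (shift a) x) as E.
  { apply functional_extensionality; intros k. unfold shift at 1. cbn [conv]. rewrite h0. hring. }
  rewrite <- E. pose proof (sqsum_shift (conv a x) n) as h1.
  pose proof (Hsq_ge0 (conv a x O)). pose proof (ha x (S n)). specialize (hx (S n)). lra.
Qed.

(** With v = a * u, the cross terms of |u - conj(c) v|^2 and |v - c u|^2 are equal. *)
Lemma moebius_identity a c u n :
  sqsum (addseq u (lmul (- Hconj c)%H (conv a u))) n - sqsum (addseq (conv a u) (lmul (- c)%H u)) n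
  = (1 - Hsq c) * (sqsum u n - sqsum (conv a u) n).
Proof.
  induction n as [|n IH]; cbn [sqsum]; [ring|].
  set (v := conv a u) in *.
  assert (Hsq (addseq u (lmul (- Hconj c)%H v) n) - Hsq (addseq v (lmul (- c)%H u) n)
    = (1 - Hsq c) * (Hsq (u n) - Hsq (v n))); [|lra].
  unfold addseq, lmul. generalize (u n) (v n); intros x y.
  destruct c as [[[? ?] ?] ?], x as [[[? ?] ?] ?], y as [[[? ?] ?] ?].
  cbv [Hsq Hadd Hopp Hmul Hconj re im_i im_j im_k fst snd]. ring.
Qed.

(** Multiplication by 1 - conj(c) * a is bounded below.  The termwise bound replaces
    the triangle inequality for the square norm and avoids square roots. *)
Lemma moebius_lower a c u n :
  left_contraction a -> in_ball c ->
  (1 - Hnorm c) ^ 2 * sqsum u n <= sqsum (addseq u (lmul (- Hconj c)%H (conv a u))) n.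
Proof.
  intros ha hc. unfold in_ball in hc. pose proof (Hnorm_ge0 c). set (k := Hnorm c) in *.
  assert ((1 - k) * sqsum u n - k * (1 - k) * sqsum (conv a u) n
    <= sqsum (addseq u (lmul (- Hconj c)%H (conv a u))) n) as h1.
  { set (v := conv a u). clearbody v. induction n as [|n IH]; cbn [sqsum]; [lra|].
    assert ((1 - k) * Hsq (u n) - k * (1 - k) * Hsq (v n)
      <= Hsq (addseq u (lmul (- Hconj c)%H v) n)); [|lra].
    unfold addseq, lmul. set (x := u n). set (y := v n).
    pose proof (Hnorm_triangle (x + - Hconj c * y)%H (Hconj c * y)%H) as t1.
    pose proof (Hnorm_triangle (- (x + - Hconj c * y))%H x) as t2.
    replace (x + - Hconj c * y + Hconj c * y)%H with x in t1 by hring.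
    replace (- (x + - Hconj c * y) + x)%H with (Hconj c * y)%H in t2 by hring.
    rewrite Hnorm_opp in t2. rewrite Hnorm_mul, Hnorm_conj in t1, t2. fold k in t1, t2.
    rewrite <- !Hnorm_sq. set (w := Hnorm (x + - Hconj c * y)%H) in *.
    pose proof (Hnorm_ge0 (x + - Hconj c * y)%H : 0 <= w).
    pose proof (Hnorm_ge0 x). pose proof (Hnorm_ge0 y).
    assert ((Hnorm x - k * Hnorm y) ^ 2 <= w ^ 2) by nra.
    assert (0 <= k * (Hnorm x - Hnorm y) ^ 2) by (apply Rmult_le_pos; [lra | apply pow2_ge_0]).
    nra. }
  pose proof (ha u n). pose proof (sqsum_ge0 u n).
  assert (k * (1 - k) * sqsum (conv a u) n <= k * (1 - k) * sqsum u n) by (apply Rmult_le_compat_l; nra).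
  nra.
Qed.

Lemma sqsum_bounded_small y K eps :
  (forall n, sqsum y n <= K) -> 0 < eps -> exists N, forall n, (N <= n)%nat -> Hnorm (y n) <= eps.
Proof.
  intros hK heps.
  destruct (ex_finite_lim_seq_incr (sqsum y) K) as [l hl].
  - intros n; apply sqsum_mono; lia.
  - exact hK.
  - assert (0 < eps ^ 2 / 2) as he by nra.
    destruct (proj2 (is_lim_seq_spec _ _) hl (mkposreal _ he)) as [N hN]. exists N; intros n hn.
    pose proof (hN n hn) as h1. pose proof (hN (S n) ltac:(lia)) as h2. simpl in h1, h2.
    apply Rabs_lt_between in h1, h2. apply Hnorm_le_sq; lra.
Qed.

(** The norms of w - conj(p) q w and of q w - p w, truncated at degree n, differ by
    (1 - |p|^2) |w_n|^2.  That term tends to 0: the terms of q w - p w tend to 0, and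
    w_n = y_(n+1) + p w_(n+1) with w of subexponential growth expresses w_n as a
    geometric average of later terms. *)
Lemma blaschke_division p w K :
  in_ball p -> tame w -> (forall n, sqsum (conv (linear (- p)%H (RtoH 1)) w) n <= K) ->
  forall n, sqsum (conv (linear (RtoH 1) (- Hconj p)%H) w) n <= K.
Proof.
  intros hp hw hy. unfold in_ball in hp. pose proof (Hnorm_ge0 p) as hp0.
  set (y := conv (linear (- p)%H (RtoH 1)) w) in *.
  set (z := conv (linear (RtoH 1) (- Hconj p)%H) w).
  assert (forall n, sqsum z (S n) = sqsum y (S n) + (1 - Hsq p) * Hsq (w n)) as hid.
  { induction n as [|n IH].
    - cbn [sqsum]. unfold z, y. cbn [conv linear]. generalize (w O); intros u. rewrite !Hsq_mul.
      replace (Hsq (RtoH 1)) with 1 by (hunf; ring). replace (Hsq (- p)%H) with (Hsq p) by (hunf; ring). ring.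
    - cbn [sqsum] in *. rewrite IH.
      assert (z (S n) = (- Hconj p * w n + RtoH 1 * w (S n))%H) as -> by apply conv_linear_S.
      assert (y (S n) = (RtoH 1 * w n + - p * w (S n))%H) as -> by apply conv_linear_S.
      generalize (w n) (w (S n)) (sqsum y n) (Hsq (y n)); intros u v r1 r2. clear.
      destruct p as [[[? ?] ?] ?], u as [[[? ?] ?] ?], v as [[[? ?] ?] ?].
      cbv [Hsq Hadd Hopp Hmul Hconj RtoH re im_i im_j im_k fst snd]. ring. }
  assert (forall eps, 0 < eps -> exists N, forall n, (N <= n)%nat -> Hnorm (w n) <= eps) as hw0.
  { intros eps heps. assert (0 < eps * (1 - Hnorm p)) as he by (apply Rmult_lt_0_compat; lra).
    destruct (sqsum_bounded_small y K _ hy he) as [N hN]. exists N; intros n hn.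
    assert (forall k, Hnorm (w n) <= eps + Hnorm p ^ k * Hnorm (w (n + k)%nat)) as hk.
    { assert (forall k, Hnorm (w n) <= eps * (1 - Hnorm p ^ k) + Hnorm p ^ k * Hnorm (w (n + k)%nat)) as h.
      { induction k as [|k IH]; [rewrite Nat.add_0_r; simpl; lra|].
        specialize (hN (S (n + k)) ltac:(lia)). unfold y in hN. rewrite conv_linear_S in hN.
        rewrite Nat.add_succ_r. cbn [pow].
        pose proof (Hnorm_triangle (RtoH 1 * w (n + k)%nat + - p * w (S (n + k)))%H (p * w (S (n + k)))%H) as ht.
        rewrite (Hnorm_mul p) in ht.
        replace (RtoH 1 * w (n + k)%nat + - p * w (S (n + k)) + p * w (S (n + k)))%H
          with (w (n + k)%nat) in ht by hring.
        pose proof (pow_le (Hnorm p) k hp0).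
        assert (Hnorm p ^ k * Hnorm (w (n + k)%nat)
          <= Hnorm p ^ k * (eps * (1 - Hnorm p) + Hnorm p * Hnorm (w (S (n + k))))).
        { apply Rmult_le_compat_l; lra. }
        nra. }
      intros k. specialize (h k). pose proof (pow_le (Hnorm p) k hp0). nra. }
    set (rho := (1 + Hnorm p) / 2).
    destruct (hw rho ltac:(unfold rho; lra)) as [C [hC hb]].
    assert (0 < rho) as hrho by (unfold rho; lra).
    apply Rnot_lt_le; intros hlt.
    destruct (pow_small (Hnorm p / rho) (C / rho ^ n) (Hnorm (w n) - eps)) as [k hkk].
    { split; [apply Rdiv_le_0_compat; lra|]. apply Rlt_div_l; unfold rho; lra. }
    { lra. }
    specialize (hkk k (le_n _)). specialize (hk k). specialize (hb (n + k)%nat).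
    assert (Hnorm p ^ k * Hnorm (w (n + k)%nat) <= C / rho ^ n * (Hnorm p / rho) ^ k); [|lra].
    unfold Rdiv. rewrite Rpow_mult_distr, pow_inv.
    pose proof (pow_lt rho n hrho). pose proof (pow_lt rho k hrho).
    replace (C * / rho ^ n * (Hnorm p ^ k * / rho ^ k)) with (Hnorm p ^ k * (C / rho ^ (n + k)))
      by (rewrite pow_add; field; lra).
    apply Rmult_le_compat_l; [now apply pow_le|].
    apply (proj1 (Rle_div_r _ _ (rho ^ (n + k)) (pow_lt _ _ hrho))). exact hb. }
  intros n. apply Rnot_lt_le; intros hlt.
  destruct (hw0 (Rmin 1 ((sqsum z n - K) / 2))) as [N hN].
  { apply Rmin_glb_lt; lra. }
  specialize (hN (N + n)%nat ltac:(lia)).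
  pose proof (sqsum_mono z n (S (N + n)) ltac:(lia)) as h1. rewrite hid in h1.
  specialize (hy (S (N + n))).
  pose proof (Rmin_l 1 ((sqsum z n - K) / 2)). pose proof (Rmin_r 1 ((sqsum z n - K) / 2)).
  pose proof (Hnorm_ge0 (w (N + n)%nat)).
  pose proof (Hsq_ge0 p). rewrite <- (Hnorm_sq (w (N + n)%nat)) in h1. nra.
Qed.

Lemma hyperbolic_quotient_contraction f a p :
  has_expansion f a -> left_contraction a -> a O = RtoH 0 -> in_ball p -> in_ball (f p) ->
  exists h, tame h /\ l2_contraction h /\ h O = power_series (shift a) p /\
    hyperbolic_difference_quotient f p = power_series h.
Proof.
  intros hf ha h0 hp hfp. set (c := f p) in *. set (r := quotient_coef a p).
  pose proof (contraction_bounded a ha) as hb1.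
  destruct (difference_quotient_expansion f a p hf hb1 hp) as [hr hR]. fold r in hr, hR. fold c in hr.
  assert (tame r) as hrt by (exact (has_expansion_tame _ _ hR)).
  set (b := addseq (delta (RtoH 1)) (lmul (- Hconj c)%H a)).
  assert (b O = RtoH 1) as hb0.
  { unfold b, addseq, lmul; cbn [delta]. rewrite h0. hring. }
  destruct (conv_inverse b hb0) as [e [hbe heb]].
  assert (forall u, conv b u = addseq u (lmul (- Hconj c)%H (conv a u))) as hbu.
  { intros u. apply functional_extensionality; intros n. unfold b.
    rewrite conv_addl, conv_delta_l, conv_lmul. unfold addseq, lmul. hring. }
  assert (tame e) as het.
  { pose proof (Hnorm_ge0 c). unfold in_ball in hfp. apply tame_bounded with (/ (1 - Hnorm c)). intros n.
    assert (sqsum (delta (RtoH 1)) (S n) = 1) as h1.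
    { clear. induction n as [|n IH]; cbn [sqsum delta] in *; [hunf; ring|]. rewrite IH. hunf; ring. }
    pose proof (moebius_lower a c e (S n) ha hfp) as h2. rewrite <- hbu, hbe, h1 in h2.
    pose proof (sqsum_term e n (S n) ltac:(lia)) as h3.
    apply Hnorm_le_sq; [left; apply Rinv_0_lt_compat; lra|].
    rewrite pow_inv. replace (/ (1 - Hnorm c) ^ 2) with (1 / (1 - Hnorm c) ^ 2) by (field; lra).
    apply (proj1 (Rle_div_r _ _ ((1 - Hnorm c) ^ 2) ltac:(nra))).
    apply Rle_trans with (sqsum e (S n) * (1 - Hnorm c) ^ 2); [apply Rmult_le_compat_r; [nra | exact h3] | lra]. }
  set (den := linear (RtoH 1) (- Hconj p)%H).
  assert (tame (conv den r)) as hdr by (apply tame_conv; [apply tame_linear | exact hrt]).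
  exists (conv (conv den r) e). split; [now apply tame_conv|]. split; [|split].
  - intros x K hx n. set (w := conv r (conv e x)).
    assert (conv (conv (conv den r) e) x = conv den w) as -> by (unfold w; now rewrite !conv_assoc).
    apply blaschke_division; [exact hp | |].
    + apply tame_conv; [exact hrt|]. apply tame_conv; [exact het|].
      apply tame_bounded with (sqrt K). intros m. unfold Hnorm. apply sqrt_le_1_alt.
      eapply Rle_trans; [apply (sqsum_term x m (S m)); lia | apply hx].
    + intros m. set (u := conv e x) in *.
      assert (conv (linear (- p)%H (RtoH 1)) w = addseq (conv a u) (lmul (- c)%H u)) as ->.
      { unfold w. rewrite conv_assoc, hr. apply functional_extensionality; intros k.
        rewrite conv_addl, conv_delta_l. reflexivity. }
      assert (addseq u (lmul (- Hconj c)%H (conv a u)) = x) as hx'.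
      { rewrite <- hbu. unfold u. rewrite conv_assoc, hbe. apply conv_delta1_l. }
      pose proof (moebius_identity a c u m) as h1. rewrite hx' in h1.
      pose proof (ha u m). assert (Hsq c < 1) by (now apply in_ball_sq).
      specialize (hx m). assert (0 <= (1 - Hsq c) * (sqsum u m - sqsum (conv a u) m)) by (apply Rmult_le_pos; lra).
      lra.
  - assert (e O = RtoH 1) as he0.
    { assert (E := f_equal (fun s => s O) hbe). cbn [conv delta] in E. now rewrite hb0, Hmul_1l in E. }
    cbn [conv]. rewrite he0. unfold den; cbn [linear]. rewrite Hmul_1r, Hmul_1l. reflexivity.
  - unfold hyperbolic_difference_quotient.
    assert (has_expansion (fun q => RtoH 1 - q * Hconj p)%H den) as hden.
    { eapply has_expansion_ext; [|apply expansion_linear]. intros; cbn beta; hring. }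
    rewrite (star_conv _ _ _ _ hden hR).
    apply star_conv; [now apply power_series_expansion|].
    apply star_inv_expansion with b; trivial. fold c.
    rewrite (star_conv _ _ _ _ (expansion_const (Hconj c)) hf).
    assert (has_expansion (power_series (conv (delta (Hconj c)) a)) (lmul (Hconj c) a)) as h1.
    { replace (conv (delta (Hconj c)) a) with (lmul (Hconj c) a)
        by (apply functional_extensionality; intros n; symmetry; apply conv_delta_l).
      apply power_series_expansion, tame_lmul. exact (has_expansion_tame _ _ hf). }
    pose proof (expansion_add _ _ _ _ (expansion_const (RtoH 1)) (expansion_opp _ _ h1)) as h2.
    replace b with (addseq (delta (RtoH 1)) (lmul (RtoH (-1)) (lmul (Hconj c) a))); [exact h2|].
    apply functional_extensionality; intros n. unfold b, addseq, lmul. f_equal. hring.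
Qed.

Theorem proposition3p7 :
  forall f : H -> H,
    slice_regular f ->
    (forall q : H, in_ball q -> in_ball (f q)) ->
    f (RtoH 0) = RtoH 0 ->
    forall q0 : H, in_ball q0 ->
      let d := Hnorm (cullen_derivative f (RtoH 0)) in
      let t := 2 * Hnorm q0 / (1 + Hnorm q0 ^ 2) in
      Hnorm (hyperbolic_derivative f q0) <= (d + t) / (1 + d * t).
Proof.
  intros f hreg hball hf0 p hp d t.
  destruct (slice_regular_expansion f hreg) as [a hf].
  assert (in_ball (RtoH 0)) as h0b by (unfold in_ball; rewrite Hnorm_0; lra).
  assert (a O = RtoH 0) as ha0.
  { rewrite <- (power_series_at_0 a), <- (has_expansion_power_series f a _ hf h0b). exact hf0. }
  assert (left_contraction a) as ha.
  { apply right_left_contraction, (bounded_right_contraction f a hf).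
    intros q hq. left. exact (hball q hq). }
  assert (d = Hnorm (shift a O)) as hd by (unfold d; now rewrite (cullen_derivative_0 f a hf)).
  assert (tame (shift a)) as hst by (exact (tame_shift a (has_expansion_tame f a hf))).
  destruct (schwarz_pick (shift a) p hst (shift_contraction a ha ha0) hp) as [hd1 hB].
  rewrite <- hd in hd1, hB.
  destruct (hyperbolic_quotient_contraction f a p hf ha ha0 hp (hball p hp)) as [h [hht [hhc [hh0 hh]]]].
  destruct (schwarz_pick h p hht hhc hp) as [_ hA]. rewrite hh0 in hA.
  unfold hyperbolic_derivative. rewrite hh.
  unfold in_ball in hp. pose proof (Hnorm_ge0 p) as hp0. unfold t.
  assert (0 <= d) as hd0 by apply Hnorm_ge0. pose proof (Hnorm_ge0 (power_series (shift a) p)) as hB0.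
  clearbody d. set (tau := Hnorm p) in *. set (B := Hnorm (power_series (shift a) p)) in *.
  eapply Rle_trans; [exact hA|].
  assert (0 < 1 + d * tau) by nra. assert (0 < 1 + B * tau) by nra.
  replace ((d + 2 * tau / (1 + tau ^ 2)) / (1 + d * (2 * tau / (1 + tau ^ 2))))
    with ((d * (1 + tau ^ 2) + 2 * tau) / (1 + tau ^ 2 + 2 * (d * tau))) by (field; split; nra).
  apply (proj2 (Rle_div_r _ _ (1 + d * tau) ltac:(lra))) in hB.
  apply Rle_div_l; [lra|].
  apply (Rmult_le_reg_r (1 + tau ^ 2 + 2 * (d * tau))); [nra|].
  replace ((d * (1 + tau ^ 2) + 2 * tau) / (1 + tau ^ 2 + 2 * (d * tau)) * (1 + B * tau) * (1 + tau ^ 2 + 2 * (d * tau)))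
    with ((d * (1 + tau ^ 2) + 2 * tau) * (1 + B * tau)) by (field; nra).
  assert (0 <= (1 - tau ^ 2) * (d + tau - B * (1 + d * tau))) by (apply Rmult_le_pos; nra).
  nra.
Qed.
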